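(* Let $n\in\mathbb{N}$, let $\Gamma$ be a group of type $\mathrm{FP}_{n+1}$, and let $\alpha$ be a standard $\Gamma$-action. Let $Z$ be $\mathbb{Z}$ or a finite field. Moreover, let $\varepsilon\in\mathbb{R}_{>0}$. Then: (i) There exists an ergodic standard $\Gamma$-action $\beta$ with $\mathrm{medim}^Z_n(\beta)\le\mathrm{medim}^Z_n(\alpha)+\varepsilon$. (ii) There exists an ergodic standard $\Gamma$-action $\beta$ with $\mathrm{mevol}_n(\beta)\le\mathrm{mevol}_n(\alpha)+\varepsilon$.
   Context: $\mathbb{N}$ contains $0$. $Z$ denotes $\mathbb{Z}$ with the usual absolute value or a finite field with the trivial norm ($|0|=0$, $|x|=1$ for $x\neq 0$). A group $\Gamma$ is of type $\mathrm{FP}_m$ if the trivial $\mathbb{Z}\Gamma$-module $\mathbb{Z}$ has a projective resolution that is finitely generated in degrees $\le m$. Standard actions. A standard $\Gamma$-action $\alpha\colon\Gamma\curvearrowright(X,\mu)$ is an essentially free, probability measure preserving action of a countable group on a standard Borel probability space. $L^\infty(\alpha,Z)=L^\infty(X,\mu,Z)$ is the ring of essentially bounded measurable functions $X\to Z$ modulo a.e. equality, with $(\gamma\cdot\lambda)(x)=\lambda(\gamma^{-1}x)$. The crossed product ring $R=L^\infty(\alpha,Z)*\Gamma$ is the free $L^\infty(\alpha,Z)$-module with basis $\Gamma$ (elements are finite sums of terms $(\lambda,\gamma)$) with multiplication $(\lambda,\gamma)(\lambda',\gamma')=(\lambda\cdot(\gamma\cdot\lambda'),\gamma\gamma')$.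 It contains $Z\Gamma$ via $\gamma\mapsto(1,\gamma)$ and acts on $L^\infty(\alpha,Z)$ by $(\lambda,\gamma)\cdot f=\lambda\cdot(\gamma\cdot f)$. Marked modules. For measurable $A\subset X$ put $\langle A\rangle=R\cdot(\chi_A,1)$. A marked projective $R$-module is an $R$-module $M$ with a finite family $(A_i)_{i\in I}$ of measurable subsets of $X$ and an isomorphism $M\cong\bigoplus_{i\in I}\langle A_i\rangle$ (suppressed from notation); $\dim_R(M)=\sum_i\mu(A_i)$. On $R$ let $|\sum_\gamma(\lambda_\gamma,\gamma)|_1=\sum_\gamma\int_X|\lambda_\gamma|\,d\mu$; elements of $M\subset\bigoplus_I R$ have norm $\|\sum_i\lambda_ie_i\|_1=\sum_i|\lambda_i|_1$. For an $R$-homomorphism $f\colon M\to N$ of marked projective modules, $\|f\|$ is the least $c$ with $\|f(z)\|_1\le c\|z\|_1$ for all $z$ (always finite). A marked direct summand of $\bigoplus_j\langle B_j\rangle$ is a submodule $\bigoplus_j\langle B_j'\rangle$ with $B_j'\subset B_j$ measurable. A finite marked decomposition of $M=\bigoplus_i\langle A_i\rangle$ is a finite family $(M_k)_k$ with $M_k=\bigoplus_i\langle A_{i,k}\rangle$ for measurable partitions $A_i=\bigsqcup_kA_{i,k}$. Logarithmic norm. $\log_+(t)=\max\{\log t,0\}$ (and $\log_+0=0$). $\mathrm{rk}(f)=\inf\{\dim N'\mid N'\subset N\text{ marked direct summand with }f(M)\subset N'\}$; $\mathrm{lognorm}'(f)=\min\{\dim(M)\log_+\|f\|,\ \mathrm{rk}(f)\log_+\|f\|\}$;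 $\mathrm{lognorm}(f)=\inf\sum_k\mathrm{lognorm}'(f|_{M_k}\colon M_k\to N)$, the infimum over all finite marked decompositions $(M_k)_k$ of $M$. Measured embeddings. A marked projective augmented $R$-chain complex $D_*\twoheadrightarrow L^\infty(\alpha,Z)$ is a chain complex $(D_k)_{k\ge0}$ of marked projective $R$-modules with a surjective $R$-homomorphism $\eta\colon D_0\to L^\infty(\alpha,Z)$, $\eta\circ\partial_1=0$. Fix a free $Z\Gamma$-resolution $C_*\twoheadrightarrow Z$ (the following is independent of the choice). An $\alpha$-embedding (up to degree $n$) is such a complex together with a $Z\Gamma$-chain map $C_*\to D_*$ up to degree $n+1$ extending the inclusion $Z\to L^\infty(\alpha,Z)$ as constant functions. $A_n(\alpha)$ is the class of all augmented complexes $D_*$ arising in this way. For $\Gamma$ of type $\mathrm{FP}_{n+1}$: $\mathrm{medim}^Z_n(\alpha)=\inf_{D_*\in A_n(\alpha)}\dim_R(D_n)$, and (for $Z=\mathbb{Z}$) $\mathrm{mevol}_n(\alpha)=\inf_{D_*\in A_n(\alpha)}\mathrm{lognorm}(\partial^D_{n+1})$. *)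

(* Defs.v *)
From HB Require Import structures.
From mathcomp Require Import all_boot all_order all_algebra.
From mathcomp Require Import generic_quotient ring_quotient.
From mathcomp Require Import all_classical all_reals all_analysis.

Set Implicit Arguments.
Unset Strict Implicit.
Unset Printing Implicit Defensive.

Import Order.TTheory GRing.Theory Num.Theory.
Import numFieldNormedType.Exports.

Local Open Scope classical_set_scope.
Local Open Scope ring_scope.

Record ring_action (G : groupType) (L : comNzRingType) := RingAction {
  ract :> G -> {rmorphism L -> L};
  ract1 : forall x, ract 1%g x = x;
  ractM : forall g h x, ract (g * h)%g x = ract g (ract h x)
}.

Section CrossedProduct.
Context {G : groupType} {L : comNzRingType}.

Definition finitely_supported : {pred G -> L} :=
  fun r => `[< finite_set [set g | r g != 0] >].

Lemma finitely_supportedP (r : G -> L) :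
  reflect (exists2 s : seq G, uniq s & forall g, r g != 0 -> g \in s)
          (r \in finitely_supported).
Proof.
apply: (iffP (asboolP _)) => [fs|[s _ rs]].
  exists (finmap.enum_fset (fset_set [set g | r g != 0])).
    exact: finmap.fset_uniq.
  by move=> g rg; rewrite in_fset_set//; exact/mem_set.
apply: (@sub_finite_set _ _ [set` s]) => [g /rs//|].
exact: finite_seq.
Qed.

Lemma finitely_supported_zmod : zmod_closed finitely_supported.
Proof.
split=> [|r t /finitely_supportedP[s _ rs] /finitely_supportedP[s' _ ts']].
  by apply/finitely_supportedP; exists [::] => // g; rewrite eqxx.
apply/finitely_supportedP; exists (undup (s ++ s')); first exact: undup_uniq.
move=> g; rewrite mem_undup mem_cat; apply: contraR; rewrite negb_or.
move=> /andP[gs gs'].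
have r0 : r g = 0 by apply/eqP; apply: contraR gs => /rs.
have t0 : t g = 0 by apply/eqP; apply: contraR gs' => /ts'.
by rewrite /GRing.add /= /GRing.opp /= r0 t0 subr0.
Qed.

HB.instance Definition _ := GRing.isZmodClosed.Build (G -> L)
  finitely_supported finitely_supported_zmod.

Lemma fsumE (V : nmodType) (F : G -> V) (s : seq G) :
  uniq s -> (forall g, F g != 0 -> g \in s) ->
  \sum_(g \in [set: G]) F g = \sum_(g <- s) F g.
Proof.
move=> us Fs; rewrite (fsbigE s)//; first by apply: eq_bigl => g; rewrite in_setT.
move=> g _ gs.
by apply/eqP; apply: contraR gs => /Fs.
Qed.

End CrossedProduct.

(* [L * G]: the finitely supported functions [r], standing for the finite
   sums of the terms [(r g, g)]. *)
Record crossed (G : groupType) (L : comNzRingType) (a : ring_action G L) :=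
  Crossed { ccoef : G -> L; _ : ccoef \in finitely_supported }.

Section CrossedRing.
Context {G : groupType} {L : comNzRingType} {a : ring_action G L}.

HB.instance Definition _ := [isSub for @ccoef G L a].
HB.instance Definition _ := [Choice of crossed a by <:].
HB.instance Definition _ := [SubChoice_isSubZmodule of crossed a by <:].

Lemma crossedP (r t : crossed a) : ccoef r =1 ccoef t -> r = t.
Proof. by move=> rt; apply: val_inj; apply/funext. Qed.

Lemma ccoefD (r t : crossed a) g : ccoef (r + t) g = ccoef r g + ccoef t g.
Proof. by []. Qed.

Lemma ccoef_supp (r : crossed a) :
  exists2 s : seq G, uniq s & forall g, ccoef r g != 0 -> g \in s.
Proof. by case: r => r rP; exact/finitely_supportedP. Qed.

(* The product of [crossed a], with [F] not necessarily finitely supported so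
   that it also gives the action of [crossed a] on constant functions. *)
Definition crossed_conv (r F : G -> L) (g : G) : L :=
  \sum_(h \in [set: G]) r h * a h (F (h^-1 * g)%g).

Lemma crossed_convE r F g (s : seq G) : uniq s ->
  (forall h, r h != 0 -> h \in s) ->
  crossed_conv r F g = \sum_(h <- s) r h * a h (F (h^-1 * g)%g).
Proof.
move=> us rs; apply: fsumE => // h; apply: contraNT => hs.
suff -> : r h = 0 by rewrite mul0r.
by apply/eqP; apply: contraR hs => /rs.
Qed.

Lemma crossed_conv_subproof (r t : crossed a) :
  crossed_conv (ccoef r) (ccoef t) \in finitely_supported.
Proof.
have [s us rs] := ccoef_supp r; have [s' us' ts'] := ccoef_supp t.
apply/finitely_supportedP.
exists (undup [seq (h * k)%g | h <- s, k <- s']); first exact: undup_uniq.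
move=> g; rewrite mem_undup; apply: contraR => gs.
rewrite (crossed_convE _ _ us rs) big1_seq// => h /andP[_ hs].
suff -> : ccoef t (h^-1 * g)%g = 0 by rewrite rmorph0 mulr0.
apply/eqP; apply: contraR gs => /ts' ks.
by apply/allpairsP; exists (h, (h^-1 * g)%g); split => //=; rewrite mulVKg.
Qed.

Lemma crossed_convA (r t : crossed a) (F : G -> L) g :
  crossed_conv (ccoef r) (crossed_conv (ccoef t) F) g =
  crossed_conv (crossed_conv (ccoef r) (ccoef t)) F g.
Proof.
have [s us rs] := ccoef_supp r; have [s' us' ts'] := ccoef_supp t.
pose u := undup [seq (h * k)%g | h <- s, k <- s'].
have uu : uniq u by exact: undup_uniq.
have supp_u h k : h \in s -> ccoef t (h^-1 * k)%g != 0 -> k \in u.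
  move=> hs /ts' ks; rewrite mem_undup; apply/allpairsP.
  by exists (h, (h^-1 * k)%g); split => //=; rewrite mulVKg.
rewrite (crossed_convE _ _ us rs) (@crossed_convE _ _ _ u)//; last first.
  move=> k; rewrite (crossed_convE _ _ us rs); apply: contraR => ku.
  rewrite big1_seq// => h /andP[_ hs].
  suff -> : ccoef t (h^-1 * k)%g = 0 by rewrite rmorph0 mulr0.
  by apply/eqP; apply: contraR ku => /(supp_u _ _ hs).
under [RHS]eq_bigr do rewrite (crossed_convE _ _ us rs) mulr_suml.
rewrite exchange_big/=; apply: eq_big_seq => h hs.
pose E k := ccoef r h * a h (ccoef t (h^-1 * k)%g) * a k (F (k^-1 * g)%g).
rewrite -[RHS](@fsumE G _ E)//; last first.
  move=> k; apply: contraNT => ku; rewrite /E.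
  suff -> : ccoef t (h^-1 * k)%g = 0 by rewrite rmorph0 mulr0 mul0r.
  by apply/eqP; apply: contraR ku => /(supp_u _ _ hs).
rewrite (reindex_fsbigT (fun k => h * k)%g); last first.
  by exists (fun k => h^-1 * k)%g => k; rewrite ?mulKg ?mulVKg.
rewrite (@fsumE _ _ _ s')//; last first.
  move=> k; apply: contraNT => ks; rewrite /E mulKg.
  suff -> : ccoef t k = 0 by rewrite rmorph0 mulr0 mul0r.
  by apply/eqP; apply: contraR ks => /ts'.
rewrite (crossed_convE _ _ us' ts') rmorph_sum mulr_sumr.
apply: eq_bigr => k _.
by rewrite /E mulKg rmorphM mulrA invgM ractM mulgA.
Qed.

Lemma single_subproof (x : L) (g : G) :
  (fun h => if h == g then x else 0) \in finitely_supported.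
Proof.
apply/finitely_supportedP; exists [:: g] => // h.
by rewrite inE; case: (h == g); rewrite ?eqxx.
Qed.

(* The term [(x, g)]. *)
Definition single (x : L) (g : G) : crossed a :=
  Crossed a (single_subproof x g).

Definition crossed_mul (r t : crossed a) : crossed a :=
  Crossed a (crossed_conv_subproof r t).
Definition crossed_one : crossed a := single 1 1%g.

Lemma crossed_mulA : associative crossed_mul.
Proof. by move=> r t u; apply: crossedP => g; exact: crossed_convA. Qed.

Lemma conv_single (x : L) h F g :
  crossed_conv (ccoef (single x h)) F g = x * a h (F (h^-1 * g)%g).
Proof.
rewrite (@crossed_convE _ _ _ [:: h])//= ?big_seq1 ?eqxx// => k.
by rewrite inE; case: (k == h); rewrite ?eqxx.
Qed.

Lemma crossed_mul1 : left_id crossed_one crossed_mul.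
Proof.
move=> r; apply: crossedP => g; apply: etrans (conv_single _ _ _ _) _.
by rewrite mul1r ract1 invg1 mul1g.
Qed.

Lemma crossed_mulr1 : right_id crossed_one crossed_mul.
Proof.
move=> r; apply: crossedP => g /=; rewrite /crossed_conv (@fsumE _ _ _ [:: g])//=.
  by rewrite big_seq1 mulVg eqxx rmorph1 mulr1.
move=> h; rewrite inE; apply: contraNT => /negPf hg.
by rewrite mulg_eq1 (inj_eq invg_inj) hg rmorph0 mulr0.
Qed.

Lemma crossed_convDl (r t : crossed a) F g :
  crossed_conv (ccoef (r + t)) F g =
  crossed_conv (ccoef r) F g + crossed_conv (ccoef t) F g.
Proof.
have [s us rs] := ccoef_supp r; have [s' us' ts'] := ccoef_supp t.
pose u := undup (s ++ s'); have uu : uniq u by exact: undup_uniq.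
have ru h : ccoef r h != 0 -> h \in u.
  by rewrite mem_undup mem_cat => /rs ->.
have tu h : ccoef t h != 0 -> h \in u.
  by rewrite mem_undup mem_cat => /ts' ->; rewrite orbT.
rewrite !(@crossed_convE _ _ _ u)//; last first.
  move=> h; rewrite ccoefD; apply: contraNT => hu.
  have -> : ccoef r h = 0 by apply/eqP; apply: contraR hu => /ru.
  have -> : ccoef t h = 0 by apply/eqP; apply: contraR hu => /tu.
  by rewrite addr0.
by rewrite -big_split/=; apply: eq_bigr => h _; rewrite -mulrDl.
Qed.

Lemma crossed_convDr (r : crossed a) E F g :
  crossed_conv (ccoef r) (E + F) g =
  crossed_conv (ccoef r) E g + crossed_conv (ccoef r) F g.
Proof.
have [s us rs] := ccoef_supp r.
rewrite !(crossed_convE _ _ us rs) -big_split/=; apply: eq_bigr => h _.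
by rewrite -mulrDr -rmorphD.
Qed.

Lemma crossed_mulDl : left_distributive crossed_mul +%R.
Proof. by move=> r t u; apply: crossedP => g; exact: crossed_convDl. Qed.

Lemma crossed_mulDr : right_distributive crossed_mul +%R.
Proof. by move=> r t u; apply: crossedP => g; exact: crossed_convDr. Qed.

Lemma crossed_one_neq0 : crossed_one != 0.
Proof.
apply/eqP => /(congr1 (fun r => ccoef r 1%g))/= /eqP.
by rewrite eqxx; exact/negP/oner_neq0.
Qed.

HB.instance Definition _ := GRing.Zmodule_isNzRing.Build (crossed a)
  crossed_mulA crossed_mul1 crossed_mulr1 crossed_mulDl crossed_mulDr
  crossed_one_neq0.

End CrossedRing.

Section AugmentationModule.
Context {G : groupType} {L : comNzRingType}.

(* The ring [L] as a left module over [L * G]: [(x, g) y = x (g . y)]. *)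
Definition aug_module (a : ring_action G L) : Type := L.

Variable a : ring_action G L.

HB.instance Definition _ := GRing.Zmodule.on (aug_module a).

Definition aug_scale (r : crossed a) (x : aug_module a) : aug_module a :=
  \sum_(g \in [set: G]) ccoef r g * a g x.

Lemma aug_scaleE r x : aug_scale r x = @crossed_conv _ _ a (ccoef r) (fun=> x) 1%g.
Proof. by []. Qed.

Lemma crossed_conv_cst r (x : L) :
  @crossed_conv _ _ a r (fun=> x) = fun=> \sum_(g \in [set: G]) r g * a g x.
Proof. by []. Qed.

Lemma aug_scaleA r t x : aug_scale r (aug_scale t x) = aug_scale (r * t) x.
Proof.
by rewrite !aug_scaleE -[RHS](crossed_convA r t) crossed_conv_cst.
Qed.

Lemma aug_scale1 : left_id 1 aug_scale.
Proof.
move=> x; rewrite aug_scaleE; apply: etrans (conv_single _ _ _ _) _.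
by rewrite mul1r ract1.
Qed.

Lemma aug_scaleDr : right_distributive aug_scale +%R.
Proof. by move=> r x y; rewrite !aug_scaleE -crossed_convDr. Qed.

Lemma aug_scaleDl x : {morph aug_scale^~ x : r t / r + t}.
Proof. by move=> r t; rewrite !aug_scaleE crossed_convDl. Qed.

HB.instance Definition _ := GRing.Zmodule_isLmodule.Build (crossed a)
  (aug_module a) aug_scaleA aug_scale1 aug_scaleDr aug_scaleDl.

End AugmentationModule.

Definition trivial_action (G : groupType) (L : comNzRingType) :
  ring_action G L :=
  @RingAction G L (fun=> idfun) (fun=> erefl) (fun _ _ _ => erefl).

(* The group ring [L G], and its trivial module [L]. *)
Definition group_ring (L : comNzRingType) (G : groupType) : nzRingType :=
  crossed (trivial_action G L).
Definition trivial_module (L : comNzRingType) (G : groupType) :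
  lmodType (group_ring L G) := aug_module (trivial_action G L).

Section GroupRingInclusion.
Context {G : groupType} {K L : comNzRingType}.
Variables (a : ring_action G L) (phi : {rmorphism K -> L}).

Lemma group_ring_map_subproof (r : group_ring K G) :
  (fun g => phi (ccoef r g)) \in finitely_supported.
Proof.
have [s us rs] := ccoef_supp r; apply/finitely_supportedP; exists s => // g.
by move=> rg; apply: rs; apply: contraNneq rg => ->; rewrite rmorph0.
Qed.

(* [sum_g k_g g |-> sum_g (phi k_g, g)] *)
Definition group_ring_map (r : group_ring K G) : crossed a :=
  Crossed a (group_ring_map_subproof r).

End GroupRingInclusion.

Section Modules.
Context {A : nzRingType}.
Implicit Types M N : lmodType A.

Definition is_basis M (B : set M) :=
  (forall x, exists (s : seq M) (c : M -> A),
     [set` s] `<=` B /\ x = \sum_(b <- s) c b *: b) /\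
  (forall (s : seq M) (c : M -> A), uniq s -> [set` s] `<=` B ->
     \sum_(b <- s) c b *: b = 0 -> forall b, b \in s -> c b = 0).

Definition is_free M := exists B : set M, is_basis B.

Definition finitely_generated M :=
  exists s : seq M, forall x, exists c : M -> A, x = \sum_(b <- s) c b *: b.

Definition is_projective M :=
  forall (N N' : lmodType A) (p : {linear N -> N'}) (f : {linear M -> N'}),
    (forall y, exists x, p x = y) ->
    exists h : {linear M -> N}, forall x, p (h x) = f x.

(* An augmented chain complex [... -> D_1 -> D_0 ->> T]; [cx_d D k] is the
   differential of degree [k + 1]. *)
Record aug_complex (T : lmodType A) := AugComplex {
  cx_mod :> nat -> lmodType A;
  cx_d : forall k, {linear cx_mod k.+1 -> cx_mod k};
  cx_aug : {linear cx_mod 0%N -> T};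
  cx_dd : forall k x, cx_d k (cx_d k.+1 x) = 0;
  cx_aug_d : forall x, cx_aug (cx_d 0 x) = 0;
  cx_aug_surj : forall y, exists x, cx_aug x = y
}.

Definition is_resolution (T : lmodType A) (C : aug_complex T) :=
  (forall x, cx_aug C x = 0 -> exists y, cx_d C 0 y = x) /\
  (forall k x, cx_d C k x = 0 -> exists y, cx_d C k.+1 y = x).

Definition is_free_resolution (T : lmodType A) (C : aug_complex T) :=
  is_resolution C /\ forall k, is_free (C k).

End Modules.

Definition type_FP (m : nat) (G : groupType) :=
  exists P : aug_complex (trivial_module int G),
    [/\ is_resolution P, forall k, is_projective (P k) &
        forall k, (k <= m)%N -> finitely_generated (P k)].

Inductive coefficients : Type :=
  | IntCoef
  | FinCoef of finFieldType.

Definition coef_ring (Z : coefficients) : comNzRingType :=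
  match Z with IntCoef => int | FinCoef F => F end.
Coercion coef_ring : coefficients >-> GRing.ComNzRing.type.

Definition coef_norm (R : realType) (Z : coefficients) : Z -> R :=
  match Z with
  | IntCoef => fun x => `|x|%:~R
  | FinCoef F => fun x => (x != 0)%:R
  end.

Section CoefficientsTheory.
Context {R : realType} {Z : coefficients}.
Implicit Types x y : Z.

Lemma coef_norm_ge0 x : 0 <= coef_norm R x.
Proof. by case: Z x => [|F] x //=; rewrite ler0z. Qed.

Lemma coef_normN x : coef_norm R (- x) = coef_norm R x.
Proof. by case: Z x => [|F] x /=; rewrite ?normrN ?oppr_eq0. Qed.

Lemma coef_normD x y : coef_norm R (x + y) <= coef_norm R x + coef_norm R y.
Proof.
case: Z x y => [|F] x y /=; first by rewrite -intrD ler_int ler_normD.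
have [->|x0] := eqVneq x 0; first by rewrite !add0r.
by rewrite (le_trans (_ : _ <= 1))//; [case: eqP|rewrite lerDl].
Qed.

Lemma coef_normM x y : coef_norm R (x * y) = coef_norm R x * coef_norm R y.
Proof.
case: Z x y => [|F] x y /=; first by rewrite normrM intrM.
by rewrite mulf_eq0 negb_or -natrM mulnb.
Qed.

Lemma coef_countable : countable [set: Z].
Proof. by case: Z => [|F]; exact: countableP. Qed.

End CoefficientsTheory.

(* [f] identifies [X] with a Polish space [P] carrying its Borel sets. *)
Definition standard_borel (R : realType) d (X : measurableType d) :=
  exists (P : completePseudoMetricType R) (f : X -> P),
    [/\ hausdorff_space P,
        exists2 S : set P, countable S & dense S,
        bijective f &
        forall A : set X, measurable A <-> <<s @open P >> (f @` A)].

(* The space may have atoms. *)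
Record standard_action (R : realType) (G : groupType) := StandardAction {
  sa_display : measure_display;
  sa_space :> measurableType sa_display;
  sa_mu : probability sa_space R;
  sa_act : G -> sa_space -> sa_space;
  sa_countable : countable [set: G];
  sa_borel : standard_borel R sa_space;
  sa_act1 : forall x, sa_act 1%g x = x;
  sa_actM : forall g h x, sa_act (g * h)%g x = sa_act g (sa_act h x);
  sa_measurable : forall g, measurable_fun setT (sa_act g);
  sa_preserving : forall g (A : set sa_space), measurable A ->
    sa_mu (sa_act g @^-1` A) = sa_mu A;
  sa_free : {ae sa_mu, forall x, forall g, g != 1%g -> sa_act g x <> x}
}.

Definition ergodic (R : realType) (G : groupType) (alpha : standard_action R G) :=
  forall A : set alpha, measurable A ->
    (forall g, sa_act g @^-1` A = A) ->
    sa_mu alpha A = 0%E \/ sa_mu alpha A = 1%E.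

Section Linfty.
Context {R : realType} {G : groupType}.
Variables (alpha : standard_action R G) (Z : coefficients).
Local Notation mu := (sa_mu alpha).

(* [Z] carries the discrete sigma-algebra. *)
Definition ess_bounded : {pred alpha -> Z} := fun f =>
  `[< (forall B : set Z, measurable (f @^-1` B)) /\
      exists c : R, {ae mu, forall x, coef_norm R (f x) <= c} >].

Lemma measurable_discrete2 (f g : alpha -> Z) (op : Z -> Z -> Z) :
  (forall B : set Z, measurable (f @^-1` B)) ->
  (forall B : set Z, measurable (g @^-1` B)) ->
  forall B : set Z, measurable ((fun x => op (f x) (g x)) @^-1` B).
Proof.
move=> mf mg B.
rewrite (_ : _ @^-1` _ =
    \bigcup_z (f @^-1` [set z] `&` g @^-1` [set y | B (op z y)])); last first.
  by apply/seteqP; split=> x /= => [Bx|[z _ [<-]]//]; exists (f x).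
apply: countable_bigcupT_measurable; first exact: coef_countable.
by move=> z; exact: measurableI.
Qed.

Lemma ess_bounded_subring : subring_closed ess_bounded.
Proof.
split.
- apply/asboolP; split=> [B|].
    have -> : (1 : alpha -> Z) @^-1` B = if (1 : Z) \in B then setT else set0.
      exact: preimage_cst.
    by case: ifP => _; [exact: measurableT|exact: measurable0].
  by exists (coef_norm R (1 : Z)); apply/aeW => x.
- move=> f g /asboolP[mf [c cf]] /asboolP[mg [c' cg]]; apply/asboolP; split.
    exact: (measurable_discrete2 (fun x y => x - y) mf mg).
  exists (c + c'); apply: filterS2 cf cg => x fx gx.
  by rewrite (le_trans (coef_normD _ _))// lerD// coef_normN.
- move=> f g /asboolP[mf [c cf]] /asboolP[mg [c' cg]]; apply/asboolP; split.
    exact: (measurable_discrete2 (fun x y => x * y) mf mg).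
  exists (c * c'); apply: filterS2 cf cg => x fx gx.
  by rewrite coef_normM ler_pM// coef_norm_ge0.
Qed.

HB.instance Definition _ := GRing.isSubringClosed.Build (alpha -> Z)
  ess_bounded ess_bounded_subring.

Record ebfun := EBFun { ebval :> alpha -> Z; _ : ebval \in ess_bounded }.

HB.instance Definition _ := [isSub for ebval].
HB.instance Definition _ := [Choice of ebfun by <:].
HB.instance Definition _ := [SubChoice_isSubComNzRing of ebfun by <:].

Lemma ebfunP (f : ebfun) : (forall B : set Z, measurable (f @^-1` B)) /\
  exists c : R, {ae mu, forall x, coef_norm R (f x) <= c}.
Proof. by case: f => f fP; exact/asboolP. Qed.

Definition ae_null : {pred ebfun} := fun f => `[< {ae mu, forall x, f x = 0} >].

Lemma ae_null_ideal : idealr_closed ae_null.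
Proof.
split.
- by apply/asboolP/aeW.
- apply/negP => /asboolP[N [mN N0 subN]].
  have : mu setT = 0%E.
    apply/eqP; rewrite eq_le measure_ge0 andbT -N0 le_measure ?inE//.
    by move=> x _; apply: subN => /= /eqP; exact/negP/oner_neq0.
  by rewrite probability_setT => /eqP; rewrite onee_eq0.
- move=> f g h /asboolP g0 /asboolP h0; apply/asboolP.
  apply: filterS2 g0 h0 => x gx hx; change (f x * g x + h x = 0).
  by rewrite gx hx mulr0 addr0.
Qed.

HB.instance Definition _ := isIdealr.Build ebfun ae_null ae_null_ideal.

Definition Linfty : comNzRingType := {ideal_quot ae_null}.
End Linfty.

Arguments ess_bounded {R G} alpha Z _.
Arguments ae_null {R G} alpha Z _.

Section LinftyTheory.
Context {R : realType} {G : groupType} {alpha : standard_action R G}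
  {Z : coefficients}.
Local Notation mu := (sa_mu alpha).
Local Notation ebf := (ebfun alpha Z).
Local Notation L := (Linfty alpha Z).

Definition linf (f : ebf) : L := \pi_({ideal_quot (ae_null alpha Z)})%qT f.
Definition linf_repr (l : L) : ebf := repr (l : {ideal_quot (ae_null alpha Z)}).

Lemma linf_reprK : cancel linf_repr linf.
Proof. exact: reprK. Qed.

Lemma linf_eq (f h : ebf) : (linf f = linf h) <-> {ae mu, forall x, f x = h x}.
Proof.
have E : (linf f == linf h) = (f - h \in ae_null alpha Z).
  exact/esym/Quotient.idealrBE.
split=> [/eqP|fh].
  rewrite E => /asboolP; apply: filterS => x /eqP.
  by change (f x - h x == 0 -> f x = h x); rewrite subr_eq0 => /eqP.
apply/eqP; rewrite E; apply/asboolP; apply: filterS fh => x fh.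
by change (f x - h x = 0); rewrite fh subrr.
Qed.

Lemma linfD : {morph linf : f h / f + h}.
Proof. exact: Quotient.pi_add. Qed.

Lemma linfN : {morph linf : f / - f}.
Proof. exact: Quotient.pi_opp. Qed.

Lemma linfM : {morph linf : f h / f * h}.
Proof. exact: Quotient.pi_mul. Qed.

Lemma linf1 : linf 1 = 1.
Proof. exact: pi_oner. Qed.

Lemma shift_subproof (g : G) (f : ebf) :
  (fun x => f (sa_act g^-1%g x)) \in ess_bounded alpha Z.
Proof.
have [mf [c cf]] := ebfunP f; apply/asboolP; split.
  move=> B; rewrite -[X in measurable X]setTI.
  exact: (sa_measurable g^-1%g measurableT (mf B)).
exists c; case: cf => N [mN N0 subN]; exists (sa_act g^-1%g @^-1` N); split.
- by rewrite -[X in measurable X]setTI; exact: sa_measurable.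
- by apply: etrans N0; exact: sa_preserving.
- by move=> x Hx; exact: subN.
Qed.

Definition ebshift (g : G) (f : ebf) : ebf := EBFun (shift_subproof g f).

(* [(g . l) x = l (g^-1 x)] *)
Definition linf_shift (g : G) (l : L) : L := linf (ebshift g (linf_repr l)).

Lemma linf_shiftE g f : linf_shift g (linf f) = linf (ebshift g f).
Proof.
apply/linf_eq; have /linf_eq := linf_reprK (linf f).
move=> [N [mN N0 subN]]; exists (sa_act g^-1%g @^-1` N); split.
- by rewrite -[X in measurable X]setTI; exact: sa_measurable.
- by apply: etrans N0; exact: sa_preserving.
- by move=> x Hx; exact: subN.
Qed.

Lemma linf_ind (P : L -> Prop) : (forall f, P (linf f)) -> forall l, P l.
Proof. by move=> Pf l; rewrite -[l]linf_reprK. Qed.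

Lemma linf_shift_zmod g : zmod_morphism (linf_shift g).
Proof.
elim/linf_ind=> f; elim/linf_ind=> h.
rewrite -linfN -linfD !linf_shiftE -linfN -linfD; congr linf.
exact/val_inj.
Qed.

Lemma linf_shift_monoid g : monoid_morphism (linf_shift g).
Proof.
split; first by rewrite -linf1 linf_shiftE; congr linf; exact/val_inj.
elim/linf_ind=> f; elim/linf_ind=> h.
by rewrite -linfM !linf_shiftE -linfM; congr linf; exact/val_inj.
Qed.

HB.instance Definition _ g := GRing.isZmodMorphism.Build L L (linf_shift g)
  (linf_shift_zmod g).
HB.instance Definition _ g := GRing.isMonoidMorphism.Build L L (linf_shift g)
  (linf_shift_monoid g).

Lemma linf_shift1 l : linf_shift 1%g l = l.
Proof.
elim/linf_ind: l => f; rewrite linf_shiftE; congr linf; apply/val_inj/funext.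
by move=> x; rewrite /= invg1 sa_act1.
Qed.

Lemma linf_shiftM g h l : linf_shift (g * h)%g l = linf_shift g (linf_shift h l).
Proof.
elim/linf_ind: l => f; rewrite !linf_shiftE; congr linf; apply/val_inj/funext.
by move=> x; rewrite /= invgM sa_actM.
Qed.

Lemma cst_subproof (z : Z) : (fun=> z) \in ess_bounded alpha Z.
Proof.
apply/asboolP; split; last by exists (coef_norm R z); exact: aeW.
move=> B; rewrite (_ : _ @^-1` _ = if z \in B then setT else set0).
  by case: ifP => _; [exact: measurableT|exact: measurable0].
exact: preimage_cst.
Qed.

Definition linf_cst (z : Z) : L := linf (EBFun (cst_subproof z)).

Lemma linf_cst_zmod : zmod_morphism linf_cst.
Proof.
by move=> x y; rewrite /linf_cst -linfN -linfD; congr linf; exact/val_inj.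
Qed.

Lemma linf_cst_monoid : monoid_morphism linf_cst.
Proof.
split=> [|x y]; first by rewrite -linf1; congr linf; exact/val_inj.
by rewrite -linfM; congr linf; exact/val_inj.
Qed.

HB.instance Definition _ := GRing.isZmodMorphism.Build Z L linf_cst
  linf_cst_zmod.
HB.instance Definition _ := GRing.isMonoidMorphism.Build Z L linf_cst
  linf_cst_monoid.

(* The class of the characteristic function of [S], for measurable [S]. *)
Definition linf_indic (S : set alpha) : L :=
  linf (insubd 0 (fun x => (x \in S)%:R)).

Lemma indic_ess_bounded (S : set alpha) : measurable S ->
  (fun x => (x \in S)%:R) \in ess_bounded alpha Z.
Proof.
move=> mS; apply/asboolP; split=> [B|]; last first.
  exists 1; apply: aeW => x; case: (x \in S); case: Z => [|F] //=.
    by rewrite oner_eq0.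
  by rewrite eqxx.
have mc (b : bool) : measurable (if b then [set: alpha] else set0).
  by case: b; [exact: measurableT|exact: measurable0].
rewrite (_ : _ @^-1` _ = (S `&` if (1 : Z) \in B then setT else set0) `|`
                         (~` S `&` if (0 : Z) \in B then setT else set0)).
  by apply: measurableU; apply: measurableI => //; exact: measurableC.
apply/seteqP; split=> x /=.
  case: (boolP (x \in S)) => xS Bx; [left|right]; split; rewrite ?ifT//=.
  - exact/set_mem.
  - exact/mem_set.
  - by move/mem_set; exact/negP.
  - exact/mem_set.
move=> [[xS]|[xS]]; case: ifPn => // /set_mem; first by rewrite mem_set.
by rewrite memNset.
Qed.

(* [\int_X |l| dmu] *)
Definition linf_norm1 (l : L) : R :=
  \int[mu]_x coef_norm R (linf_repr l x).

End LinftyTheory.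

Definition Linfty_action (R : realType) (G : groupType)
    (alpha : standard_action R G) (Z : coefficients) :
    ring_action G (Linfty alpha Z) :=
  @RingAction G (Linfty alpha Z) (fun g => linf_shift g) linf_shift1 linf_shiftM.

Section Marked.
Context {R : realType} {G : groupType}.
Variables (alpha : standard_action R G) (Z : coefficients).
Local Notation mu := (sa_mu alpha).

Definition crossed_ring : nzRingType := crossed (Linfty_action alpha Z).
Definition Linfty_module : lmodType crossed_ring :=
  aug_module (Linfty_action alpha Z).
Definition group_ring_incl : group_ring Z G -> crossed_ring :=
  group_ring_map (Linfty_action alpha Z) (@linf_cst R G alpha Z).

(* The left ideal [<S>]. *)
Definition principal (S : set alpha) : set crossed_ring :=
  [set r | exists t : crossed_ring, r = t * single (linf_indic S) 1%g].

Definition crossed_norm1 (r : crossed_ring) : R :=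
  \sum_(g \in [set: G]) linf_norm1 (ccoef r g).

(* [\bigoplus_i <S i>] *)
Definition principal_sum (I : finType) (S : I -> set alpha) :
    set {ffun I -> crossed_ring^o} :=
  [set z | forall i, principal (S i) (z i)].

Definition measure_sum (I : finType) (S : I -> set alpha) : R :=
  \sum_i fine (mu (S i)).

(* The isomorphism of [M] with [\bigoplus_i <mk_set i>] is given as an
   injective linear map into [\bigoplus_i crossed_ring]. *)
Record marking (M : lmodType crossed_ring) := Marking {
  mk_index : finType;
  mk_set : mk_index -> set alpha;
  mk_measurable : forall i, measurable (mk_set i);
  mk_iso : {linear M -> {ffun mk_index -> crossed_ring^o}};
  mk_iso_inj : injective mk_iso;
  mk_iso_range : range mk_iso = principal_sum mk_set
}.

End Marked.

Section MarkedTheory.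
Context {R : realType} {G : groupType} {alpha : standard_action R G}
  {Z : coefficients}.
Local Notation mu := (sa_mu alpha).
Local Notation LG := (crossed_ring alpha Z).

Definition marked_dim (M : lmodType LG) (mM : marking M) : R :=
  measure_sum (@mk_set _ _ _ _ _ mM).

Definition marked_norm1 (M : lmodType LG) (mM : marking M) (z : M) : R :=
  \sum_i crossed_norm1 (mk_iso mM z i).

(* [S] specifies a marked direct summand of [M], namely [marked_sub mM S]. *)
Definition is_summand (M : lmodType LG) (mM : marking M)
    (S : mk_index mM -> set alpha) :=
  forall i, measurable (S i) /\ S i `<=` mk_set i.

Definition marked_sub (M : lmodType LG) (mM : marking M)
    (S : mk_index mM -> set alpha) : set M :=
  mk_iso mM @^-1` principal_sum (Z := Z) S.

Section Lognorm.
Variables (M N : lmodType LG) (mM : marking M) (mN : marking N).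
Variable f : {linear M -> N}.

(* In [opnorm], [marked_rank] and [lognorm'], [S] specifies a marked direct
   summand of [M], and the values are those of the restriction of [f] to it. *)
Definition opnorm (S : mk_index mM -> set alpha) : R :=
  inf [set c | 0 <= c /\ forall z, marked_sub S z ->
                 marked_norm1 mN (f z) <= c * marked_norm1 mM z].

Definition marked_rank (S : mk_index mM -> set alpha) : R :=
  inf [set measure_sum S' | S' in
         [set S' : mk_index mN -> set alpha |
            is_summand S' /\ f @` marked_sub S `<=` marked_sub S']].

Definition log_plus (t : R) : R := Num.max (ln t) 0.

Definition lognorm' (S : mk_index mM -> set alpha) : R :=
  Num.min (measure_sum S * log_plus (opnorm S))
          (marked_rank S * log_plus (opnorm S)).

(* [S k] specifies the [k]-th summand of a finite marked decomposition. *)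
Definition is_marked_decomposition (K : finType)
    (S : K -> mk_index mM -> set alpha) :=
  forall i, [/\ forall k, measurable (S k i),
                trivIset setT (fun k => S k i) &
                \bigcup_k S k i = mk_set i].

Definition lognorm : R :=
  inf [set x | exists (K : finType) (S : K -> mk_index mM -> set alpha),
                 is_marked_decomposition S /\ x = \sum_k lognorm' (S k)].

End Lognorm.
End MarkedTheory.

Record marked_complex (R : realType) (G : groupType)
    (alpha : standard_action R G) (Z : coefficients) := MarkedComplex {
  mc_complex :> aug_complex (Linfty_module alpha Z);
  mc_marking : forall k, marking (mc_complex k)
}.

Section Embeddings.
Context {R : realType} {G : groupType} {Z : coefficients}.
Variables (n : nat) (C : aug_complex (trivial_module Z G)).
Variable alpha : standard_action R G.

(* [D] is part of an [alpha]-embedding up to degree [n], where [C] is the fixed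
   free resolution of [Z] over the group ring. *)
Definition embedding_class (D : marked_complex alpha Z) :=
  exists f : forall k, C k -> D k,
    [/\ forall k, (k <= n.+1)%N -> forall r x y,
          f k (r *: x + y) = group_ring_incl alpha r *: f k x + f k y,
        forall k, (k <= n)%N -> forall x,
          f k (cx_d C k x) = cx_d D k (f k.+1 x) &
        forall x, cx_aug D (f 0%N x) = linf_cst (cx_aug C x)].

Definition medim : \bar R :=
  ereal_inf [set x | exists D, embedding_class D /\
                       x = (marked_dim (mc_marking D n))%:E].

End Embeddings.

Definition mevol (R : realType) (G : groupType) (n : nat)
    (C : aug_complex (trivial_module IntCoef G))
    (alpha : standard_action R G) : \bar R :=
  ereal_inf [set x | exists D : marked_complex alpha IntCoef,
    embedding_class n C D /\
    x = (lognorm (mc_marking D n.+1) (mc_marking D n) (cx_d D n))%:E].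

(* Main.v *)
(** Since [beta] is only required to be ergodic, it is obtained as an ergodic
    measure on a factor of [alpha] that remembers an almost optimal embedding.

    Such an embedding [D] involves only countably many measurable subsets of
    [alpha]: the matrices of its differentials have finitely many coefficients,
    each of which takes finitely many values up to null sets, and the chain map
    can be precomposed with a self-map of the resolution of countable image.
    Together with sets witnessing freeness, these subsets define an equivariant
    map [p] from [alpha] to the Cantor space of the functions from [G * nat] to
    [bool], under which all the data are pulled back from sets that depend on
    finitely many coordinates.

    Every relation that makes the data an embedding, every upper bound for an
    operator norm and every inclusion that bounds a rank says that some such
    finitary set is null. Hence the embedding can be rebuilt, with operator
    norms that do not increase, over every invariant probability measure on the
    Cantor space that vanishes on the finitary sets that are null for the
    pushforward of the measure of [alpha]. These measures form a compact convex
    set, and the dimension, respectively the upper bound for the logarithmic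
    norm, is a linear functional on it. A measure that minimises this functional
    and then, lexicographically, the measures of all finitary sets is an extreme
    point, hence ergodic. *)

Require Import Defs.
From HB Require Import structures.
From mathcomp Require Import all_boot all_order all_algebra.
From mathcomp Require Import all_classical all_reals all_analysis.
From mathcomp Require Import lra measurable_realfun.

Set Implicit Arguments.
Unset Strict Implicit.
Unset Printing Implicit Defensive.

Import Order.TTheory GRing.Theory Num.Theory.
Import numFieldNormedType.Exports.
Local Open Scope classical_set_scope.
Local Open Scope ring_scope.

(** * The Cantor space and its finitary sets *)

(** A limit of measures is controlled only on the sets along which it is taken, and the minimising
    measure may be singular to the pushforward of the measure of [alpha]. So an almost everywhere
    statement survives only if its exceptional set lies in an algebra fixed beforehand. This shapes
    three choices. Coefficients have to take finitely many values up to null sets, which essential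
    boundedness with values in the integers or a finite field provides. Freeness is restated through
    sets whose translates satisfy two nullity conditions. Operator norms, which are not linear in
    the measure, are frozen at their values over [alpha], and only the measures of the pieces vary.
    Finitary sets are clopen in the Cantor space, so finite additivity on them already gives
    countable additivity. Measures thus become points of a product of unit intervals, and
    compactness is pointwise convergence along one ultrafilter. Finally, the map to the Cantor space
    need not be surjective: sets with equal preimages may differ, but only by a null set. *)

Lemma countable_image (T U : Type) (A : set T) (f : T -> U) :
  countable A -> countable (f @` A).
Proof. exact/sub_countable/card_image_le. Qed.

(** The source of compactness: limits in the Cantor space and limits of contents are both taken
    along such an ultrafilter, so that no subsequences have to be extracted. *)
Lemma ultra_nat : exists F : set_system nat, UltraFilter F /\ \oo `<=` F.
Proof. by have [F [UF sF]] := ultraFilterLemma eventually_filter; exists F. Qed.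

Lemma ultra_cvg (R : realType) (F : set_system nat) (u : nat -> R) :
  UltraFilter F -> (forall n, 0 <= u n <= 1) -> exists l : R, u @ F --> l.
Proof.
move=> UF u01.
have /(_ (u @ F) _) : compact `[0 : R, 1] by exact: segment_compact.
case.
- by apply: (@filterS _ F _ setT _ _ filterT) => n _ /=; rewrite in_itv /= u01.
- move=> l [_ cl]; exists l => V nV.
  have [//|FV] := in_ultra_setVsetC (u @^-1` V) UF.
  by have [x [] /=] := cl (~` V) V FV nV.
Qed.

Section Finitary.

Definition determined_below N (A : set (nat -> bool)) :=
  forall x y : nat -> bool, (forall i, (i < N)%N -> x i = y i) -> A x -> A y.

(** In the product topology these are the clopen sets of the Cantor space. They form a countable
    algebra that generates its Borel sets. *)
Definition finitary (A : set (nat -> bool)) := exists N, determined_below N A.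

Lemma determined_belowW N M A : (N <= M)%N ->
  determined_below N A -> determined_below M A.
Proof.
by move=> NM dA x y xy; apply: dA => i iN; apply: xy; exact: leq_trans NM.
Qed.

Lemma finitary0 : finitary set0.
Proof. by exists 0%N. Qed.

Lemma finitaryT : finitary setT.
Proof. by exists 0%N. Qed.

Lemma finitaryU : setU_closed finitary.
Proof.
move=> A B [N dA] [M dB]; exists (maxn N M) => x y xy [Ax|Bx]; [left|right].
- exact: (determined_belowW (leq_maxl N M) dA) Ax.
- exact: (determined_belowW (leq_maxr N M) dB) Bx.
Qed.

Lemma finitaryC : setC_closed finitary.
Proof.
move=> A [N dA]; exists N => x y xy nAx Ay; apply: nAx; apply: dA Ay => i iN.
by rewrite xy.
Qed.

Lemma finitaryI : setI_closed finitary.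
Proof.
move=> A B fA fB; rewrite -[A `&` B]setCK setCI.
by apply/finitaryC/finitaryU; exact: finitaryC.
Qed.

Lemma finitary_coord i : finitary [set x : nat -> bool | x i].
Proof. by exists i.+1 => x y xy /=; rewrite xy. Qed.

Lemma finitary_preimage (s : nat -> nat) A : finitary A ->
  finitary [set x : nat -> bool | A (fun i => x (s i))].
Proof.
move=> [N dA]; exists (\max_(i < N) (s i)).+1 => x y xy /=.
apply: dA => i iN /=; apply: xy; rewrite ltnS.
exact: (@leq_bigmax _ (fun j : 'I_N => s j) (Ordinal iN)).
Qed.

(** Codes form a countable type. This makes an open set a countable union of finitary sets and lets
    the minimisation run through all finitary sets. *)
Definition finitary_code (c : nat * seq (seq bool)) : set (nat -> bool) :=
  [set x | [seq x i | i <- iota 0 c.1] \in c.2].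

Lemma finitary_codeP A : finitary A -> exists c, A = finitary_code c.
Proof.
move=> [N dA].
pose p (s : seq bool) := `[< A (nth false s) >].
pose T := [seq tval t | t <- enum [set: N.-tuple bool] & p (tval t)].
exists (N, T); apply/seteqP; split=> x.
- move=> Ax; rewrite /finitary_code /=.
  have sz : size [seq x i | i <- iota 0 N] == N by rewrite size_map size_iota.
  apply/mapP; exists (Tuple sz) => //; rewrite mem_filter mem_enum in_setT andbT.
  apply/asboolP; apply: dA Ax => i iN.
  by rewrite (nth_map 0%N) ?size_iota// nth_iota.
- rewrite /finitary_code /= => /mapP[t]; rewrite mem_filter => /andP[/asboolP At _] tE.
  apply: dA At => i iN.
  by rewrite -tE (nth_map 0%N) ?size_iota// nth_iota.
Qed.

Lemma finitary_code_finitary c : finitary (finitary_code c).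
Proof.
exists c.1 => x y xy; rewrite /finitary_code /=.
suff -> : [seq x i | i <- iota 0 c.1] = [seq y i | i <- iota 0 c.1] by [].
by apply/eq_in_map => i; rewrite mem_iota => /andP[_]; exact: xy.
Qed.

(** Choose a point in each [A n] and take the limit coordinatewise along the ultrafilter. Whether
    the limit lies in [A m] depends on finitely many coordinates, and some [n >= m] has a chosen
    point with the same ones; that point lies in [A n], hence in [A m]. *)
Lemma finitary_compact (A : nat -> set (nat -> bool)) :
  (forall n, finitary (A n)) -> (forall n, A n !=set0) ->
  (forall n m, (n <= m)%N -> A m `<=` A n) -> \bigcap_n A n !=set0.
Proof.
move=> fA A0 decA; have [F [UF ooF]] := ultra_nat.
have /choice[k Ak] := A0.
have lim i : exists b, F [set n | k n i = b].
  have [Ft|Ff] := in_ultra_setVsetC [set n | k n i = true] UF; first by exists true.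
  by exists false; apply: filterS Ff => n /=; case: (k n i).
have /choice[x xP] := lim.
exists x => m _; have [N dA] := fA m.
have FN : F [set n | forall i, (i < N)%N -> k n i = x i].
  elim: N {dA} => [|N IH]; first by apply: filterS filterT.
  apply: filterS2 IH (xP N) => n /= IH kN i; rewrite ltnS leq_eqVlt.
  by case/orP => [/eqP->//|]; exact: IH.
have Fm : F [set n | (m <= n)%N] by apply: ooF; exists m.
have [n [nN nm]] := filter_ex (filterI FN Fm).
by apply: (dA (k n)) => //; exact: (decA m n).
Qed.

End Finitary.

(* A wrapper, because [nat -> bool] already carries the topology of uniform
   convergence. *)
Record bstream (R : realType) := BStream { bs_val :> nat -> bool }.

(** * A complete metric structure on the Cantor space *)

Section BstreamMetric.
Variable R : realType.
Local Notation K := (bstream R).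

HB.instance Definition _ := gen_eqMixin K.
HB.instance Definition _ := gen_choiceMixin K.
HB.instance Definition _ := isPointed.Build K (BStream R (fun=> false)).

Lemma bstreamP (x y : K) : (forall i, x i = y i) -> x = y.
Proof. by case: x y => [x] [y] /= xy; congr BStream; exact/funext. Qed.

(** The open ball of the ultrametric with value [1 / (i + 1)], where [i] is the first index at which
    two points differ. The clause [0 < e] empties the balls of nonpositive radius; as singletons
    they would violate the triangle inequality. *)
Definition bs_ball (x : K) (e : R) : set K :=
  [set y | 0 < e /\ forall i, e <= i.+1%:R^-1 -> x i = y i].

Lemma bs_ball_center x (e : R) : 0 < e -> bs_ball x e x.
Proof. by []. Qed.

Lemma bs_ball_sym x y (e : R) : bs_ball x e y -> bs_ball y e x.
Proof. by move=> [e0 xy]; split=> // i /xy. Qed.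

Lemma bs_ball_triangle x y z (e1 e2 : R) :
  bs_ball x e1 y -> bs_ball y e2 z -> bs_ball x (e1 + e2) z.
Proof.
move=> [e10 xy] [e20 yz]; split; first exact: addr_gt0.
by move=> i ei; rewrite xy ?yz// (le_trans _ ei)// ?lerDl ?lerDr ltW.
Qed.

HB.instance Definition _ := hasNbhs.Build K (nbhs_ (entourage_ bs_ball)).
HB.instance Definition _ := Nbhs_isPseudoMetric.Build R K
  erefl bs_ball_center bs_ball_sym bs_ball_triangle erefl.

Lemma bs_ballP N : exists2 e : R, 0 < e &
  forall x y : K, ball x e y -> forall i, (i < N)%N -> x i = y i.
Proof.
exists N.+1%:R^-1; first by rewrite invr_gt0.
move=> x y [_ xy] i iN; apply: xy.
by rewrite lef_pV2 ?posrE// ler_nat ltnW// ltnS.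
Qed.

Lemma bs_ball_below (e : R) : 0 < e -> exists N,
  forall x y : K, (forall i, (i < N)%N -> x i = y i) -> ball x e y.
Proof.
move=> e0; exists (Num.truncn e^-1).+1 => x y xy; split=> // i ei; apply: xy.
rewrite ltnS ltnW// truncn_gt_nat.
by rewrite -[leLHS]invrK lef_pV2// posrE invr_gt0.
Qed.

Lemma bs_complete (F : set_system K) : ProperFilter F -> cauchy F -> cvg F.
Proof.
move=> FF /cauchyP cF.
have lim i : exists b, F [set x | x i = b].
  have [e e0 eP] := bs_ballP i.+1.
  have [x Fx] := cF e e0; exists (x i); apply: filterS Fx => y /eP -> //.
have /choice[x xP] := lim.
apply/cvg_ex; exists (BStream R x); apply/cvg_ballP => e e0.
have [N NP] := bs_ball_below e0.
suff: F [set y | forall i, (i < N)%N -> x i = y i].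
  by apply: filterS => y xy; exact: (NP (BStream R x)).
elim: N {NP} => [|N IH]; first by apply: filterS filterT.
apply: filterS2 IH (xP N) => y /= IH kN i; rewrite ltnS leq_eqVlt.
by case/orP => [/eqP->//|]; exact: IH.
Qed.

HB.instance Definition _ := Uniform_isComplete.Build K bs_complete.

Definition bs_space : completePseudoMetricType R := K.

Lemma bs_hausdorff : hausdorff_space bs_space.
Proof.
move=> x y xy; apply: bstreamP => i.
have [e e0 eP] := bs_ballP i.+1.
have [z [xz yz]] := xy _ _ (nbhsx_ballx x e e0) (nbhsx_ballx y e e0).
by rewrite (eP _ _ xz i)// (eP _ _ yz i).
Qed.

Lemma bs_separable : exists2 S : set bs_space, countable S & dense S.
Proof.
exists (range (fun s : seq bool => BStream R (nth false s))).
  exact/countable_image/countableP.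
move=> O [x Ox] oO.
have /nbhs_ballP[e e0 eO] : nbhs x O by exact: open_nbhs_nbhs.
have [N NP] := bs_ball_below e0.
exists (BStream R (nth false [seq bs_val x i | i <- iota 0 N])); split; last first.
  by exists [seq bs_val x i | i <- iota 0 N].
apply/eO/NP => i iN /=.
by rewrite (nth_map 0%N) ?size_iota// nth_iota.
Qed.

Lemma finitary_open (A : set (nat -> bool)) : finitary A ->
  open (@bs_val R @^-1` A : set bs_space).
Proof.
move=> [N dA]; rewrite openE => x Ax; apply/nbhs_ballP.
have [e e0 eP] := bs_ballP N; exists e => // y xy.
exact: dA (eP _ _ xy) Ax.
Qed.

Lemma open_finitary (O : set bs_space) : open O ->
  <<s finitary >> (BStream R @^-1` O).
Proof.
rewrite openE => oO.
pose D := [set c | finitary_code c `<=` BStream R @^-1` O].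
have -> : BStream R @^-1` O = \bigcup_(c in D) finitary_code c.
  apply/seteqP; split=> [x Ox|x [c cO cx]]; last exact: cO.
  have /nbhs_ballP[e e0 eO] := oO _ Ox.
  have [N NP] := bs_ball_below e0.
  pose s := [seq x i | i <- iota 0 N].
  exists (N, [:: s]); last by rewrite /finitary_code /= inE.
  move=> y; rewrite /finitary_code /= inE => /eqP ys.
  apply/eO/NP => i iN; move: (congr1 (nth false ^~ i) ys).
  by rewrite !(nth_map 0%N) ?size_iota// !nth_iota.
pose I := g_sigma_algebraType finitary.
have mc c : D c -> measurable (finitary_code c : set I).
  move=> _; apply: sub_sigma_algebra; exact: finitary_code_finitary.
have -> : \bigcup_(c in D) finitary_code c =
    \bigcup_c (if `[< D c >] then finitary_code c else set0).
  apply/seteqP; split=> x [c].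
    by move=> Dc cx; exists c => //; case: asboolP.
  by move=> _; case: asboolP => // Dc cx; exists c.
have : @measurable _ I (\bigcup_c (if `[< D c >] then finitary_code c else set0)).
  apply: countable_bigcupT_measurable => [|c]; first exact: countableP.
  by case: asboolP => // Dc; exact: mc.
by [].
Qed.

Lemma bs_borel (A : set (nat -> bool)) :
  <<s finitary >> A <-> <<s @open bs_space >> (BStream R @` A).
Proof.
pose I := g_sigma_algebraType finitary.
pose J := g_sigma_algebraType (@open bs_space).
have -> : BStream R @` A = @bs_val R @^-1` A.
  apply/seteqP; split=> [_ [x Ax <-]//|[x] Ax]; by exists x.
split=> mA.
  have mf : @measurable_fun _ _ J I setT (@bs_val R).
    apply: (@measurability _ _ J I setT _ finitary) => // _ [B fB <-].
    by rewrite setTI; apply: sub_sigma_algebra; exact: finitary_open.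
  by have := mf measurableT A mA; rewrite setTI.
have mf : @measurable_fun _ _ I J setT (BStream R).
  apply: (@measurability _ _ I J setT _ (@open bs_space)) => // _ [B oB <-].
  by rewrite setTI; exact: open_finitary.
by have := mf measurableT _ mA; rewrite setTI.
Qed.

End BstreamMetric.

(** * Extension of contents and ergodic extreme points *)

(** The bounds are asked of all sets so that ultralimits exist at every index, while additivity
    concerns finitary sets only. Contents constructed below are therefore set to [0] on the other
    sets. *)
Record finitary_content (R : realType) (phi : set (nat -> bool) -> R) : Prop :=
  FinitaryContent {
  fc_bounded : forall A, 0 <= phi A <= 1;
  fc_add : forall A B, finitary A -> finitary B -> A `&` B = set0 ->
    phi (A `|` B) = phi A + phi B;
  fc_setT : phi setT = 1
}.

Definition fin_alg : Type := nat -> bool.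
HB.instance Definition _ := Pointed.copy fin_alg (nat -> bool).
Fact fin_alg_display : measure_display. Proof. by []. Qed.
HB.instance Definition _ := @isAlgebraOfSets.Build fin_alg_display fin_alg
  finitary finitary0 finitaryU finitaryC.

Notation fin_sigma := (g_sigma_algebraType (finitary : set (set fin_alg))).

Lemma measure_probability d (T : measurableType d) (R : realType)
    (mu : {measure set T -> \bar R}) : mu setT = 1%E ->
  exists P : probability T R, forall A, P A = mu A.
Proof.
move=> mu1; exists (mnormalize mu (dirac point)) => A.
change (mnormalize mu (dirac point) A = mu A).
rewrite /mnormalize mu1; case: ifPn => [|_]; first by rewrite onee_eq0.
by rewrite /= invr1 mule1.
Qed.

Section ContentExtension.
Variables (R : realType) (phi : set (nat -> bool) -> R).
Hypothesis cphi : finitary_content phi.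

Let m (A : set fin_alg) : \bar R := (phi A)%:E.

Lemma finitary_content0 : phi set0 = 0.
Proof.
have := fc_add cphi finitary0 finitary0 (setI0 _); rewrite setU0 => /eqP.
by rewrite -subr_eq0 opprD addrA subrr sub0r oppr_eq0 => /eqP.
Qed.

Let m0 : m set0 = 0%E.
Proof. by rewrite /m finitary_content0. Qed.

Let m_ge0 A : (0 <= m A)%E.
Proof. by rewrite lee_fin; have /andP[] := fc_bounded cphi A. Qed.

(** By [finitary_compact], a finitary union of disjoint finitary sets is already a finite union of
    them, so the partial sums are eventually constant. *)
Let m_sigma_additive : semi_sigma_additive m.
Proof.
move=> F mF tF mUF.
have mU n : finitary (\bigcup_(k < n) F k).
  by rewrite bigcup_mkord; apply: (@bigsetU_measurable _ fin_alg).
have addF n : (\sum_(0 <= i < n) m (F i) = m (\bigcup_(k < n) F k))%E.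
  elim: n => [|n IH]; first by rewrite big_geq// bigcup_mkord big_ord0 m0.
  rewrite big_nat_recr//= IH /m -EFinD -(fc_add cphi) ?bigcup_mkord ?big_ord_recr//=.
  - by rewrite -bigcup_mkord; exact: mU.
  - exact: mF.
  rewrite -bigcup_mkord setI_bigcupl bigcup0// => k /= kn.
  apply/eqP; apply: contraTT isT => /set0P[x [Fkx Fnx]].
  have : k = n by apply: tF => //; exists x.
  by move=> kE; rewrite kE ltnn in kn.
have [N NE] : exists N, \bigcup_n F n `\` \bigcup_(k < N) F k = set0.
  apply: contrapT => /forallNP H.
  have [||n k nk x [Ux nx]|x Hx] := @finitary_compact
    (fun N => \bigcup_n F n `\` \bigcup_(k < N) F k).
  - move=> N; rewrite setDE; apply: finitaryI => //; exact: finitaryC.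
  - by move=> N; apply/set0P/eqP; exact: H.
  - by split=> // -[j jn Fj]; apply: nx; exists j => //; exact: leq_trans nk.
  have [[n _ Fnx] _] := Hx 0%N I.
  have [_] := Hx n.+1 I; apply; exists n => //=.
apply: cvg_near_cst; exists N => // n /= Nn; rewrite addF; congr m.
apply/seteqP; split=> [x [k _ Fkx]|x Ux]; first by exists k.
have : ~ (\bigcup_n F n `\` \bigcup_(k < N) F k) x by rewrite NE.
move=> /not_andP[//|/contrapT[k kN Fkx]].
by exists k => //=; exact: leq_trans Nn.
Qed.

Let premeasure : set fin_alg -> \bar R := m.
HB.instance Definition _ := isMeasure.Build _ _ _ premeasure m0 m_ge0
  m_sigma_additive.

Lemma finitary_extension : exists P : probability fin_sigma R,
  forall A, finitary A -> P A = (phi A)%:E.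
Proof.
pose mu : {measure set fin_sigma -> \bar R} := measure_extension premeasure.
have muE A : finitary A -> mu A = (phi A)%:E.
  by move=> fA; rewrite /mu/= /measure_extension measurable_mu_extE.
have mu1 : mu setT = 1%E by rewrite muE ?(fc_setT cphi)//; exact: finitaryT.
by have [P PE] := measure_probability mu1; exists P => A fA; rewrite PE muE.
Qed.

End ContentExtension.

Lemma fin_sigma_measure_unique (R : realType)
    (m1 m2 : {measure set fin_sigma -> \bar R}) :
  (m1 setT < +oo)%E -> (forall A, finitary A -> m1 A = m2 A) ->
  forall A, measurable A -> m1 A = m2 A.
Proof.
move=> m1oo m12 A mA.
apply: (measure_unique (finitary : set (set fin_sigma)) (fun=> setT)) => //.
- exact: finitaryI.
- by move=> _; exact: finitaryT.
- by apply: bigcup_const; exists 0%N.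
Qed.

(** * Lexicographic minimisation of linear functionals *)

Section LexicographicMinimum.
Variables (R : realType) (T : Type) (F : set_system nat).
Hypotheses (UF : UltraFilter F) (ooF : \oo `<=` F).

Definition pairing (w : seq (R * T)) (phi : T -> R) : R :=
  \sum_(c <- w) c.1 * phi c.2.

(** For sets of functions with values between 0 and 1, where ultralimits of sequences always exist,
    this takes the place of compactness in the product topology. *)
Definition ultra_closed (M : set (T -> R)) :=
  forall (u : nat -> T -> R) (phi : T -> R),
    F [set n | M (u n)] -> (forall t, u ^~ t @ F --> phi t) -> M phi.

Lemma pairing_cvg w (u : nat -> T -> R) phi :
  (forall t, u ^~ t @ F --> phi t) ->
  (fun n => pairing w (u n)) @ F --> pairing w phi.
Proof.
move=> uphi; rewrite /pairing.
elim: w => [|c w IH].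
  rewrite big_nil; under eq_fun do rewrite big_nil; exact: cvg_cst.
rewrite big_cons; under eq_fun do rewrite big_cons.
by apply: cvgD => //; apply: cvgM => //; exact: cvg_cst.
Qed.

Lemma ultra_limit (M : set (T -> R)) (u : nat -> T -> R) :
  (forall phi, M phi -> forall t, 0 <= phi t <= 1) ->
  (forall n, M (u n)) -> exists phi : T -> R, forall t, u ^~ t @ F --> phi t.
Proof.
move=> bM Mu.
have /choice[phi phiP] : forall t, exists l : R, u ^~ t @ F --> l.
  by move=> t; apply: ultra_cvg => n; exact: bM.
by exists phi.
Qed.

Lemma ultra_closed_min (M : set (T -> R)) w :
  M !=set0 -> (forall phi, M phi -> forall t, 0 <= phi t <= 1) ->
  ultra_closed M ->
  exists2 phi, M phi & forall psi, M psi -> pairing w phi <= pairing w psi.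
Proof.
move=> [phi0 Mphi0] bM cM.
pose E := [set pairing w phi | phi in M].
have lE : has_inf E.
  split; first by exists (pairing w phi0), phi0.
  exists (- \sum_(c <- w) `|c.1|) => _ [phi Mphi <-]; rewrite /pairing.
  rewrite lerNl -sumrN; apply: ler_sum => c _.
  have /andP[p0 p1] := bM _ Mphi c.2.
  by rewrite (le_trans (ler_norm _))// normrN normrM ler_piMr// ger0_norm.
have /choice[u uP] : forall n : nat, exists phi,
    M phi /\ pairing w phi < inf E + n.+1%:R^-1.
  move=> n; have [|_ [phi Mphi <-] lt] := @inf_adherent _ E n.+1%:R^-1 _ lE.
    by rewrite invr_gt0.
  by exists phi.
have [phi phiP] := ultra_limit bM (fun n => (uP n).1).
have Mphi : M phi.
  by apply: cM phiP; apply: filterS filterT => n _; exact: (uP n).1.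
exists phi => // psi Mpsi; apply: (@le_trans _ _ (inf E)); last first.
  by apply: ge_inf; [exact: lE.2|exists psi].
have h : (fun n : nat => inf E + n.+1%:R^-1) @ F --> inf E.
  have : (fun n : nat => inf E + n.+1%:R^-1) @ \oo --> inf E + 0.
    by apply: cvgD; [exact: cvg_cst|exact: cvg_harmonic].
  rewrite addr0; apply: cvg_trans => V; exact: ooF.
apply: (ler_cvg_to (pairing_cvg (w := w) phiP) h).
by apply: filterS filterT => n _; exact/ltW/(uP n).2.
Qed.

(* Minimising the [w i] one after the other replaces the Krein-Milman theorem:
   by [lexicographic_min_extreme] the result is extreme in [M] as soon as the
   [w i] separate points. *)
Lemma lexicographic_min (M : set (T -> R)) (w : nat -> seq (R * T)) :
  M !=set0 -> (forall phi, M phi -> forall t, 0 <= phi t <= 1) ->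
  ultra_closed M ->
  exists2 phi, M phi & forall i psi, M psi ->
    (forall j, (j < i)%N -> pairing (w j) psi = pairing (w j) phi) ->
    pairing (w i) phi <= pairing (w i) psi.
Proof.
move=> M0 bM cM.
(* [Mi i] is the face of [M] on which the first [i] functionals are minimised in turn. The faces
   shrink, so a sequence whose [n]-th point lies in [Mi n] is eventually in each face, and its
   ultralimit lies in all of them. *)
pose fix Mi (i : nat) : set (T -> R) := if i is i'.+1 then
  [set phi | Mi i' phi /\ forall psi, Mi i' psi -> pairing (w i') phi <= pairing (w i') psi]
  else M.
have decMi i j : (i <= j)%N -> Mi j `<=` Mi i.
  elim: j => [|j IH]; first by rewrite leqn0 => /eqP->.
  by rewrite leq_eqVlt ltnS => /predU1P[->//|/IH H] phi [/H].
have bMi i phi : Mi i phi -> forall t, 0 <= phi t <= 1.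
  by move=> /(decMi _ _ (leq0n i)); exact: bM.
have MiP i : Mi i !=set0 /\ ultra_closed (Mi i).
  elim: i => [//|i [ne cl]]; split.
    by have [phi ? ?] := ultra_closed_min (w i) ne (@bMi i) cl; exists phi.
  move=> u phi Fu uphi; split.
    by apply: cl uphi; apply: filterS Fu => n [].
  move=> psi Mpsi; apply: (ler_cvg_to (pairing_cvg uphi) (cvg_cst _)).
  by apply: filterS Fu => n [_]; exact.
have /choice[u uP] : forall i, exists phi, Mi i phi by move=> i; exact: (MiP i).1.
have Mu n : M (u n) by exact: decMi (leq0n n) _ (uP n).
have [phi phiP] := ultra_limit bM Mu.
have Mphi i : Mi i phi.
  apply: (MiP i).2 phiP; apply: ooF; exists i => // n /= ni.
  exact: decMi ni _ (uP n).
exists phi; first exact: (Mphi 0%N).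
move=> i psi Mpsi eqj; have [_] := Mphi i.+1; apply.
(* A competitor with the same earlier values as [phi] inherits minimality at each of them, hence
   lies in [Mi i]. *)
elim: i eqj => [//|i IH] eqj; split.
  by apply: IH => j ji; apply: eqj; exact: ltnW.
move=> chi Mchi; rewrite eqj//; have [_] := Mphi i.+1; exact.
Qed.

(** By strong induction [psi1] and [psi2] agree with [phi] below [i], so both are admissible
    competitors at [i] and have at least the value of [phi] there. A proper convex combination equal
    to that value forces equality in both. *)
Lemma lexicographic_min_extreme (M : set (T -> R)) (w : nat -> seq (R * T)) phi
    (psi1 psi2 : T -> R) (t : R) :
  (forall i psi, M psi ->
    (forall j, (j < i)%N -> pairing (w j) psi = pairing (w j) phi) ->
    pairing (w i) phi <= pairing (w i) psi) ->
  M psi1 -> M psi2 -> 0 < t < 1 ->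
  (forall i, pairing (w i) phi =
             t * pairing (w i) psi1 + (1 - t) * pairing (w i) psi2) ->
  forall i, pairing (w i) psi1 = pairing (w i) phi.
Proof.
move=> min M1 M2 /andP[t0 t1] conv i.
suff: pairing (w i) psi1 = pairing (w i) phi /\
      pairing (w i) psi2 = pairing (w i) phi by case.
have [k] := ubnP i; elim: k i => [//|k IH] i; rewrite ltnS => ik.
have le1 : pairing (w i) phi <= pairing (w i) psi1.
  by apply: min => // j ji; apply: (IH j _).1; exact: leq_trans ji ik.
have le2 : pairing (w i) phi <= pairing (w i) psi2.
  by apply: min => // j ji; apply: (IH j _).2; exact: leq_trans ji ik.
have := conv i; split; nra.
Qed.

End LexicographicMinimum.

Lemma cvg_eq (R : realType) (F : set_system nat) {FF : ProperFilter F}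
    (u v : nat -> R) (a b : R) :
  u @ F --> a -> v @ F --> b -> F [set n | u n = v n] -> a = b.
Proof.
move=> ua vb uv; apply/eqP; rewrite eq_le; apply/andP; split.
  by apply: (ler_cvg_to ua vb); apply: filterS uv => n /= ->.
by apply: (ler_cvg_to vb ua); apply: filterS uv => n /= ->.
Qed.

(** * Invariant contents and an ergodic measure among them *)

Section ErgodicExtension.
Variables (R : realType) (I : Type) (act : I -> (nat -> bool) -> (nat -> bool)).
Hypothesis act_finitary : forall g A, finitary A -> finitary (act g @^-1` A).
Variable null : set (set (nat -> bool)).

Definition invariant_content (phi : set (nat -> bool) -> R) :=
  [/\ finitary_content phi,
      forall g A, finitary A -> phi (act g @^-1` A) = phi A &
      forall A, finitary A -> null A -> phi A = 0].

(** Each clause is an equation or a weak inequality between finitely many values of [phi], and such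
    conditions pass to pointwise limits. *)
Lemma invariant_content_closed (F : set_system nat) : UltraFilter F ->
  ultra_closed F invariant_content.
Proof.
move=> UF u phi Fu uphi.
have bnd A : 0 <= phi A <= 1.
  apply/andP; split.
    apply: (ler_cvg_to (cvg_cst (0 : R)) (uphi A)).
    by apply: filterS Fu => n [/fc_bounded/(_ A)/andP[]].
  apply: (ler_cvg_to (uphi A) (cvg_cst (1 : R))).
  by apply: filterS Fu => n [/fc_bounded/(_ A)/andP[]].
split; first split=> //.
- move=> A B fA fB AB.
  have AB' : (fun n => u n A + u n B) @ F --> phi A + phi B by apply: cvgD.
  apply: (cvg_eq (uphi _) AB').
  by apply: filterS Fu => n [/fc_add H _ _]; exact: H.
- apply: (cvg_eq (uphi _) (cvg_cst (1 : R))).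
  by apply: filterS Fu => n [/fc_setT].
- move=> g A fA; apply: (cvg_eq (uphi _) (uphi _)).
  by apply: filterS Fu => n [_ H _]; exact: H.
- move=> A fA NA; apply: (cvg_eq (uphi _) (cvg_cst (0 : R))).
  by apply: filterS Fu => n [_ _]; exact.
Qed.

Lemma act_measurable g : measurable_fun setT (act g : fin_sigma -> fin_sigma).
Proof.
apply: (@measurability _ _ fin_sigma fin_sigma setT _ finitary) => // _ [B fB <-].
by rewrite setTI; apply: sub_sigma_algebra; exact: act_finitary.
Qed.

Lemma finitary_measurable A : finitary A -> measurable (A : set fin_sigma).
Proof. exact: sub_sigma_algebra. Qed.

Lemma ergodic_extension (phi0 : set (nat -> bool) -> R)
    (w0 : seq (R * set (nat -> bool))) :
  invariant_content phi0 -> (forall c, c \in w0 -> finitary c.2) ->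
  exists P : probability fin_sigma R,
  [/\ forall A, finitary A -> null A -> P A = 0%E,
      forall g (A : set fin_sigma), measurable A -> P (act g @^-1` A) = P A,
      forall A : set fin_sigma, measurable A ->
        (forall g, act g @^-1` A = A) -> P A = 0%E \/ P A = 1%E &
      \sum_(c <- w0) c.1 * fine (P c.2) <= pairing w0 phi0].
Proof.
move=> M0 fw0; have [F [UF ooF]] := ultra_nat.
(* Index [0] carries [w0]: no earlier agreement is demanded there, so the minimum can be compared
   with [phi0] itself. Index [i' + 1] evaluates the finitary set with code number [i']; numbers that
   code nothing receive a harmless default. *)
pose w (i : nat) : seq (R * set (nat -> bool)) := if i is i'.+1 then
  [:: (1, finitary_code (odflt (0%N, [::]) (unpickle i')))] else w0.
have [|phi [cphi invphi nullphi] minphi] :=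
    lexicographic_min UF ooF w (ex_intro _ _ M0) _ (invariant_content_closed UF).
  by move=> phi [/fc_bounded bphi _ _].
have [P PE] := finitary_extension cphi.
have Pfin (A : set fin_sigma) : measurable A -> P A \is a fin_num.
  by move=> mA; rewrite fin_num_measure.
have inv g (A : set fin_sigma) : measurable A -> P (act g @^-1` A) = P A.
  move=> mA.
  pose Qm : {measure set fin_sigma -> \bar R} := pushforward P (act g : fin_sigma -> fin_sigma).
  pose Q := Qm (act_measurable g).
  change (Q A = P A); apply/esym; apply: (@fin_sigma_measure_unique R P Q) => //.
    by apply: (@le_lt_trans _ _ 1%E); [exact: probability_le1|rewrite ltry].
  move=> B fB; change (P B = P (act g @^-1` B)).
  by rewrite !PE ?invphi//; exact: act_finitary.
exists P; split=> //.
- by move=> A fA NA; rewrite PE// nullphi.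
- move=> A mA invA.
  have [PA0|PA0] := eqVneq (P A) 0%E; first by left.
  have [PA1|PA1] := eqVneq (P A) 1%E; first by right.
  (* Otherwise [P] is a proper convex combination of its normalised restrictions
     to [A] and [~` A], which agree with [P] by extremality. *)
  exfalso.
  pose t := fine (P A).
  have tE : P A = t%:E by rewrite fineK// Pfin.
  have t0 : 0 < t.
    by rewrite -lte_fin -tE lt_def PA0 measure_ge0.
  have t1 : t < 1.
    by rewrite -lte_fin -tE lt_def eq_sym PA1 probability_le1.
  have cE : P (~` A) = (1 - t)%:E by rewrite probability_setC// tE.
  (* [s] stands for the mass of [B]. The value [0] off the finitary sets keeps [fc_bounded] valid
     for every set. *)
  pose psi (B : set (nat -> bool)) s (C : set (nat -> bool)) : R :=
    if `[< finitary C >] then s^-1 * fine (P (C `&` B)) else 0.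
  have Mpsi (B : set fin_sigma) s : 0 < s -> P B = s%:E -> measurable B ->
      (forall g, act g @^-1` B = B) -> invariant_content (psi B s).
    move=> s0 PB mB invB.
    have mC C : finitary C -> measurable (C `&` B : set fin_sigma).
      by move=> fC; apply: measurableI => //; exact: finitary_measurable.
    have FC C : finitary C -> P (C `&` B) \is a fin_num by move=> /mC; exact: Pfin.
    split; first split.
    + move=> C; rewrite /psi; case: asboolP => fC; last by rewrite lexx ler01.
      rewrite mulr_ge0 ?invr_ge0 ?(ltW s0) ?fine_ge0//=.
      rewrite mulrC ler_pdivrMr// mul1r -lee_fin fineK ?FC// -PB.
      by apply: le_measure; rewrite ?inE//; exact: mC.
    + move=> C D fC fD CD; rewrite /psi !asboolT//; last exact: finitaryU.
      rewrite -mulrDr -fineD ?FC// setIUl measureU//; [exact: mC|exact: mC|].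
      by rewrite setIACA CD set0I.
    + rewrite /psi asboolT; last exact: finitaryT.
      by rewrite setTI PB mulVf ?gt_eqF.
    + move=> g C fC; rewrite /psi !asboolT//; last exact: act_finitary.
      by rewrite -[in LHS](invB g) -preimage_setI inv//; exact: mC.
    + move=> C fC NC; rewrite /psi asboolT//.
      have -> : P (C `&` B) = 0%E; last by rewrite mulr0.
      apply/eqP; rewrite eq_le measure_ge0 andbT.
      have <- : P C = 0%E by rewrite PE// nullphi.
      by apply: le_measure; rewrite ?inE//; [exact: mC|exact: finitary_measurable].
  have MA := Mpsi A t t0 tE mA invA.
  have MC : invariant_content (psi (~` A) (1 - t)).
    apply: Mpsi; rewrite ?subr_gt0//; first exact: measurableC.
    by move=> g; rewrite -preimage_setC invA.
  have conv C : finitary C ->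
      phi C = t * psi A t C + (1 - t) * psi (~` A) (1 - t) C.
    move=> fC; rewrite /psi asboolT// !mulrA !divff ?gt_eqF ?subr_gt0// !mul1r.
    have mC := finitary_measurable fC.
    rewrite -fineD ?Pfin//; [|exact: measurableI|by apply: measurableI => //; exact: measurableC].
    rewrite -measureU; [|exact: measurableI|by apply: measurableI => //; exact: measurableC|].
      rewrite -setIUr setUv setIT; exact: (congr1 fine (esym (PE _ fC))).
    by rewrite setIACA setICr setI0.
  have fw i c : c \in w i -> finitary c.2.
    case: i => [|i]; first exact: fw0.
    by rewrite inE => /eqP->; exact: finitary_code_finitary.
  have ext i : pairing (w i) (psi A t) = pairing (w i) phi.
    apply: (lexicographic_min_extreme (t := t) minphi MA MC); first by rewrite t0.
    move=> {}i; rewrite /pairing !mulr_sumr -big_split /=.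
    elim: (w i) (fw i) => [|c s IH] fs; first by rewrite !big_nil.
    rewrite !big_cons IH; last by move=> d ds; apply: fs; rewrite inE ds orbT.
    rewrite (conv c.2); last by apply: fs; rewrite inE eqxx.
    by congr (_ + _); rewrite mulrDr mulrCA [in X in _ + X]mulrCA.
  have PA C : finitary C -> P (C `&` A) = (t%:E * P C)%E.
    move=> fC; have [c cE'] := finitary_codeP fC.
    have := ext (pickle c).+1; rewrite /pairing /w pickleK /= !big_seq1 /= !mul1r -cE'.
    rewrite /psi asboolT// => /(congr1 (fun x => t * x)).
    rewrite mulrA divff ?gt_eqF// mul1r => tphi.
    rewrite (PE C fC) -EFinM -tphi fineK// Pfin//.
    by apply: measurableI => //; exact: finitary_measurable.
  (* [A] is independent of every finitary set, hence of every measurable set by uniqueness of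
     measures, and so of itself: [t = t * t], against [0 < t < 1]. *)
  have : mrestr P mA A = mscale (NngNum (ltW t0)) P A.
    apply: fin_sigma_measure_unique => //.
    by rewrite /= /mrestr setTI tE ltry.
  rewrite /mrestr /mscale /= setIid tE -EFinM => -[] /eqP.
  by rewrite -subr_eq0 -{1}[t]mulr1 -mulrBr mulf_eq0 subr_eq0 gt_eqF//= gt_eqF.
- have := minphi 0%N phi0 M0 (fun _ => ltac:(by [])).
  apply: le_trans; rewrite /pairing /= le_eqVlt; apply/orP; left; apply/eqP.
  elim: w0 fw0 {w minphi} => [|c s IH] fs; first by rewrite !big_nil.
  rewrite !big_cons IH; last by move=> d ds; apply: fs; rewrite inE ds orbT.
  by rewrite PE//; apply: fs; rewrite inE eqxx.
Qed.

End ErgodicExtension.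

(** * An ergodic factor *)

Lemma countable_enum (T : Type) (A : set T) (a0 : T) : countable A -> A a0 ->
  exists e : nat -> T, (forall n, A (e n)) /\ forall a, A a -> exists n, e n = a.
Proof.
move=> /countable_injP[f finj] Aa0.
pose P n := [set a | A a /\ f a = n].
pose e n := if pselect (exists a, P n a) is left h then projT1 (cid h) else a0.
exists e; split.
  by move=> n; rewrite /e; case: pselect => // h; case: cid => a [].
move=> a Aa; exists (f a); rewrite /e; case: pselect => [h|]; last first.
  by case; exists a.
case: cid => b [Ab fb] /=.
by apply: finj => //; exact: mem_set.
Qed.

Lemma countable_setU (T : Type) (A B : set T) :
  countable A -> countable B -> countable (A `|` B).
Proof.
move=> cA cB.
have -> : A `|` B = \bigcup_(b in [set: bool]) (if b then A else B).
  apply/seteqP; split=> x; first by case=> ?; [exists true|exists false].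
  by case=> -[] _ ?; [left|right].
by apply: bigcup_countable => [|[] _] //; exact: countableP.
Qed.

(** * Separating sets and a form of freeness that survives limits *)

Section StandardAction.
Variables (R : realType) (G : groupType) (alpha : standard_action R G).
Local Notation mu := (sa_mu alpha).
Local Notation act := (@sa_act R G alpha).

Lemma sa_actK g : cancel (act g) (act g^-1%g).
Proof. by move=> x; rewrite -sa_actM mulVg sa_act1. Qed.

Lemma sa_act_measurable g (A : set alpha) :
  measurable A -> measurable (act g @^-1` A).
Proof.
by move=> mA; rewrite -[X in measurable X]setTI; exact: sa_measurable.
Qed.

(** The sets are preimages of balls of radius [1 / (m + 1)] around the points of a countable dense
    set. Interiors are taken to have open, hence Borel, sets. *)
Lemma separating_family : exists V : nat -> set alpha,
  (forall m, measurable (V m)) /\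
  forall x y, x <> y -> exists m, V m x /\ ~ V m y.
Proof.
have [P [f [hP [S cS dS] bf mf]]] := sa_borel alpha.
have fT : range f = setT.
  have [h _ fK] := bf; apply/seteqP; split=> // y _; exists (h y) => //.
have [s0 Ss0] : S !=set0.
  have [z [_ Sz]] := dS setT (ex_intro _ (point : P) I) openT.
  by exists z.
have [e [Se eS]] := countable_enum cS Ss0.
pose V k : set alpha := if unpickle k is Some (i, m) then
  f @^-1` (ball (e i) (m.+1%:R^-1 : R))° else set0.
exists V; split=> [k|x y xy].
  rewrite /V; case: unpickle => [[i m]|]; last exact: measurable0.
  apply/mf; rewrite image_preimage//; apply: sub_sigma_algebra.
  exact: open_interior.
have fxy : f x != f y by apply/eqP => /(bij_inj bf).
move: hP; rewrite open_hausdorff => /(_ _ _ fxy) [] [Q Q'] /= [/set_mem Qx /set_mem Q'y] [oQ _ /eqP QQ'].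
have Qy : ~ Q (f y) by move=> Qy; have : (Q `&` Q') (f y) by []; rewrite QQ'.
have /nbhs_ballP[r r0 rQ] : nbhs (f x) Q by exact: open_nbhs_nbhs.
(* For [q = 1 / (m + 1) <= r / 2] and a dense point [s] within [q / 2] of [f x], the ball of radius
   [q] around [s] contains [f x] and stays within [q / 2 + q < r] of it, so it misses [f y]. *)
have [m mr] : exists m : nat, m.+1%:R^-1 <= r / 2.
  have r2 : 0 < r / 2 by rewrite divr_gt0.
  exists (Num.truncn (r / 2)^-1); rewrite -[leRHS]invrK lef_pV2 ?posrE ?invr_gt0//.
  exact/ltW/truncnS_gt.
pose q : R := m.+1%:R^-1.
have q0 : 0 < q by rewrite invr_gt0.
have [s [sx Ss]] : (ball (f x) (q / 2))° `&` S !=set0.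
  apply: dS; last exact: open_interior.
  by exists (f x); apply: nbhsx_ballx; rewrite divr_gt0.
have [i si] := eS s Ss.
have xs : ball (f x) (q / 2) s by exact: interior_subset sx.
exists (pickle (i, m)); rewrite /V pickleK /= si; split.
  apply: (@filterS _ (nbhs (f x)) _ (ball (f x) (q / 2))).
    move=> z xz; rewrite [m.+1%:R^-1]splitr; apply: ball_triangle xz.
    exact: ball_sym.
  by apply: nbhsx_ballx; rewrite divr_gt0.
move=> /interior_subset sy; apply/Qy/rQ.
apply: (@le_ball _ _ _ (q / 2 + q)); last exact: ball_triangle sy.
have qr : q <= r / 2 by [].
clear - qr q0.
by lra.
Qed.

(* Freeness as the nullity of two sets built from finitely many translates of
   one set [B]: this condition, unlike freeness itself, passes to limits of
   measures. [B] is chosen greedily along a separating family. *)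
Lemma free_independent_set g : g != 1%g -> exists B : set alpha,
  [/\ measurable B, B `&` act g @^-1` B = set0 &
      mu (~` (B `|` act g @^-1` B `|` act g^-1%g @^-1` B)) = 0%E].
Proof.
move=> g1; have [V [mV sepV]] := separating_family.
(* [g] moves no point of [W m] into [W m], since the image has left [V m]. By freeness and
   separation the [W m] cover almost every point. *)
pose W m := V m `&` ~` (act g @^-1` V m).
have mW m : measurable (W m).
  by apply: measurableI => //; apply/measurableC/sa_act_measurable.
(* A point [x] of [W m'] is rejected only if [g x] or [g^-1 x] was taken before. So every point of
   some [W m] ends up in the union or next to it. *)
pose fix Bs (m : nat) : set alpha := if m is m'.+1 then
  Bs m' `|` (W m' `&` ~` (act g @^-1` Bs m' `|` act g^-1%g @^-1` Bs m'))
  else set0.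
have mBs m : measurable (Bs m).
  elim: m => [|m IH] /=; first exact: measurable0.
  apply: measurableU => //; apply: measurableI => //; apply: measurableC.
  by apply: measurableU; exact: sa_act_measurable.
have incBs i j : (i <= j)%N -> Bs i `<=` Bs j.
  elim: j => [|j IH]; first by rewrite leqn0 => /eqP->.
  by rewrite leq_eqVlt ltnS => /predU1P[->//|/IH H] x /H; left.
have indBs m x : Bs m x -> Bs m (act g x) -> False.
  elim: m => [//|m IH] /= [Bx|[[Vx nVx] nBx]] [Bgx|[[Vgx _] nBgx]] //.
  - exact: IH.
  - by apply: nBgx; right; rewrite /= sa_actK.
  - by apply: nBx; left.
pose B := \bigcup_m Bs m.
have mB : measurable B by exact: bigcupT_measurable.
exists B; split=> //.
  apply/seteqP; split=> // x [[i _ Bix] [j _ Bjx]].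
  apply: (indBs (maxn i j) x).
    exact: incBs (leq_maxl i j) _ Bix.
  exact: incBs (leq_maxr i j) _ Bjx.
have mD : measurable (~` (B `|` act g @^-1` B `|` act g^-1%g @^-1` B)).
  by apply: measurableC; apply: measurableU; [apply: measurableU|]; rewrite //;
    exact: sa_act_measurable.
apply/negligibleP => //.
have [N [mN N0 subN]] := sa_free alpha.
exists N; split=> // x nx; apply: subN => /= /(_ g g1) gx.
have [m [Vgx Vx]] := sepV x (act g x) (nesym gx).
apply: nx.
have [BN|] := pselect ((act g @^-1` Bs m `|` act g^-1%g @^-1` Bs m) x).
  by case: BN => Bx; [left; right|right]; exists m.
by move=> nB; left; left; exists m.+1 => //=; right.
Qed.

End StandardAction.

Record factor_algebra (R : realType) (G : groupType)
    (alpha beta : standard_action R G) := FactorAlgebra {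
  fa_map :> alpha -> beta;
  fa_sets : set (set beta);
  fa_equivariant : forall g x, fa_map (sa_act g x) = sa_act g (fa_map x);
  fa_setT : fa_sets setT;
  fa_setC : setC_closed fa_sets;
  fa_setU : setU_closed fa_sets;
  fa_act : forall g A, fa_sets A -> fa_sets (sa_act g @^-1` A);
  fa_measurable : forall A, fa_sets A -> measurable A;
  fa_preimage : forall A, fa_sets A -> measurable (fa_map @^-1` A);
  fa_null : forall A, fa_sets A -> sa_mu alpha (fa_map @^-1` A) = 0%E ->
    sa_mu beta A = 0%E
}.

Section ErgodicFactor.
Variables (R : realType) (G : groupType) (alpha : standard_action R G).
Local Notation mu := (sa_mu alpha).

Lemma coordinates : exists (b : nat -> G * nat) (c : G * nat -> nat),
  cancel b c /\ cancel c b.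
Proof.
have : ([set: G * nat] #= [set: nat])%card.
  apply: eq_card_nat.
    have -> : [set: G * nat] = [set: G] `*` [set: nat] by apply/seteqP; split.
    by apply: countableX; [exact: (sa_countable alpha)|exact: countableP].
  move=> /(finite_image snd) fin; apply: infinite_nat.
  by apply: sub_finite_set fin => n _; exists (1%g, n).
move=> /pcard_eqP[c].
have [b cK bK] : bijective c by rewrite -setTT_bijective.
by exists b, c.
Qed.

Variables (E : set (set alpha)) (w : seq (R * set alpha)).
Hypotheses (cE : countable E) (mE : forall A, E A -> measurable A)
  (wE : forall c, c \in w -> E c.2).

(** Each set of [E] becomes a coordinate of the target, read at the identity of [G], and is thereby
    the exact preimage of a finitary set. The functional [w] has first priority in the minimisation,
    with the pushforward of [mu] as a competitor, whence the final inequality. *)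
Lemma ergodic_factor : exists (beta : standard_action R G)
    (p : factor_algebra alpha beta) (F : set alpha -> set beta),
  [/\ ergodic beta,
      forall A, E A -> fa_sets p (F A) /\ p @^-1` F A = A &
      \sum_(c <- w) c.1 * fine (sa_mu beta (F c.2)) <=
      \sum_(c <- w) c.1 * fine (mu c.2)].
Proof.
have [e [_ eG]] := countable_enum (sa_countable alpha) (I : [set: G] 1%g).
have indep g : exists B : set alpha, measurable B /\ (g != 1%g ->
    B `&` sa_act g @^-1` B = set0 /\
    mu (~` (B `|` sa_act g @^-1` B `|` sa_act g^-1%g @^-1` B)) = 0%E).
  have [->|g1] := eqVneq g 1%g; first by exists set0.
  by have [B [mB B1 B2]] := free_independent_set alpha g1; exists B.
have {indep} [B BP] := choice indep.
(* Besides [E], the coordinates record the sets that witness freeness for every group element;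
   [set0] makes the family nonempty, as its enumeration demands. *)
pose E' := E `|` range (B \o e) `|` [set set0].
have mE' A : E' A -> measurable A.
  by case=> [[/mE//|[n _ <-]]|->//]; exact: (BP _).1.
have cE' : countable E'.
  apply: countable_setU; last exact/finite_set_countable/finite_set1.
  by apply: countable_setU => //; exact/countable_image/countableP.
have [En [E'En EnE]] : exists En : nat -> set alpha,
    (forall n, E' (En n)) /\ forall A, E' A -> exists n, En n = A.
  by apply: (countable_enum (a0 := set0)) => //; right.
have [b [c [bK cK]]] := coordinates.
(* The shift [(g k)(h, m) = k (g^-1 h, m)], written through the bijection [b]. With [p x (h, m)]
   telling whether [h^-1 x] lies in [En m], it is the action for which [p] is equivariant. *)
pose act (g : G) (k : nat -> bool) : nat -> bool :=
  fun n => k (c ((g^-1 * (b n).1)%g, (b n).2)).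
have act_fin g A : finitary A -> finitary (act g @^-1` A).
  exact: finitary_preimage.
pose p (x : alpha) : nat -> bool :=
  fun n => `[< En (b n).2 (sa_act (b n).1^-1%g x) >].
have pE g x : p (sa_act g x) = act g (p x).
  apply/funext => n; rewrite /p /act cK /= invgM invgK sa_actM.
  by [].
have mp A : finitary A -> measurable (p @^-1` A).
  move=> /finitary_codeP[[N T] ->].
  have mq (l : seq nat) (t : seq bool) :
      measurable [set x | [seq p x i | i <- l] = t].
    elim: l t => [|i l IH] [|v t].
    - by have -> : [set x : alpha | [seq p x i | i <- [::]] = [::]] = setT by apply/seteqP; split.
    - by have -> : [set x : alpha | [seq p x i | i <- [::]] = v :: t] = set0 by apply/seteqP; split.
    - by have -> : [set x : alpha | [seq p x i | i <- i :: l] = [::]] = set0 by apply/seteqP; split.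
    have -> : [set x : alpha | [seq p x i | i <- i :: l] = v :: t] =
        (if v then sa_act (b i).1^-1%g @^-1` En (b i).2
         else ~` (sa_act (b i).1^-1%g @^-1` En (b i).2)) `&`
        [set x | [seq p x i | i <- l] = t].
      apply/seteqP; split=> x /=.
        by case=> <- <-; split=> //; rewrite /p; case: asboolP.
      move=> [vx <-]; congr (_ :: _); rewrite /p.
      by case: v vx => vx; case: asboolP.
    apply: measurableI => //.
    by case: v; [|apply: measurableC]; apply/sa_act_measurable/mE'/E'En.
  have -> : p @^-1` finitary_code (N, T) = \bigcup_t
      (if t \in T then [set x | [seq p x i | i <- iota 0 N] = t] else set0).
    apply/seteqP; split=> x; rewrite /finitary_code /=.
      by move=> xT; exists [seq p x i | i <- iota 0 N] => //; rewrite xT.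
    by move=> [t _]; case: ifP => // tT ->.
  apply: countable_bigcupT_measurable => [|t]; first exact: countableP.
  by case: ifP => // _; exact: mq.
pose null A := mu (p @^-1` A) = 0%E.
pose phi0 (A : set (nat -> bool)) : R :=
  if `[< finitary A >] then fine (mu (p @^-1` A)) else 0.
have M0 : invariant_content act null phi0.
  have fin A : finitary A -> mu (p @^-1` A) \is a fin_num.
    by move=> fA; rewrite fin_num_measure//; exact: mp.
  split; first split.
  - move=> A; rewrite /phi0; case: asboolP => fA; last by rewrite lexx ler01.
    rewrite fine_ge0//= -lee_fin fineK ?fin//.
    by apply: probability_le1; exact: mp.
  - move=> A C fA fC AC; rewrite /phi0 !asboolT//; last exact: finitaryU.
    rewrite -fineD ?fin// preimage_setU measureU//; [exact: mp|exact: mp|].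
    by rewrite -preimage_setI AC preimage_set0.
  - rewrite /phi0 asboolT; last exact: finitaryT.
    by rewrite preimage_setT probability_setT.
  - move=> g A fA; rewrite /phi0 !asboolT//; last exact: act_fin.
    rewrite -[in RHS](sa_preserving g); last exact: mp.
    congr (fine (mu _)); apply/seteqP; split=> x /=; by rewrite pE.
  - by move=> A fA; rewrite /null /phi0 asboolT// => ->.
have FP A : exists D, E A -> [/\ finitary D & p @^-1` D = A].
  have [EA|nEA] := pselect (E A); last by exists set0.
  have [j jA] : exists j, En j = A by apply: EnE; left; left.
  exists [set k | k (c (1%g, j))] => _; split; first exact: finitary_coord.
  apply/seteqP; split=> x /=.
    by rewrite /p cK /= invg1 sa_act1 jA => /asboolP.
  by rewrite /p cK /= invg1 sa_act1 jA => /asboolP.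
have {FP} [F FP] := choice FP.
pose w0 := [seq (d.1, F d.2) | d <- w].
have fw0 d : d \in w0 -> finitary d.2.
  move=> /mapP[d' /wE Ed ->].
  by have [] := FP _ Ed.
have [P [nullP invP ergP wP]] := ergodic_extension act_fin M0 fw0.
have act1 k : act 1%g k = k.
  apply/funext => n; rewrite /act invg1 mul1g; congr k.
  by rewrite -[RHS]bK; case: (b n).
have actM g h k : act (g * h)%g k = act g (act h k).
  by apply/funext => n; rewrite /act cK /= invgM mulgA.
have bP : standard_borel R fin_sigma.
  exists (bs_space R), (BStream R); split.
  - exact: bs_hausdorff.
  - exact: bs_separable.
  - by exists (@bs_val R) => // -[].
  - by move=> A; exact: bs_borel.
have freeP : {ae P, forall x, forall g, g != 1%g -> act g x <> x}.
  have : {ae P, forall x, forall n, e n != 1%g -> act (e n) x <> x}.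
    apply: ae_foralln => n.
    have [->|g1] := eqVneq (e n) 1%g.
      by apply: aeW => x /eqP.
    set g := e n.
    have [mB /(_ g1)[indB covB]] := BP g.
    have [j jB] : exists j, En j = B g by apply: EnE; left; right; exists n.
    pose U : set (nat -> bool) := [set k | k (c (1%g, j))].
    have fU : finitary U by exact: finitary_coord.
    have pU : p @^-1` U = B g.
      apply/seteqP; split=> x /=.
        by rewrite /U /p /= cK /= invg1 sa_act1 jB => /asboolP.
      by move=> Bx; rewrite /U /p /= cK /= invg1 sa_act1 jB; exact/asboolP.
    have pact h : p @^-1` (act h @^-1` U) = sa_act h @^-1` B g.
      by rewrite -pU; apply/seteqP; split=> x /=; rewrite pE.
    (* A fixed point of [act g] lies in [U1] if it is in [U], and otherwise in [U2], as [g] and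
       [g^-1] leave it in place. Both sets are finitary with null preimage under [p]. *)
    pose U1 := U `&` act g @^-1` U.
    pose U2 := ~` (U `|` act g @^-1` U `|` act g^-1%g @^-1` U).
    have fU1 : finitary U1 by apply: finitaryI => //; exact: act_fin.
    have fU2 : finitary U2.
      apply: finitaryC; apply: finitaryU; last exact: act_fin.
      by apply: finitaryU => //; exact: act_fin.
    have PU1 : P U1 = 0%E.
      apply: nullP => //; rewrite /null /U1 preimage_setI pact pU indB.
      exact: measure0.
    have PU2 : P U2 = 0%E.
      apply: nullP => //; rewrite /null /U2 -preimage_setC !preimage_setU !pact pU.
      exact: covB.
    exists (U1 `|` U2); split.
    - by apply: measurableU; exact: finitary_measurable.
    - have : P.-negligible (U1 `|` U2).
        by apply: negligibleU; apply/negligibleP => //; exact: finitary_measurable.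
      by move/negligibleP; apply; apply: measurableU; exact: finitary_measurable.
    move=> k /= /not_implyP[_ /contrapT gk].
    have [Uk|nUk] := pselect (U k); [left|right].
      by split=> //; rewrite /= gk.
    move=> [[//|]|] /=; first by rewrite gk.
    by rewrite -{1}gk -actM mulVg act1.
  move=> [N [mN N0 subN]]; exists N; split=> // k nk; apply: subN => fk.
  apply: nk => g g1; have [n gn] := eG g I.
  by rewrite -gn; apply: fk; rewrite gn.
pose beta := @StandardAction R G _ fin_sigma P act (sa_countable alpha) bP act1
  actM (act_measurable act_fin) invP freeP.
pose pf := @FactorAlgebra R G alpha beta p finitary pE finitaryT finitaryC
  finitaryU act_fin finitary_measurable mp nullP.
exists beta, pf, F; split.
- move=> A mA invA; exact: ergP.
- by move=> A /FP[].
- move: wP; rewrite /w0 /pairing !big_map /=; move/le_trans; apply.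
  rewrite le_eqVlt; apply/orP; left; apply/eqP.
  elim: w wE => [|d s IH] ds; first by rewrite !big_nil.
  rewrite !big_cons IH; last by move=> d' ds'; apply: ds; rewrite inE ds' orbT.
  have [fF pF] := FP _ (ds d (mem_head _ _)).
  by rewrite /phi0 asboolT// pF.
Qed.

End ErgodicFactor.

(** * Self-maps of countable image *)

Section CountableModules.
Context {A : nzRingType}.
Hypothesis cA : countable [set: A].
Implicit Types M N : lmodType A.

Definition span M (S : set M) : set M :=
  [set x | exists s : seq (A * M),
     (forall c, c \in s -> S c.2) /\ x = \sum_(c <- s) c.1 *: c.2].

Lemma countable_combinations M (S : set M) : countable S -> countable (span S).
Proof.
move=> cS.
have [a [_ aA]] := countable_enum cA (I : [set: A] 0).
have c0S : countable (S `|` [set 0]).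
  by apply: countable_setU => //; exact/finite_set_countable/finite_set1.
have [v [_ vS]] := countable_enum (a0 := 0) c0S (or_intror erefl).
pose f (s : seq (nat * nat)) : M := \sum_(i <- s) a i.1 *: v i.2.
apply: (@sub_countable _ _ _ (range f)); last exact/countable_image/countableP.
apply: subset_card_le => x [s [sS ->]].
elim: s sS => [|c s IH] sS; first by exists [::] => //; rewrite /f !big_nil.
have [|t _ tE] := IH; first by move=> d ds; apply: sS; rewrite inE ds orbT.
have [i ic] := aA c.1 I.
have [j jc] := vS c.2 (or_introl (sS c (mem_head _ _))).
by exists ((i, j) :: t) => //; rewrite /f !big_cons /= ic jc -tE.
Qed.

(** [is_basis] tests independence on duplicate-free lists only, so the coefficients of equal vectors
    must first be collected. *)
Lemma big_regroup M N (s : seq (A * M)) (phi : M -> N) :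
  \sum_(c <- s) c.1 *: phi c.2 =
  \sum_(b <- undup [seq c.2 | c <- s]) (\sum_(c <- s | c.2 == b) c.1) *: phi b.
Proof.
under [RHS]eq_bigr do rewrite scaler_suml big_mkcond.
rewrite exchange_big /=; apply: eq_big_seq => c cs.
rewrite (bigD1_seq c.2) ?undup_uniq ?mem_undup ?map_f//= eqxx.
by rewrite big1 ?addr0// => b /negPf bc; rewrite eq_sym bc.
Qed.

Lemma basis_relation M N (B : set M) (phi : M -> N) (s : seq (A * M)) :
  is_basis B -> (forall c, c \in s -> B c.2) ->
  \sum_(c <- s) c.1 *: c.2 = 0 -> \sum_(c <- s) c.1 *: phi c.2 = 0.
Proof.
move=> [_ indB] sB s0; rewrite big_regroup// big1_seq// => b /andP[_ bs].
pose d b := \sum_(c <- s | c.2 == b) c.1.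
rewrite -/(d b) (indB _ d (undup_uniq _) _ _ b bs) ?scale0r//.
- move=> x /=; rewrite mem_undup => /mapP[c cs ->]; exact: sB.
- exact: etrans (esym (big_regroup s id)) s0.
Qed.

Lemma basis_extension M N (B : set M) (phi : M -> N) : is_basis B ->
  exists h : {linear M -> N}, (forall b, B b -> h b = phi b) /\
    range h `<=` span (phi @` B).
Proof.
move=> bB.
have spanB x : exists s : seq (A * M),
    (forall c, c \in s -> B c.2) /\ x = \sum_(c <- s) c.1 *: c.2.
  have [s [c [sB xE]]] := bB.1 x; exists [seq (c b, b) | b <- s]; split.
    by move=> d /mapP[b bs ->]; exact: sB.
  by rewrite big_map.
have [r rP] := choice spanB.
pose h x := \sum_(c <- r x) c.1 *: phi c.2.
have hE x s : (forall c, c \in s -> B c.2) -> x = \sum_(c <- s) c.1 *: c.2 ->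
    h x = \sum_(c <- s) c.1 *: phi c.2.
  move=> sB xE; apply/eqP; rewrite -subr_eq0; apply/eqP.
  have := @basis_relation M N B phi (r x ++ [seq (- c.1, c.2) | c <- s]) bB.
  have negE (V : lmodType A) (psi : M -> V) :
      \sum_(c <- s) - c.1 *: psi c.2 = - \sum_(c <- s) c.1 *: psi c.2.
    by rewrite -sumrN; apply: eq_bigr => c _; rewrite scaleNr.
  rewrite !big_cat !big_map /= negE (negE M id); apply; last first.
    by rewrite /= -(rP x).2 -xE subrr.
  move=> c; rewrite mem_cat => /orP[|/mapP[d ds ->]]; first exact: (rP x).1.
  by move=> /=; exact: sB.
have hlin : linear h.
  move=> k x y.
  rewrite (hE _ ([seq (k * c.1, c.2) | c <- r x] ++ r y)).
  - rewrite big_cat big_map /= /h scaler_sumr; congr (_ + _).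
    by apply: eq_bigr => c _; rewrite scalerA.
  - move=> c; rewrite mem_cat => /orP[/mapP[d ds ->] /=|]; first exact: (rP x).1.
    exact: (rP y).1.
  - rewrite big_cat big_map /= {1}(rP x).2 {1}(rP y).2 scaler_sumr; congr (_ + _).
    by apply: eq_bigr => c _; rewrite scalerA.
pose H : {linear M -> N} := HB.pack h (GRing.isLinear.Build _ _ _ _ h hlin).
exists H; split=> [b Bb|_ [x _ <-]].
  rewrite [LHS](hE _ [:: (1, b)]).
  - by rewrite big_seq1 scale1r.
  - by move=> c; rewrite inE => /eqP->.
  - by rewrite big_seq1 scale1r.
exists [seq (c.1, phi c.2) | c <- r x]; split; last by rewrite big_map.
move=> _ /mapP[c cr ->] /=; exists c.2 => //; exact: (rP x).1.
Qed.

Lemma free_lift_countable M N N' (p : {linear N -> N'}) (f : {linear M -> N'}) :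
  is_free M -> countable (range f) -> (forall x, exists y, p y = f x) ->
  exists h : {linear M -> N}, (forall x, p (h x) = f x) /\ countable (range h).
Proof.
move=> [B bB] cf pf.
(* The preimage is chosen as a function of the value [f b], not of [b]. Hence only countably many
   lifts occur, however large the basis is. *)
pose Y z := xget 0 [set y | p y = z].
have YP x : p (Y (f x)) = f x.
  by rewrite /Y; case: xgetP => // nY; have [y yx] := pf x; case: (nY y).
have [h [hB hspan]] := basis_extension (fun b => Y (f b)) bB.
exists h; split.
  move=> x; have [s [c [sB ->]]] := bB.1 x.
  rewrite !linear_sum; apply: eq_big_seq => b bs.
  by rewrite !linearZ hB ?YP//; exact: sB.
apply: (sub_countable (subset_card_le hspan)); apply: countable_combinations.
apply: (@sub_countable _ _ _ (Y @` range f)); last exact: countable_image.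
by apply: subset_card_le => _ [b _ <-]; exists (f b) => //; exists b.
Qed.

(* A free resolution may have uncountable rank, but it has a self-map over the
   identity of countable image. *)
Lemma countable_self_map (T : lmodType A) (C : aug_complex T) :
  countable [set: T] -> is_free_resolution C ->
  exists g : forall k, {linear C k -> C k},
    [/\ forall k x, cx_d C k (g k.+1 x) = g k (cx_d C k x),
        forall x, cx_aug C (g 0%N x) = cx_aug C x &
        forall k, countable (range (g k))].
Proof.
move=> cT [[ex0 exk] fr].
pose cyc k : C k -> Prop := if k is k'.+1 return C k -> Prop
  then fun x => cx_d C k' x = 0 else fun x => cx_aug C x = 0.
(* Preservation of cycles is carried along because it places [g \o cx_d C k] inside the boundaries,
   by exactness, which is what the next lift requires. *)
pose X k := {g : {linear C k -> C k} |
  countable (range g) /\ forall x, cyc k x -> cyc k (g x)}.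
have exactC k x : cyc k x -> exists y, cx_d C k y = x.
  by case: k x => [|k] x; [exact: ex0|exact: exk].
have boundC k x : cyc k (cx_d C k x).
  by case: k x => [|k] x; [exact: cx_aug_d|exact: cx_dd].
have [g0 [g0E cg0]] : exists h : {linear C 0%N -> C 0%N},
    (forall x, cx_aug C (h x) = cx_aug C x) /\ countable (range h).
  apply: free_lift_countable => //.
    by apply: sub_countable cT; exact: subset_card_le.
  by move=> x; exists x.
have X0P : countable (range g0) /\ forall x, cyc 0%N x -> cyc 0%N (g0 x).
  by split=> // x /=; rewrite g0E.
have step k (g : X k) : {g' : X k.+1 |
    forall x, cx_d C k (sval g' x) = sval g (cx_d C k x)}.
  apply: cid; case: g => g /= [cg gcyc].
  pose f : {linear C k.+1 -> C k} := g \o cx_d C k.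
  have [||h [hE ch]] := @free_lift_countable _ _ _ (cx_d C k) f (fr k.+1).
  - apply: sub_countable cg; apply: subset_card_le => _ [x _ <-].
    by exists (cx_d C k x).
  - by move=> x; apply: exactC; apply: gcyc; exact: boundC.
  have hP : countable (range h) /\ forall x, cyc k.+1 x -> cyc k.+1 (h x).
    by split=> // x /= x0; rewrite hE /f /= x0 linear0.
  by exists (exist _ h hP).
pose fix g k : X k := if k is k'.+1 then sval (step k' (g k')) else exist _ g0 X0P.
exists (fun k => sval (g k)); split=> //=.
- by move=> k x; exact: (svalP (step k (g k))).
- by move=> k; have [] := svalP (g k).
Qed.

End CountableModules.

Lemma crossed_sum_single (G : groupType) (L : comNzRingType) (a : ring_action G L)
    (r : crossed a) (s : seq G) : uniq s ->
  (forall g, ccoef r g != 0 -> g \in s) -> r = \sum_(g <- s) single (ccoef r g) g.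
Proof.
move=> us rs; apply: crossedP => g.
have -> : ccoef (\sum_(g <- s) single (a := a) (ccoef r g) g) g =
    \sum_(h <- s) ccoef (single (a := a) (ccoef r h) h) g.
  by elim/big_ind2 : _ => // x1 x2 y1 y2; rewrite ccoefD => <- <-.
rewrite /=; have [gs|gs] := boolP (g \in s).
  rewrite (bigD1_seq g)//= eqxx big1 ?addr0// => h hg.
  by rewrite eq_sym (negPf hg).
rewrite big1_seq; last by move=> h /= hs; case: eqP hs gs => // -> ->.
by apply/eqP; apply: contraR gs => /rs.
Qed.

Lemma crossed_countable (G : groupType) (L : comNzRingType) (a : ring_action G L) :
  countable [set: G] -> countable [set: L] -> countable [set: crossed a].
Proof.
move=> cG cL.
have [e [_ eG]] := countable_enum cG (I : [set: G] 1%g).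
have [l [_ lL]] := countable_enum cL (I : [set: L] 0).
pose f (s : seq (nat * nat)) : crossed a := \sum_(i <- s) single (l i.1) (e i.2).
apply: (@sub_countable _ _ _ (range f)); last exact/countable_image/countableP.
apply: subset_card_le => r _.
have [s us rs] := ccoef_supp r.
rewrite (crossed_sum_single us rs); elim: s {us rs} => [|g s [t _ tE]]; first by exists [::] => //; rewrite /f !big_nil.
have [i ig] := lL (ccoef r g) I; have [j jg] := eG g I.
by exists ((i, j) :: t) => //; rewrite /f !big_cons /= ig jg -tE.
Qed.

(** * Transfer of coefficients *)

(** This is why an essentially bounded function has finitely many values up to a null set. *)
Lemma coef_bounded_finite (R : realType) (Z : coefficients) (c : R) :
  exists s : seq Z, forall z, coef_norm R z <= c -> z \in s.
Proof.
case: Z => [|F] /=; last by exists (enum F) => z _; rewrite mem_enum.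
pose N := (Num.truncn c).+1.
exists ([seq (n%:Z) | n <- iota 0 N] ++ [seq (- n%:Z) | n <- iota 0 N]) => z zc.
have zN : (`|z| < N)%N.
  rewrite -(ltr_nat R) -[X in X < _]/((Posz `|z|%N)%:~R) abszE.
  exact: le_lt_trans zc (truncnS_gt _).
rewrite mem_cat; case: (intP z) zN => [|n|n] zN.
- by apply/orP; left; apply/mapP; exists 0%N => //; rewrite mem_iota.
- by apply/orP; left; apply/mapP; exists n.+1 => //; rewrite mem_iota.
- apply/orP; right; apply/mapP; exists n.+1 => //; rewrite mem_iota.
  by rewrite abszN in zN.
Qed.

Section LinftyRepr.
Context {R : realType} {G : groupType} {alpha : standard_action R G}
  {Z : coefficients}.
Local Notation mu := (sa_mu alpha).
Local Notation L := (Linfty alpha Z).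
Implicit Types l m : L.

Lemma linf_repr_linf (f : ebfun alpha Z) :
  {ae mu, forall x, linf_repr (linf f) x = f x}.
Proof. by apply/linf_eq; rewrite linf_reprK. Qed.

Lemma linf_reprD l m :
  {ae mu, forall x, linf_repr (l + m) x = linf_repr l x + linf_repr m x}.
Proof.
apply: (iffLR (linf_eq (linf_repr (l + m)) (linf_repr l + linf_repr m))).
by rewrite linfD !linf_reprK.
Qed.

Lemma linf_reprM l m :
  {ae mu, forall x, linf_repr (l * m) x = linf_repr l x * linf_repr m x}.
Proof.
apply: (iffLR (linf_eq (linf_repr (l * m)) (linf_repr l * linf_repr m))).
by rewrite linfM !linf_reprK.
Qed.

Lemma linf_repr_eq l m :
  {ae mu, forall x, linf_repr l x = linf_repr m x} -> l = m.
Proof. by move=> /linf_eq; rewrite !linf_reprK. Qed.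

Lemma ae_act g (P : alpha -> Prop) :
  {ae mu, forall x, P x} -> {ae mu, forall x, P (sa_act g x)}.
Proof.
move=> [N [mN N0 subN]]; exists (sa_act g @^-1` N); split.
- exact: sa_act_measurable.
- by rewrite sa_preserving.
- by move=> x Hx; apply: subN.
Qed.

Lemma linf_repr_shift g l : {ae mu, forall x,
  linf_repr (linf_shift g l) x = linf_repr l (sa_act g^-1%g x)}.
Proof. exact: (linf_repr_linf (ebshift g (linf_repr l))). Qed.

Lemma linf_repr_cst (z : Z) : {ae mu, forall x, linf_repr (linf_cst z : L) x = z}.
Proof. exact: (linf_repr_linf (EBFun (cst_subproof z))). Qed.

Lemma linf_repr_indic (S : set alpha) : measurable S ->
  {ae mu, forall x, linf_repr (linf_indic S : L) x = (x \in S)%:R}.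
Proof.
move=> mS; pose f : ebfun alpha Z := insubd 0 (fun x => (x \in S)%:R).
apply: filterS (linf_repr_linf f) => x ->; rewrite /f.
by rewrite /insubd insubT//; exact: indic_ess_bounded.
Qed.

End LinftyRepr.

Section Transfer.
Context {R : realType} {G : groupType} {alpha beta : standard_action R G}.
Variable p : factor_algebra alpha beta.
Local Notation mu := (sa_mu alpha).
Local Notation nu := (sa_mu beta).
Local Notation U := (fa_sets p).

Lemma fa_set0 : U set0.
Proof. by rewrite -setCT; apply: fa_setC; exact: fa_setT. Qed.

Lemma fa_setI : setI_closed U.
Proof.
move=> A B UA UB; rewrite -[A `&` B]setCK setCI.
by apply: fa_setC; apply: fa_setU; exact: fa_setC.
Qed.

Lemma fa_bigsetU (I : choiceType) (s : seq I) (F : I -> set beta) :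
  (forall i, i \in s -> U (F i)) -> U (\big[setU/set0]_(i <- s) F i).
Proof.
by move=> UF; rewrite big_seq; elim/big_ind : _ => //; [exact: fa_set0|exact: fa_setU].
Qed.

(** Finiteness of the set of values compensates for [fa_sets] being closed under finite unions only:
    every condition on the values then defines a set of the algebra. *)
Definition fa_simple (T : choiceType) (u : beta -> T) :=
  (exists s : seq T, forall y, u y \in s) /\ forall z, U (u @^-1` [set z]).

Lemma fa_simple_preimage (T : choiceType) (u : beta -> T) (B : set T) :
  fa_simple u -> U (u @^-1` B).
Proof.
move=> [[s us] Uu].
have -> : u @^-1` B =
    \big[setU/set0]_(z <- s) (if `[< B z >] then u @^-1` [set z] else set0).
  rewrite -bigcup_seq; apply/seteqP; split=> y.
    move=> By; exists (u y); first exact: us.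
    by case: asboolP.
  by case=> z _; case: asboolP => // Bz /= uz; rewrite /= uz.
by apply: fa_bigsetU => z _; case: asboolP => // _; exact: fa_set0.
Qed.

Lemma fa_simple_comp (T T' : choiceType) (f : T -> T') (u : beta -> T) :
  fa_simple u -> fa_simple (fun y => f (u y)).
Proof.
move=> su; split; last first.
  by move=> z; exact: (@fa_simple_preimage _ u (f @^-1` [set z])).
by have [[s us] _] := su; exists (map f s) => y; exact: map_f.
Qed.

Lemma fa_simple_pair (T T' : choiceType) (u : beta -> T) (v : beta -> T') :
  fa_simple u -> fa_simple v -> fa_simple (fun y => (u y, v y)).
Proof.
move=> [[s us] Uu] [[t vt] Uv]; split.
  by exists [seq (a, b) | a <- s, b <- t] => y; exact: allpairs_f.
move=> [a b].
have -> : (fun y => (u y, v y)) @^-1` [set (a, b)] =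
    u @^-1` [set a] `&` v @^-1` [set b].
  by apply/seteqP; split=> y /= [-> ->].
exact: fa_setI.
Qed.

Lemma fa_simple_op (T1 T2 T : choiceType) (op : T1 -> T2 -> T) u v :
  fa_simple u -> fa_simple v -> fa_simple (fun y => op (u y) (v y)).
Proof.
move=> su sv; exact: (fa_simple_comp (fun c => op c.1 c.2) (fa_simple_pair su sv)).
Qed.

Lemma fa_simple_cst (T : choiceType) (z : T) : fa_simple (fun=> z).
Proof.
split; first by exists [:: z] => y; rewrite inE.
move=> z'; rewrite preimage_cst; case: ifP => _; [exact: fa_setT|exact: fa_set0].
Qed.

Lemma fa_simple_mem (A : set beta) : U A -> fa_simple (fun y => y \in A).
Proof.
move=> UA; split; first by exists [:: true; false] => y; case: (y \in A).
move=> [].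
  have -> : (fun y => y \in A) @^-1` [set true] = A; last by [].
  by apply/seteqP; split=> y /= => [/set_mem|/mem_set].
have -> : (fun y => y \in A) @^-1` [set false] = ~` A; last exact: fa_setC.
apply/seteqP; split=> y /= => [/negbT/negP yA Ay|nAy].
  by apply: yA; exact: mem_set.
by apply/negbTE/negP => /set_mem.
Qed.

Lemma fa_simple_act (T : choiceType) (u : beta -> T) g :
  fa_simple u -> fa_simple (fun y => u (sa_act g y)).
Proof.
move=> [[s us] Uu]; split; first by exists s.
by move=> z; exact: (fa_act g (Uu z)).
Qed.

(** Almost everywhere statements pass from [alpha] to [beta] through this lemma; [U P] puts the
    exceptional set within reach of [fa_null]. *)
Lemma fa_ae (P : set beta) : U P -> {ae mu, forall x, P (p x)} ->
  {ae nu, forall y, P y}.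
Proof.
move=> UP aeP; exists (~` P); split=> //.
  by apply: (fa_measurable (f := p)); exact: fa_setC.
apply: (fa_null (f := p)); first exact: fa_setC.
have mP : measurable (p @^-1` (~` P)) by apply: fa_preimage; exact: fa_setC.
by apply/negligibleP.
Qed.

Section Coefficients.
Context {Z : coefficients}.
Local Notation La := (Linfty alpha Z).
Local Notation Lb := (Linfty beta Z).

Lemma fa_simple_bounded (u : beta -> Z) : fa_simple u ->
  exists c : R, forall y, coef_norm R (u y) <= c.
Proof.
move=> [[s us] _]; exists (\sum_(z <- s) coef_norm R z) => y.
move: (us y) => {us}; elim: s => [//|z s IH]; rewrite inE big_cons => /predU1P[->|/IH].
  by rewrite lerDl sumr_ge0// => *; exact: coef_norm_ge0.
by move/le_trans; apply; rewrite lerDr coef_norm_ge0.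
Qed.

Lemma fa_simple_ess_bounded (u : beta -> Z) : fa_simple u ->
  u \in ess_bounded beta Z.
Proof.
move=> su; apply/asboolP; split.
  by move=> B; apply: (fa_measurable (f := p)); exact: fa_simple_preimage.
by have [c uc] := fa_simple_bounded su; exists c; exact: aeW.
Qed.

(* A relation and not a map, because only the classes that are pulled back from
   a simple function on [beta] can be transferred. *)
Definition linf_rel (l : La) (l' : Lb) := exists u : beta -> Z,
  [/\ fa_simple u, {ae mu, forall x, linf_repr l x = u (p x)} &
      {ae nu, forall y, linf_repr l' y = u y}].

(** The set where two simple functions agree belongs to the algebra, so their agreement almost
    everywhere along [p] forces agreement almost everywhere on [beta]. *)
Lemma linf_rel_functional l l1 l2 : linf_rel l l1 -> linf_rel l l2 -> l1 = l2.
Proof.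
move=> [u [su lu l1u]] [v [sv lv l2v]]; apply: linf_repr_eq.
have uv : {ae nu, forall y, u y = v y}.
  apply: (@fa_ae [set y | u y = v y]); last first.
    by apply: filterS2 lu lv => x ux vx; rewrite /= -ux -vx.
  exact: (@fa_simple_preimage _ _ [set c | c.1 = c.2] (fa_simple_pair su sv)).
by apply: filterS3 l1u l2v uv => y -> -> ->.
Qed.

Lemma linf_relD l m l' m' : linf_rel l l' -> linf_rel m m' ->
  linf_rel (l + m) (l' + m').
Proof.
move=> [u [su lu l'u]] [v [sv mv m'v]]; exists (fun y => u y + v y); split.
- exact: fa_simple_op.
- by apply: filterS3 (linf_reprD l m) lu mv => x -> -> ->.
- by apply: filterS3 (linf_reprD l' m') l'u m'v => x -> -> ->.
Qed.

Lemma linf_relM l m l' m' : linf_rel l l' -> linf_rel m m' ->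
  linf_rel (l * m) (l' * m').
Proof.
move=> [u [su lu l'u]] [v [sv mv m'v]]; exists (fun y => u y * v y); split.
- exact: fa_simple_op.
- by apply: filterS3 (linf_reprM l m) lu mv => x -> -> ->.
- by apply: filterS3 (linf_reprM l' m') l'u m'v => x -> -> ->.
Qed.

Lemma linf_rel_cst (z : Z) : linf_rel (linf_cst z) (linf_cst z).
Proof.
by exists (fun=> z); split;
  [exact: fa_simple_cst|exact: linf_repr_cst|exact: linf_repr_cst].
Qed.

Lemma linf_rel0 : linf_rel 0 0.
Proof. by have := linf_rel_cst 0; rewrite !rmorph0. Qed.

Lemma linf_rel1 : linf_rel 1 1.
Proof. by have := linf_rel_cst 1; rewrite !rmorph1. Qed.

Lemma linf_rel_indic (A : set beta) : U A ->
  linf_rel (linf_indic (p @^-1` A)) (linf_indic A).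
Proof.
move=> UA; exists (fun y => (y \in A)%:R); split.
- exact: (fa_simple_comp (fun b : bool => b%:R) (fa_simple_mem UA)).
- apply: filterS (linf_repr_indic (Z := Z) (fa_preimage UA)) => x ->.
  by congr (_%:R); apply/idP/idP => /set_mem xA; apply: mem_set.
- exact/linf_repr_indic/(fa_measurable UA).
Qed.

Lemma linf_rel_shift g l l' : linf_rel l l' ->
  linf_rel (linf_shift g l) (linf_shift g l').
Proof.
move=> [u [su lu l'u]]; exists (fun y => u (sa_act g^-1%g y)); split.
- exact: fa_simple_act.
- apply: filterS2 (linf_repr_shift g l) (ae_act g^-1%g lu) => x -> ->.
  by rewrite fa_equivariant.
- by apply: filterS2 (linf_repr_shift g l') (ae_act g^-1%g l'u) => x -> ->.
Qed.

Lemma linf_rel_sum (I : Type) (s : seq I) (F : I -> La) (F' : I -> Lb) :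
  (forall i, linf_rel (F i) (F' i)) ->
  linf_rel (\sum_(i <- s) F i) (\sum_(i <- s) F' i).
Proof.
move=> FF'; elim/big_rec2 : _ => [|i l l' _]; first exact: linf_rel0.
exact: linf_relD.
Qed.

Definition transferable (A : set alpha) := exists2 B, U B & p @^-1` B = A.

Definition level_sets (l : La) : set (set alpha) :=
  range (fun z => linf_repr l @^-1` [set z]).

Lemma linf_rel_exists l : level_sets l `<=` transferable ->
  exists l', linf_rel l l'.
Proof.
move=> lt.
have /choice[B BP] : forall z, exists B, U B /\ p @^-1` B = linf_repr l @^-1` [set z].
  by move=> z; have [|B UB BE] := lt (linf_repr l @^-1` [set z]); [exists z|exists B].
have [c lc] := (ebfunP (linf_repr l)).2.
have [s sP] := coef_bounded_finite Z c.
(* Outside the image of [p] the sets [B z] may overlap or fail to cover. Taking the first match, and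
   [0] if there is none, gives a function anyway, and on the image of [p] the match is unique. *)
pose u (s : seq Z) (y : beta) : Z :=
  foldr (fun z v => if y \in B z then z else v) 0 s.
have su t : fa_simple (u t).
  elim: t => [|z t IH] /=; first exact: fa_simple_cst.
  exact: (fa_simple_op (fun b v => if b then z else v) (fa_simple_mem (BP z).1) IH).
have uE t x : linf_repr l x \in t -> u t (p x) = linf_repr l x.
  elim: t => [//|z t IH]; rewrite inE /=.
  case: ifPn => [/set_mem Bz _|nB].
    by have : (p @^-1` B z) x by []; rewrite (BP z).2.
  case/predU1P => [zE|]; last exact: IH.
  case/negP: nB; apply/mem_set.
  by have : (linf_repr l @^-1` [set z]) x by []; rewrite -(BP z).2.
exists (linf (EBFun (fa_simple_ess_bounded (su s)))), (u s); split=> //.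
- by apply: filterS lc => x /sP xs; rewrite uE.
- exact: linf_repr_linf.
Qed.

Definition linf_transfer (l : La) : Lb := xget 0 [set l' | linf_rel l l'].

Lemma linf_transferE l l' : linf_rel l l' -> linf_transfer l = l'.
Proof.
rewrite /linf_transfer => ll'; case: xgetP => [l2 _ ll2|/(_ l')//].
exact: linf_rel_functional ll2 ll'.
Qed.

Lemma linf_transferP l : level_sets l `<=` transferable ->
  linf_rel l (linf_transfer l).
Proof. by move=> /linf_rel_exists[l' ll']; rewrite (linf_transferE ll'). Qed.

Local Notation Ra := (crossed_ring alpha Z).
Local Notation Rb := (crossed_ring beta Z).

Definition crossed_rel (r : Ra) (r' : Rb) :=
  forall g, linf_rel (ccoef r g) (ccoef r' g).

Lemma crossed_rel_functional r r1 r2 :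
  crossed_rel r r1 -> crossed_rel r r2 -> r1 = r2.
Proof.
move=> rr1 rr2; apply: crossedP => g.
exact: linf_rel_functional (rr1 g) (rr2 g).
Qed.

Lemma crossed_relD r t r' t' : crossed_rel r r' -> crossed_rel t t' ->
  crossed_rel (r + t) (r' + t').
Proof. by move=> rr' tt' g; rewrite !ccoefD; exact: linf_relD. Qed.

Lemma crossed_rel0 : crossed_rel 0 0.
Proof. by move=> g; exact: linf_rel0. Qed.

Lemma crossed_rel_single l l' g : linf_rel l l' ->
  crossed_rel (single l g) (single l' g).
Proof. by move=> ll' h /=; case: eqP => // _; exact: linf_rel0. Qed.

Lemma crossed_supp2 (r : Ra) (r' : Rb) : exists2 s : seq G, uniq s &
  (forall g, ccoef r g != 0 -> g \in s) /\ forall g, ccoef r' g != 0 -> g \in s.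
Proof.
have [s us rs] := ccoef_supp r; have [s' us' rs'] := ccoef_supp r'.
exists (undup (s ++ s')); first exact: undup_uniq.
by split=> g; rewrite mem_undup mem_cat; [move=> /rs ->|move=> /rs' ->; rewrite orbT].
Qed.

Lemma crossed_relM r t r' t' : crossed_rel r r' -> crossed_rel t t' ->
  crossed_rel (r * t) (r' * t').
Proof.
move=> rr' tt' g; have [s us [rs rs']] := crossed_supp2 r r'.
rewrite -[ccoef (r * t) g]/(@crossed_conv _ _ (Linfty_action alpha Z) (ccoef r) (ccoef t) g).
rewrite -[ccoef (r' * t') g]/(@crossed_conv _ _ (Linfty_action beta Z) (ccoef r') (ccoef t') g).
rewrite (crossed_convE _ _ us rs) (crossed_convE _ _ us rs').
apply: linf_rel_sum => h; apply: linf_relM; first exact: rr'.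
exact: linf_rel_shift.
Qed.

Lemma crossed_rel_sum (I : Type) (s : seq I) (F : I -> Ra) (F' : I -> Rb) :
  (forall i, crossed_rel (F i) (F' i)) ->
  crossed_rel (\sum_(i <- s) F i) (\sum_(i <- s) F' i).
Proof.
move=> FF'; elim/big_rec2 : _ => [|i l l' _]; first exact: crossed_rel0.
exact: crossed_relD.
Qed.

Lemma crossed_rel_incl (c : group_ring Z G) :
  crossed_rel (group_ring_incl alpha c) (group_ring_incl beta c).
Proof. by move=> g; exact: linf_rel_cst. Qed.

Lemma linf_rel_scale (r : Ra) (r' : Rb) (l : Linfty_module alpha Z)
    (l' : Linfty_module beta Z) :
  crossed_rel r r' -> linf_rel l l' -> linf_rel (r *: l) (r' *: l').
Proof.
move=> rr' ll'; have [s us [rs rs']] := crossed_supp2 r r'.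
rewrite -[r *: l]/(@crossed_conv _ _ (Linfty_action alpha Z) (ccoef r) (fun=> l) 1%g).
rewrite -[r' *: l']/(@crossed_conv _ _ (Linfty_action beta Z) (ccoef r') (fun=> l') 1%g).
rewrite (crossed_convE _ _ us rs) (crossed_convE _ _ us rs').
apply: linf_rel_sum => h; apply: linf_relM; first exact: rr'.
exact: linf_rel_shift.
Qed.

Lemma crossed_transfer_subproof (r : Ra) :
  (fun g => linf_transfer (ccoef r g)) \in finitely_supported.
Proof.
have [s us rs] := ccoef_supp r; apply/finitely_supportedP; exists s => // g.
apply: contraR => /(contraR (rs g))/eqP ->.
by apply/eqP; apply: linf_transferE; exact: linf_rel0.
Qed.

Definition crossed_transfer (r : Ra) : Rb :=
  Crossed _ (crossed_transfer_subproof r).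

Definition crossed_level_sets (r : Ra) : set (set alpha) :=
  \bigcup_g level_sets (ccoef r g).

Lemma crossed_transferE r r' : crossed_rel r r' -> crossed_transfer r = r'.
Proof. by move=> rr'; apply: crossedP => g; exact: linf_transferE. Qed.

Lemma crossed_transferP r : crossed_level_sets r `<=` transferable ->
  crossed_rel r (crossed_transfer r).
Proof.
by move=> rt g; apply: linf_transferP => A Ag; apply: rt; exists g.
Qed.

End Coefficients.
End Transfer.

Section LevelSets.
Context {R : realType} {G : groupType} {alpha : standard_action R G}
  {Z : coefficients}.

Lemma level_sets_measurable (l : Linfty alpha Z) A :
  level_sets l A -> measurable A.
Proof. by move=> [z _ <-]; exact: (ebfunP (linf_repr l)).1. Qed.

Lemma level_sets_countable (l : Linfty alpha Z) : countable (level_sets l).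
Proof. exact/countable_image/coef_countable. Qed.

Lemma crossed_level_sets_countable (r : crossed_ring alpha Z) :
  countable (crossed_level_sets r).
Proof.
apply: bigcup_countable; first exact: (sa_countable alpha).
by move=> g _; exact: level_sets_countable.
Qed.

Lemma crossed_level_sets_measurable (r : crossed_ring alpha Z) A :
  crossed_level_sets r A -> measurable A.
Proof. by case=> g _; exact: level_sets_measurable. Qed.

End LevelSets.

(** * Base change of marked complexes *)

Section MarkedSums.
Context {R : realType} {G : groupType} {alpha : standard_action R G}
  {Z : coefficients}.
Local Notation L := (Linfty alpha Z).
Local Notation LG := (crossed_ring alpha Z).

Definition crossed_indic (S : set alpha) : LG := single (linf_indic S) 1%g.

Lemma crossed_single_mul1 (l l' : L) g :
  single (a := Linfty_action alpha Z) l g * single l' 1%g =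
  single (l * linf_shift g l') g.
Proof.
apply: crossedP => h; apply: etrans (conv_single _ _ _ _) _ => /=.
have -> : ((g^-1 * h)%g == 1%g) = (h == g).
  by rewrite -[LHS](inj_eq (mulgI g)) mulVKg mulg1.
by case: eqP => // _; rewrite rmorph0 mulr0.
Qed.

Lemma crossed_indicM (A B : set alpha) : measurable A -> measurable B ->
  crossed_indic A * crossed_indic B = crossed_indic (A `&` B).
Proof.
move=> mA mB; rewrite /crossed_indic crossed_single_mul1 linf_shift1.
congr single; apply: linf_repr_eq.
have mAB := measurableI _ _ mA mB.
have H : {ae sa_mu alpha, forall x,
    linf_repr (linf_indic A * linf_indic B : L) x = (x \in A)%:R * (x \in B)%:R}.
  by apply: filterS3 (linf_reprM (linf_indic A : L) (linf_indic B)) (linf_repr_indic (Z := Z) mA)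
    (linf_repr_indic (Z := Z) mB) => x -> -> ->.
apply: filterS2 H (linf_repr_indic (Z := Z) mAB) => x -> ->.
by rewrite in_setI -natrM mulnb.
Qed.

(** The indicator is idempotent, so membership in the left ideal becomes an equation, and equations
    can be transferred to [beta]. *)
Lemma principalP (S : set alpha) (r : LG) : measurable S ->
  principal S r <-> r * crossed_indic S = r.
Proof.
move=> mS; split=> [[t ->]|<-]; last by exists r.
by rewrite -mulrA crossed_indicM// setIid.
Qed.

Section MarkedSum.
Variables (I : finType) (S : I -> set alpha).

Definition in_marked_sum : {pred {ffun I -> LG^o}} :=
  fun z => [forall i, (z i : LG) * crossed_indic (S i) == z i].

Lemma in_marked_sumP (z : {ffun I -> LG^o}) :
  reflect (forall i, (z i : LG) * crossed_indic (S i) = z i) (z \in in_marked_sum).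
Proof. by apply: (iffP forallP) => zS i; apply/eqP. Qed.

Lemma marked_sum_submod : submod_closed in_marked_sum.
Proof.
split=> [|a y z /in_marked_sumP yS /in_marked_sumP zS]; apply/in_marked_sumP => i.
  by rewrite ffunE mul0r.
rewrite !ffunE mulrDl zS; congr (_ + _).
by change (a * (y i : LG) * crossed_indic (S i) = a * (y i : LG)); rewrite -mulrA yS.
Qed.

HB.instance Definition _ := GRing.isSubmodClosed.Build LG {ffun I -> LG^o}
  in_marked_sum marked_sum_submod.

Record marked_sum := MarkedSum {
  marked_val :> {ffun I -> LG^o}; _ : marked_val \in in_marked_sum }.

HB.instance Definition _ := [isSub for marked_val].
HB.instance Definition _ := [Choice of marked_sum by <:].
HB.instance Definition _ := [SubChoice_isSubLmodule of marked_sum by <:].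

Hypothesis mS : forall i, measurable (S i).

Lemma marked_sum_mulr (z : marked_sum) i : (z i : LG) * crossed_indic (S i) = z i.
Proof. by case: z => z zS; exact: (in_marked_sumP _ zS i). Qed.

Definition marked_sum_iso : {linear marked_sum -> {ffun I -> LG^o}} :=
  (val : marked_sum -> {ffun I -> LG^o}).

Lemma marked_sum_range : range marked_sum_iso = principal_sum S.
Proof.
apply/seteqP; split=> [_ [z _ <-] i|z zS].
  by apply/principalP => //; exact: marked_sum_mulr.
have zS' : z \in in_marked_sum.
  by apply/in_marked_sumP => i; apply/principalP.
by exists (MarkedSum zS').
Qed.

Definition marked_sum_marking : marking marked_sum :=
  @Marking _ _ _ _ _ I S mS marked_sum_iso val_inj marked_sum_range.

Definition marked_sum_vec (M : lmodType LG) (v : I -> M) (z : marked_sum) : M :=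
  \sum_i (z i : LG) *: v i.

Lemma marked_sum_vec_linear (M : lmodType LG) (v : I -> M) : linear (marked_sum_vec v).
Proof.
move=> a y z; rewrite /marked_sum_vec scaler_sumr -big_split; apply: eq_bigr => i _.
have -> : (a *: y + z) i = a * (y i : LG) + z i by rewrite /= !ffunE.
by rewrite scalerDl scalerA.
Qed.

HB.instance Definition _ (M : lmodType LG) (v : I -> M) := GRing.isLinear.Build LG marked_sum M
  *:%R (marked_sum_vec v) (marked_sum_vec_linear v).

End MarkedSum.

Section MarkedMap.
Variables (I J : finType) (S : I -> set alpha) (T : J -> set alpha).

Variable m : I -> J -> LG.
Hypothesis mT : forall i j, m i j * crossed_indic (T j) = m i j.

Lemma marked_map_row_subproof i : [ffun j => m i j : LG^o] \in in_marked_sum T.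
Proof. by apply/in_marked_sumP => j; rewrite ffunE mT. Qed.

Definition marked_map : {linear marked_sum S -> marked_sum T} :=
  marked_sum_vec (fun i => MarkedSum (marked_map_row_subproof i)).

Lemma marked_mapE z j : marked_map z j = \sum_i (z i : LG) * m i j.
Proof.
rewrite /marked_map /= /marked_sum_vec.
have -> (s : seq I) : marked_val (\sum_(i <- s) (z i : LG) *:
    MarkedSum (marked_map_row_subproof i)) j =
    \sum_(i <- s) marked_val ((z i : LG) *: MarkedSum (marked_map_row_subproof i)) j.
  elim/big_rec2 : _ => [|i y x _ <-]; first by rewrite /= ffunE.
  by rewrite /= ffunE.
by apply: eq_bigr => i _ /=; rewrite !ffunE.
Qed.

End MarkedMap.

Section MarkedBasis.
Variables (M : lmodType LG) (mM : marking M).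
Local Notation I := (mk_index mM).

Definition marked_unit (i : I) : {ffun I -> LG^o} :=
  [ffun j => if j == i then crossed_indic (mk_set i) else 0].

Lemma marked_basis_subproof i : exists b : M, mk_iso mM b = marked_unit i.
Proof.
suff : principal_sum (@mk_set _ _ _ _ _ mM) (marked_unit i).
  by rewrite -mk_iso_range => -[b _ bi]; exists b.
move=> j; apply/principalP; first exact: mk_measurable.
rewrite /marked_unit ffunE; case: eqP => [->|_]; last exact: mul0r.
by rewrite crossed_indicM ?setIid//; exact: mk_measurable.
Qed.

(** Generators rather than a free basis: [crossed_indic (mk_set i)] fixes [marked_basis i]. *)
Definition marked_basis (i : I) : M := projT1 (cid (marked_basis_subproof i)).

Lemma mk_iso_basis i j :
  mk_iso mM (marked_basis i) j = if j == i then crossed_indic (mk_set i) else 0.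
Proof. by rewrite /marked_basis; case: cid => b /= ->; rewrite ffunE. Qed.

Lemma mk_iso_mulr x i : (mk_iso mM x i : LG) * crossed_indic (mk_set i) = mk_iso mM x i.
Proof.
apply/principalP; first exact: mk_measurable.
have : range (mk_iso mM) (mk_iso mM x) by exists x.
by rewrite mk_iso_range; exact.
Qed.

Lemma marked_expansion x : x = \sum_i (mk_iso mM x i : LG) *: marked_basis i.
Proof.
apply: (@mk_iso_inj _ _ _ _ _ mM); apply/ffunP => j.
rewrite linear_sum sum_ffunE (bigD1 j)//= big1 ?addr0.
  rewrite linearZ ffunE mk_iso_basis eqxx.
  by rewrite -[LHS]mk_iso_mulr.
move=> i ij; rewrite linearZ ffunE mk_iso_basis eq_sym (negPf ij).
exact: mulr0.
Qed.

Lemma marked_linear (N : lmodType LG) (f : {linear M -> N}) x :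
  f x = \sum_i (mk_iso mM x i : LG) *: f (marked_basis i).
Proof.
by rewrite {1}[x]marked_expansion linear_sum; apply: eq_bigr => i _; rewrite linearZ.
Qed.

Lemma marked_linear_coord (N : lmodType LG) (mN : marking N)
    (f : {linear M -> N}) x j :
  mk_iso mN (f x) j =
  \sum_i (mk_iso mM x i : LG) * (mk_iso mN (f (marked_basis i)) j : LG).
Proof.
rewrite (marked_linear f) linear_sum sum_ffunE; apply: eq_bigr => i _.
by rewrite linearZ ffunE.
Qed.

End MarkedBasis.
End MarkedSums.

Section BaseChange.
Context {R : realType} {G : groupType} {alpha beta : standard_action R G}
  {Z : coefficients}.
Variable p : factor_algebra alpha beta.

Definition factor_hat (A : set alpha) : set beta :=
  xget set0 [set B | fa_sets p B /\ p @^-1` B = A].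

Lemma factor_hatP A : transferable p A ->
  fa_sets p (factor_hat A) /\ p @^-1` factor_hat A = A.
Proof.
rewrite /factor_hat => -[B UB BA]; case: xgetP => [C -> //|/(_ B)[]]; by [].
Qed.

Lemma crossed_rel_indic B : fa_sets p B ->
  crossed_rel p (crossed_indic (p @^-1` B)) (crossed_indic B : crossed_ring beta Z).
Proof. by move=> UB; apply: crossed_rel_single; exact: linf_rel_indic. Qed.

Lemma crossed_rel_hat A : transferable p A ->
  crossed_rel p (crossed_indic A) (crossed_indic (factor_hat A) : crossed_ring beta Z).
Proof. by move=> /factor_hatP[UA pA]; rewrite -{1}pA; exact: crossed_rel_indic. Qed.

Variables (D : marked_complex alpha Z) (w : D 0%N).
Local Notation mk k := (mc_marking D k).
Local Notation bas k i := (@marked_basis _ _ _ _ _ (mk k) i).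
Local Notation coef k i j := (mk_iso (mk k) (cx_d D k (bas k.+1 i)) j).

(** The coefficients of [w] are included because [w], of augmentation [1], witnesses the
    surjectivity of the augmentation. *)
Definition complex_sets : set (set alpha) :=
  (\bigcup_k (range (@mk_set _ _ _ _ _ (mk k)) `|`
     \bigcup_i \bigcup_j crossed_level_sets (coef k i j))) `|`
  ((\bigcup_i level_sets (cx_aug D (bas 0%N i))) `|`
   \bigcup_i crossed_level_sets (mk_iso (mk 0%N) w i)).

Hypotheses (wD : complex_sets `<=` transferable p) (w1 : cx_aug D w = 1).

Definition bc_set k (i : mk_index (mk k)) := factor_hat (mk_set i).

Lemma bc_setP k (i : mk_index (mk k)) :
  fa_sets p (bc_set i) /\ p @^-1` bc_set i = mk_set i.
Proof. by apply: factor_hatP; apply: wD; left; exists k => //; left; exists i. Qed.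

Lemma bc_set_rel k (i : mk_index (mk k)) :
  crossed_rel p (crossed_indic (mk_set i)) (crossed_indic (bc_set i) : crossed_ring beta Z).
Proof.
by apply: crossed_rel_hat; apply: wD; left; exists k => //; left; exists i.
Qed.

Lemma bc_set_measurable k (i : mk_index (mk k)) : measurable (bc_set i).
Proof. exact: (fa_measurable (bc_setP i).1). Qed.

Definition bc_coef k (i : mk_index (mk k.+1)) (j : mk_index (mk k)) :
  crossed_ring beta Z := crossed_transfer p (coef k i j).

Lemma bc_coef_rel k (i : mk_index (mk k.+1)) (j : mk_index (mk k)) :
  crossed_rel p (coef k i j) (bc_coef i j).
Proof.
apply: crossed_transferP => A lA; apply: wD; left; exists k => //; right.
by exists i => //; exists j.
Qed.

(** The pattern of all transferred identities: both sides are related to the same element over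
    [alpha], and [crossed_rel] is functional. *)
Lemma bc_coef_mulr k (i : mk_index (mk k.+1)) (j : mk_index (mk k)) :
  bc_coef i j * crossed_indic (bc_set j) = bc_coef i j.
Proof.
have rel := crossed_relM (bc_coef_rel i j) (bc_set_rel j).
rewrite mk_iso_mulr in rel.
exact: crossed_rel_functional rel (bc_coef_rel i j).
Qed.

Definition bc_mod k : lmodType (crossed_ring beta Z) :=
  marked_sum (Z := Z) (@bc_set k).

Definition bc_d k : {linear bc_mod k.+1 -> bc_mod k} :=
  marked_map (@bc_set k.+1) (@bc_coef_mulr k).

Lemma bc_dE k (z : bc_mod k.+1) j :
  marked_val (bc_d k z) j = \sum_i (marked_val z i : crossed_ring beta Z) * bc_coef i j.
Proof. exact: marked_mapE. Qed.

Definition bc_aug_coef (i : mk_index (mk 0%N)) : Linfty_module beta Z :=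
  linf_transfer p (cx_aug D (bas 0%N i)).

Lemma bc_aug_rel i : linf_rel p (cx_aug D (bas 0%N i)) (bc_aug_coef i).
Proof.
by apply: linf_transferP => A lA; apply: wD; right; left; exists i.
Qed.

Definition bc_aug : {linear bc_mod 0%N -> Linfty_module beta Z} :=
  marked_sum_vec (S := @bc_set 0%N) bc_aug_coef.

Lemma bc_augE (z : bc_mod 0%N) :
  bc_aug z = \sum_i (marked_val z i : crossed_ring beta Z) *: bc_aug_coef i.
Proof. by []. Qed.

Lemma bc_dd k x : bc_d k (bc_d k.+1 x) = 0.
Proof.
apply: val_inj; apply/ffunP => l; rewrite [LHS]bc_dE [RHS]ffunE.
under eq_bigr do rewrite bc_dE mulr_suml.
rewrite exchange_big /= big1// => i _.
under eq_bigr do rewrite -mulrA.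
rewrite -mulr_sumr.
suff -> : \sum_j bc_coef i j * bc_coef j l = 0 by rewrite mulr0.
have rel := crossed_rel_sum (index_enum _)
  (fun j => crossed_relM (bc_coef_rel i j) (bc_coef_rel j l)).
rewrite -marked_linear_coord cx_dd linear0 ffunE in rel.
exact: crossed_rel_functional rel (crossed_rel0 _).
Qed.

Lemma linf_rel_sum_scale (I : Type) (s : seq I) (r : I -> crossed_ring alpha Z)
    (r' : I -> crossed_ring beta Z) (v : I -> Linfty_module alpha Z)
    (v' : I -> Linfty_module beta Z) :
  (forall i, crossed_rel p (r i) (r' i)) -> (forall i, linf_rel p (v i) (v' i)) ->
  linf_rel p (\sum_(i <- s) r i *: v i) (\sum_(i <- s) r' i *: v' i).
Proof.
move=> rr' vv'.
apply: (@linf_rel_sum _ _ _ _ p Z I s (fun i => r i *: v i) (fun i => r' i *: v' i)) => i.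
exact: linf_rel_scale.
Qed.

Lemma bc_aug_d x : bc_aug (bc_d 0 x) = 0.
Proof.
rewrite bc_augE.
under eq_bigr do rewrite bc_dE scaler_suml.
rewrite exchange_big /= big1// => i _.
transitivity ((marked_val x i : crossed_ring beta Z) *:
    \sum_j bc_coef i j *: bc_aug_coef j).
  by rewrite scaler_sumr; apply: eq_bigr => j _; rewrite scalerA.
suff -> : \sum_j bc_coef i j *: bc_aug_coef j = 0 by rewrite scaler0.
have rel := linf_rel_sum_scale (index_enum _) (bc_coef_rel i) bc_aug_rel.
rewrite -marked_linear cx_aug_d in rel.
exact: linf_rel_functional rel (linf_rel0 _).
Qed.

(** Transferring [w] yields an element of augmentation [1], and the term [(y, 1)] of the crossed
    product sends [1] to [y]. *)
Lemma bc_aug_surj y : exists x, bc_aug x = y.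
Proof.
pose W i : crossed_ring beta Z := crossed_transfer p (mk_iso (mk 0%N) w i).
have WP i : crossed_rel p (mk_iso (mk 0%N) w i) (W i).
  by apply: crossed_transferP => A lA; apply: wD; right; right; exists i.
have Wm i : W i * crossed_indic (bc_set i) = W i.
  have rel := crossed_relM (WP i) (bc_set_rel i).
  rewrite mk_iso_mulr in rel.
  exact: crossed_rel_functional rel (WP i).
have Wsum : [ffun i => W i : (crossed_ring beta Z)^o] \in
    in_marked_sum (Z := Z) (@bc_set 0%N).
  by apply/in_marked_sumP => i; rewrite ffunE Wm.
have W1 : bc_aug (MarkedSum Wsum) = 1 :> Linfty beta Z.
  rewrite bc_augE.
  have rel := linf_rel_sum_scale (index_enum _) WP bc_aug_rel.
  rewrite -marked_linear w1 in rel.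
  rewrite -(linf_rel_functional rel (linf_rel1 _)).
  by apply: eq_bigr => i _; rewrite /= ffunE.
exists (single y 1%g *: MarkedSum Wsum : bc_mod 0%N).
rewrite linearZ_LR W1.
change (@crossed_conv _ _ (Linfty_action beta Z) (ccoef (single (a := Linfty_action beta Z) y 1%g)) (fun=> 1) 1%g = y).
by rewrite conv_single rmorph1 mulr1.
Qed.

Definition base_change : marked_complex beta Z :=
  @MarkedComplex R G beta Z
    (@AugComplex (crossed_ring beta Z) (Linfty_module beta Z) bc_mod bc_d bc_aug
      bc_dd bc_aug_d bc_aug_surj)
    (fun k => marked_sum_marking (Z := Z) (@bc_set_measurable k)).

Section Embedding.
Variables (n : nat) (C : aug_complex (trivial_module Z G)).
Variables (f : forall k, C k -> D k) (g : forall k, {linear C k -> C k}).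
Arguments f : clear implicits.
Hypotheses (f_lin : forall k, (k <= n.+1)%N -> forall r x y,
    f k (r *: x + y) = group_ring_incl alpha r *: f k x + f k y)
  (f_d : forall k, (k <= n)%N -> forall x,
    f k (cx_d C k x) = cx_d D k (f k.+1 x))
  (f_aug : forall x, cx_aug D (f 0%N x) = linf_cst (cx_aug C x)).
Hypotheses (g_d : forall k x, cx_d C k (g k.+1 x) = g k (cx_d C k x))
  (g_aug : forall x, cx_aug C (g 0%N x) = cx_aug C x).

Definition embedding_sets : set (set alpha) :=
  \bigcup_k \bigcup_(y in range (g k)) \bigcup_i
     crossed_level_sets (mk_iso (mk k) (f k y) i).

Hypothesis tfg : embedding_sets `<=` transferable p.

Let F k (x : C k) i : crossed_ring beta Z :=
  crossed_transfer p (mk_iso (mk k) (f k (g k x)) i).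

Let F_rel k (x : C k) i : crossed_rel p (mk_iso (mk k) (f k (g k x)) i) (F x i).
Proof.
apply: crossed_transferP => A lA; apply: tfg.
by exists k => //; exists (g k x); [exists x|exists i].
Qed.

Let F_mulr k (x : C k) i : F x i * crossed_indic (bc_set i) = F x i.
Proof.
have rel := crossed_relM (F_rel x i) (bc_set_rel i).
rewrite mk_iso_mulr in rel.
exact: crossed_rel_functional rel (F_rel x i).
Qed.

Let F_subproof k (x : C k) :
  [ffun i => F x i : (crossed_ring beta Z)^o] \in in_marked_sum (Z := Z) (@bc_set k).
Proof. by apply/in_marked_sumP => i; rewrite ffunE F_mulr. Qed.

Lemma base_change_embedding : embedding_class n C base_change.
Proof.
exists (fun k x => MarkedSum (F_subproof x)); split.
- move=> k kn r x y; apply: val_inj; apply/ffunP => i.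
  rewrite /= !ffunE.
  have rel := crossed_relD (crossed_relM (crossed_rel_incl p r) (F_rel x i)) (F_rel y i).
  apply: crossed_transferE.
  rewrite linearP f_lin// linearP !ffunE; exact: rel.
- move=> k kn x; apply: val_inj; apply/ffunP => j.
  rewrite [RHS]bc_dE /= ffunE.
  have rel := crossed_rel_sum (index_enum _)
    (fun i => crossed_relM (F_rel x i) (bc_coef_rel i j)).
  rewrite -marked_linear_coord in rel.
  rewrite -f_d// g_d in rel.
  rewrite (crossed_rel_functional (F_rel _ j) rel).
  by apply: eq_bigr => i _; rewrite /= ffunE.
- move=> x; rewrite [LHS]bc_augE.
  have rel := linf_rel_sum_scale (index_enum _) (F_rel x) bc_aug_rel.
  rewrite -marked_linear f_aug g_aug in rel.
  rewrite -(linf_rel_functional rel (linf_rel_cst _ _)).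
  by apply: eq_bigr => i _; rewrite /= ffunE.
Qed.

End Embedding.
End BaseChange.

(** * Norms and ranks *)

Section Norms.
Context {R : realType} {G : groupType} {alpha : standard_action R G}
  {Z : coefficients}.
Local Notation mu := (sa_mu alpha).
Local Notation L := (Linfty alpha Z).
Local Notation LG := (crossed_ring alpha Z).

Lemma coef_norm0 : coef_norm R (0 : Z) = 0.
Proof. by case: Z => [|F] //=; rewrite eqxx. Qed.

Lemma coef_norm1 : coef_norm R (1 : Z) = 1.
Proof. by case: Z => [|F] //=; rewrite oner_eq0. Qed.

Definition linf_abs (l : L) (x : alpha) : R := coef_norm R (linf_repr l x).

Lemma linf_abs_ge0 (l : L) x : 0 <= linf_abs l x.
Proof. exact: coef_norm_ge0. Qed.

Lemma linf_abs_measurable l : measurable_fun setT (linf_abs l).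
Proof.
move=> _ Y _; rewrite setTI.
have -> : linf_abs l @^-1` Y = linf_repr l @^-1` (fun z => Y (coef_norm R z)) by [].
exact: (ebfunP (linf_repr l)).1.
Qed.

Lemma linf_abs_EFin_measurable l : measurable_fun setT (EFin \o linf_abs l).
Proof. exact/measurable_EFinP/linf_abs_measurable. Qed.

Lemma linf_norm1E (l : L) : (linf_norm1 l)%:E = (\int[mu]_x (linf_abs l x)%:E)%E.
Proof.
rewrite /linf_norm1 /Rintegral fineK// ge0_fin_numE; last first.
  by apply: integral_ge0 => x _; rewrite lee_fin linf_abs_ge0.
have [c lc] := (ebfunP (linf_repr l)).2.
apply: (@le_lt_trans _ _ (\int[mu]_x (cst (Num.max c 0)%:E x))%E).
  apply: ae_ge0_le_integral => //.
  - by move=> x _; rewrite lee_fin linf_abs_ge0.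
  - exact: linf_abs_EFin_measurable.
  - by move=> x _; rewrite lee_fin le_max lexx orbT.
  - by apply: filterS lc => x xc _; rewrite lee_fin le_max xc.
rewrite integral_cst// [X in (_ * X)%E](_ : _ = 1%E) ?mule1 ?ltry//.
exact: probability_setT.
Qed.

Lemma linf_norm1_ge0 (l : L) : 0 <= linf_norm1 l.
Proof.
by rewrite -lee_fin linf_norm1E; apply: integral_ge0 => x _; rewrite lee_fin linf_abs_ge0.
Qed.

Lemma linf_norm1_sumE (I : Type) (s : seq I) (l : I -> L) (c : R) : 0 <= c ->
  (c * \sum_(i <- s) linf_norm1 (l i))%:E =
  (\int[mu]_x (c * \sum_(i <- s) linf_abs (l i) x)%:E)%E.
Proof.
move=> c0.
transitivity (c%:E * \int[mu]_x (\sum_(i <- s) (linf_abs (l i) x)%:E))%E.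
  rewrite EFinM; congr (_ * _)%E; rewrite ge0_integral_sum//.
  - by rewrite -sumEFin; apply: eq_bigr => i _; rewrite linf_norm1E.
  - by move=> i; exact: linf_abs_EFin_measurable.
  - by move=> i x _; rewrite lee_fin linf_abs_ge0.
rewrite -ge0_integralZl_EFin//.
- by apply: eq_integral => x _; rewrite sumEFin -EFinM.
- by move=> x _; apply: sume_ge0 => i _; rewrite lee_fin linf_abs_ge0.
- by apply: emeasurable_sum => i; exact: linf_abs_EFin_measurable.
Qed.

(** The general comparison behind the norm estimates below: a pointwise inequality between weighted
    sums is integrated. One-element lists give statements about a single norm. *)
Lemma linf_norm1_sum_le (I J : Type) (s : seq I) (t : seq J) (l : I -> L)
    (m : J -> L) (c d : R) : 0 <= c -> 0 <= d ->
  {ae mu, forall x, c * \sum_(i <- s) linf_abs (l i) x <=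
                    d * \sum_(j <- t) linf_abs (m j) x} ->
  c * \sum_(i <- s) linf_norm1 (l i) <= d * \sum_(j <- t) linf_norm1 (m j).
Proof.
move=> c0 d0 ae_le; rewrite -lee_fin !linf_norm1_sumE//.
have mea (K : Type) (u : seq K) (n : K -> L) e : measurable_fun setT
    (EFin \o (fun x => e * \sum_(i <- u) linf_abs (n i) x)).
  apply/measurable_EFinP/measurable_funM; first exact: measurable_cst.
  exact: (measurable_sum _ (fun i => linf_abs_measurable (n i))).
apply: ae_ge0_le_integral => //.
- move=> x _; rewrite lee_fin mulr_ge0// sumr_ge0// => i _; exact: linf_abs_ge0.
- exact: mea.
- move=> x _; rewrite lee_fin mulr_ge0// sumr_ge0// => i _; exact: linf_abs_ge0.
- exact: mea.
- by apply: filterS ae_le => x H _; rewrite lee_fin.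
Qed.

Lemma linf_norm10 : linf_norm1 (0 : L) = 0.
Proof.
apply/eqP; rewrite eq_le linf_norm1_ge0 andbT.
have := @linf_norm1_sum_le nat nat [:: 0%N] [::] (fun=> 0 : L) (fun=> 0 : L) 1 0
  ler01 (lexx 0).
rewrite mul0r mul1r big_seq1; apply.
have -> : 0 = linf_cst 0 :> L by rewrite rmorph0.
by apply: filterS (linf_repr_cst (Z := Z) 0) => x x0; rewrite mul0r mul1r big_seq1 /linf_abs x0 coef_norm0.
Qed.

Lemma linf_norm1D (l m : L) : linf_norm1 (l + m) <= linf_norm1 l + linf_norm1 m.
Proof.
have := @linf_norm1_sum_le nat bool [:: 0%N] [:: true; false]
  (fun=> l + m) (fun b => if b then l else m) 1 1 ler01 ler01.
rewrite !mul1r big_seq1 big_cons big_seq1; apply.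
apply: filterS (linf_reprD l m) => x lm.
by rewrite !mul1r big_seq1 big_cons big_seq1 /linf_abs lm coef_normD.
Qed.

Lemma linf_norm1_indic (S : set alpha) : measurable S ->
  (linf_norm1 (linf_indic S : L))%:E = mu S.
Proof.
move=> mS; rewrite linf_norm1E -[RHS](congr1 mu (setIT S)) -integral_indic//.
have ae_eq : {ae mu, forall x, linf_abs (linf_indic S : L) x = \1_S x}.
  apply: filterS (linf_repr_indic (Z := Z) mS) => x xS.
  by rewrite /linf_abs xS indicE; case: (x \in S); rewrite ?coef_norm0 ?coef_norm1.
apply/eqP; rewrite eq_le; apply/andP; split; apply: ae_ge0_le_integral => //;
  try by move=> x _; rewrite lee_fin ?linf_abs_ge0.
- exact: linf_abs_EFin_measurable.
- exact/measurable_EFinP/measurable_indic.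
- by apply: filterS ae_eq => x -> _.
- exact/measurable_EFinP/measurable_indic.
- exact: linf_abs_EFin_measurable.
- by apply: filterS ae_eq => x -> _.
Qed.

Lemma linf_absM (l m : L) :
  {ae mu, forall x, linf_abs (l * m) x = linf_abs l x * linf_abs m x}.
Proof. by apply: filterS (linf_reprM l m) => x xlm; rewrite /linf_abs xlm coef_normM. Qed.

Lemma crossed_norm1E (r : LG) (s : seq G) : uniq s ->
  (forall g, ccoef r g != 0 -> g \in s) ->
  crossed_norm1 r = \sum_(g <- s) linf_norm1 (ccoef r g).
Proof.
move=> us rs; apply: fsumE => // g; apply: contraNT => gs.
have -> : ccoef r g = 0 by apply/eqP; apply: contraR gs => /rs.
by rewrite linf_norm10.
Qed.

Lemma crossed_norm10 : crossed_norm1 (0 : LG) = 0.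
Proof. by rewrite (@crossed_norm1E 0 [::])// => [|g]; rewrite ?big_nil//= eqxx. Qed.

Lemma crossed_norm1D (r t : LG) : crossed_norm1 (r + t) <= crossed_norm1 r + crossed_norm1 t.
Proof.
have [s us rs] := ccoef_supp r; have [s' us' ts'] := ccoef_supp t.
pose u := undup (s ++ s'); have uu : uniq u by exact: undup_uniq.
have ru g : ccoef r g != 0 -> g \in u by rewrite mem_undup mem_cat => /rs ->.
have tu g : ccoef t g != 0 -> g \in u by rewrite mem_undup mem_cat orbC => /ts' ->.
have rtu g : ccoef (r + t) g != 0 -> g \in u.
  rewrite ccoefD; apply: contraNT => gu.
  have -> : ccoef r g = 0 by apply/eqP; apply: contraR gu => /ru.
  have -> : ccoef t g = 0 by apply/eqP; apply: contraR gu => /tu.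
  by rewrite addr0.
rewrite (crossed_norm1E uu ru) (crossed_norm1E uu tu) (crossed_norm1E uu rtu).
by rewrite -big_split; apply: ler_sum => g _; rewrite ccoefD linf_norm1D.
Qed.

Lemma crossed_norm1_sum (I : Type) (s : seq I) (r : I -> LG) :
  crossed_norm1 (\sum_(i <- s) r i) <= \sum_(i <- s) crossed_norm1 (r i).
Proof.
elim/big_rec2 : _ => [|i y x _ xy]; first by rewrite crossed_norm10.
by rewrite (le_trans (crossed_norm1D _ _))// lerD2l.
Qed.

(** Left multiplication by a single term permutes the group elements in the support. Nothing
    cancels, so this is an equality. *)
Lemma crossed_norm1_single_mul (l : L) (g : G) (r : LG) (s : seq G) : uniq s ->
  (forall h, ccoef r h != 0 -> h \in s) ->
  crossed_norm1 (single l g * r : LG) =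
  \sum_(h <- s) linf_norm1 (l * linf_shift g (ccoef r h)).
Proof.
move=> us rs.
have E k : ccoef (single l g * r : LG) k = l * linf_shift g (ccoef r (g^-1 * k)%g).
  exact: conv_single.
rewrite (@crossed_norm1E _ [seq (g * h)%g | h <- s]).
- rewrite big_map; apply: eq_bigr => h _; congr linf_norm1.
  by rewrite E mulKg.
- by rewrite map_inj_uniq//; exact: mulgI.
- move=> k; rewrite E => nz; apply/mapP; exists (g^-1 * k)%g; last by rewrite mulVKg.
  by apply: rs; apply: contraNneq nz => ->; rewrite rmorph0 mulr0.
Qed.

(** Subadditivity reduces a bound for right multiplication to left factors with a single term. *)
Lemma crossed_norm1_mul_le (r : LG) (K : Type) (t : seq K) (m : K -> LG) (c : R) :
  (forall g, \sum_(k <- t) crossed_norm1 (single (ccoef r g) g * m k : LG) <=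
     c * linf_norm1 (ccoef r g)) ->
  \sum_(k <- t) crossed_norm1 (r * m k) <= c * crossed_norm1 r.
Proof.
move=> H; have [s us rs] := ccoef_supp r.
rewrite (crossed_norm1E us rs) mulr_sumr.
apply: (@le_trans _ _ (\sum_(k <- t) \sum_(g <- s) crossed_norm1 (single (ccoef r g) g * m k : LG))).
  apply: ler_sum => k _; rewrite {1}(crossed_sum_single us rs) mulr_suml.
  exact: crossed_norm1_sum.
by rewrite exchange_big; exact: ler_sum.
Qed.

Lemma ccoef_mul_indic (r : LG) (S : set alpha) g :
  ccoef (r * crossed_indic S) g = ccoef r g * linf_shift g (linf_indic S).
Proof.
change (crossed_conv (a := Linfty_action alpha Z) (ccoef r) (ccoef (crossed_indic S : LG)) g =
  ccoef r g * linf_shift g (linf_indic S)).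
rewrite /crossed_conv (@fsumE _ _ _ [:: g])//=.
  by rewrite big_seq1 mulVg eqxx.
move=> h; rewrite inE; apply: contraNT => /negPf hg.
by rewrite mulg_eq1 (inj_eq invg_inj) hg rmorph0 mulr0.
Qed.

End Norms.

(** * Operator norms through row sums of the matrix *)

Section OperatorNorm.
Context {R : realType} {G : groupType} {alpha : standard_action R G}
  {Z : coefficients}.
Local Notation mu := (sa_mu alpha).
Local Notation L := (Linfty alpha Z).
Local Notation LG := (crossed_ring alpha Z).
Variables (M N : lmodType LG) (mM : marking M) (mN : marking N).
Variable f : {linear M -> N}.
Local Notation I := (mk_index mM).
Local Notation J := (mk_index mN).

Definition matrix_coef (i : I) (j : J) : LG := mk_iso mN (f (marked_basis i)) j.

(* For the [1]-norms, the operator norm of [f] on [S] is the maximum over [i] of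
   the essential supremum of [row_abs s i] on [S i]. *)
Definition row_abs (s : seq G) (i : I) (x : alpha) : R :=
  \sum_(c <- [seq (j, g) | j <- index_enum J, g <- s])
    linf_abs (ccoef (matrix_coef i c.1) c.2) x.

Definition supports (s : seq G) := uniq s /\
  forall i j g, ccoef (matrix_coef i j) g != 0 -> g \in s.

Definition bounded_by (c : R) (S : I -> set alpha) :=
  0 <= c /\ forall z, marked_sub S z ->
    marked_norm1 mN (f z) <= c * marked_norm1 mM z.

Lemma supports_exists : exists s, supports s.
Proof.
have /choice[s0 s0P] : forall c : I * J, exists s : seq G,
    forall g, ccoef (matrix_coef c.1 c.2) g != 0 -> g \in s.
  by move=> c; have [s _ rs] := ccoef_supp (matrix_coef c.1 c.2); exists s.
exists (undup (flatten [seq s0 c | c <- enum {: I * J}])); split; first exact: undup_uniq.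
move=> i j g gij; rewrite mem_undup; apply/flattenP; exists (s0 (i, j)).
  by apply: map_f; rewrite mem_enum.
exact: s0P.
Qed.

Lemma row_abs_measurable s i : measurable_fun setT (row_abs s i).
Proof. exact: (measurable_sum _ (fun c => linf_abs_measurable (ccoef (matrix_coef i c.1) c.2))). Qed.

Lemma row_norm_single (s : seq G) i (l : L) g : supports s ->
  \sum_j crossed_norm1 (single l g * matrix_coef i j : LG) =
  \sum_(c <- [seq (j, h) | j <- index_enum J, h <- s])
    linf_norm1 (l * linf_shift g (ccoef (matrix_coef i c.1) c.2)).
Proof.
move=> [us ms]; rewrite big_allpairs; apply: eq_bigr => j _.
by rewrite (crossed_norm1_single_mul _ _ us (ms i j)).
Qed.

(** For a term [(l, g)] the norm of its product with row [i] is the integral of [|l|] times the row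
    sum at [g^-1 x], and [l] vanishes unless [g^-1 x] lies in [S i]. Summation over terms and rows
    gives the bound. *)
Lemma row_abs_le_bounded c s (S : I -> set alpha) : 0 <= c -> supports s ->
  (forall i, measurable (S i)) ->
  (forall i, {ae mu, forall x, S i x -> row_abs s i x <= c}) -> bounded_by c S.
Proof.
move=> c0 ss mS Sc; split=> // z Sz; rewrite /marked_norm1 mulr_sumr.
apply: (@le_trans _ _ (\sum_j \sum_i
    crossed_norm1 ((mk_iso mM z i : LG) * matrix_coef i j))).
  apply: ler_sum => j _; rewrite (@marked_linear_coord _ _ _ _ M mM N mN f z j).
  exact: crossed_norm1_sum.
rewrite exchange_big /=; apply: ler_sum => i _.
apply: crossed_norm1_mul_le => g; rewrite (row_norm_single _ _ _ ss).
set l := ccoef _ g.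
have := @linf_norm1_sum_le _ _ _ _ _ _ [seq (j, h) | j <- index_enum J, h <- s] [:: 0%N]
  (fun d => l * linf_shift g (ccoef (matrix_coef i d.1) d.2)) (fun=> l) 1 c ler01 c0.
rewrite mul1r big_seq1; apply.
have lS : {ae mu, forall x, linf_abs l x = linf_abs l x * (sa_act g^-1%g x \in S i)%:R}.
  have /principalP - /(_ (mS i)) Sz' := Sz i.
  have lE : l = l * linf_shift g (linf_indic (S i)).
    by rewrite -ccoef_mul_indic Sz'.
  have shS : {ae mu, forall x, linf_abs (linf_shift g (linf_indic (S i)) : L) x =
      (sa_act g^-1%g x \in S i)%:R}.
    apply: filterS2 (linf_repr_shift g (linf_indic (S i) : L))
      (ae_act g^-1%g (linf_repr_indic (Z := Z) (mS i))) => x xE xS.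
    by rewrite /linf_abs xE xS; case: (_ \in _); rewrite ?coef_norm0 ?coef_norm1.
  by apply: filterS2 shS (linf_absM l (linf_shift g (linf_indic (S i)))) => x <- <-; rewrite -lE.
have sh : {ae mu, forall x, \sum_(d <- [seq (j, h) | j <- index_enum J, h <- s])
    linf_abs (l * linf_shift g (ccoef (matrix_coef i d.1) d.2)) x =
    linf_abs l x * row_abs s i (sa_act g^-1%g x)}.
  rewrite /row_abs; elim: [seq _ | _ <- _, _ <- _] => [|d u IH].
    by apply: aeW => x; rewrite !big_nil mulr0.
  apply: filterS3 IH (linf_absM l (linf_shift g (ccoef (matrix_coef i d.1) d.2)))
    (linf_repr_shift g (ccoef (matrix_coef i d.1) d.2)) => x IH xM xS.
  by rewrite !big_cons IH xM mulrDr /linf_abs xS.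
apply: filterS3 lS sh (ae_act g^-1%g (Sc i)) => x lx -> Sx.
rewrite mul1r big_seq1 lx.
have [xS|_] := boolP (_ \in _); last by rewrite mulr0 mul0r mulr0.
by rewrite mulr1 mulrC ler_wpM2r ?linf_abs_ge0//; apply: Sx; exact/set_mem.
Qed.

(** The test element is the indicator of the set [T] where the row sum is at least [c + e], times
    the generator [i]. Its image has norm at least [(c + e)] times the measure of [T] but at most
    [c] times it, so [T] is null. *)
Lemma bounded_row_abs_le c s (S : I -> set alpha) : supports s ->
  (forall i, measurable (S i) /\ S i `<=` mk_set i) -> bounded_by c S ->
  forall i, {ae mu, forall x, S i x -> row_abs s i x <= c}.
Proof.
move=> ss mS [c0 Sc] i.
suff Tn n : {ae mu, forall x, ~ (S i x /\ c + n.+1%:R^-1 <= row_abs s i x)}.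
  apply: filterS (ae_foralln Tn) => x H Sx; rewrite leNgt; apply/negP => xc.
  have d0 : 0 < row_abs s i x - c by rewrite subr_gt0.
  apply: (H (Num.truncn (row_abs s i x - c)^-1)); split=> //.
  rewrite addrC -lerBrDr -[leRHS]invrK lef_pV2 ?posrE ?invr_gt0//.
  exact/ltW/truncnS_gt.
pose e : R := n.+1%:R^-1; have e0 : 0 < e by rewrite invr_gt0.
pose T : set alpha := S i `&` [set x | c + e <= row_abs s i x].
have mT : measurable T.
  apply: measurableI; first exact: (mS i).1.
  have := row_abs_measurable s i measurableT (measurable_itv `[c + e, +oo[).
  rewrite setTI; congr (measurable _); apply/seteqP.
  by split=> x /=; rewrite in_itv /= andbT.
have TS : T `<=` S i by move=> x [].
have TmS : T `<=` mk_set i by apply: subset_trans TS _; exact: (mS i).2.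
pose z : M := (crossed_indic T : LG) *: marked_basis i.
have zE j : mk_iso mM z j = if j == i then crossed_indic T else 0.
  rewrite /z linearZ ffunE mk_iso_basis; case: eqP => _; last exact: mulr0.
  change (crossed_indic T * crossed_indic (mk_set i) = (crossed_indic T : LG)).
  by rewrite crossed_indicM ?(setIidl TmS)//; exact: mk_measurable.
have Sz : marked_sub S z.
  move=> j; apply/principalP; first exact: (mS j).1.
  rewrite zE; case: eqP => [->|_]; last exact: mul0r.
  by rewrite crossed_indicM ?(setIidl TS)//; exact: (mS i).1.
have nz : marked_norm1 mM z = linf_norm1 (linf_indic T : L).
  rewrite /marked_norm1 (bigD1 i)//= zE eqxx big1 ?addr0.
    rewrite (@crossed_norm1E _ _ _ _ _ [:: 1%g])// ?big_seq1 ?eqxx//.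
      by rewrite /= eqxx.
    by move=> g; rewrite inE /=; case: (g == 1%g); rewrite ?eqxx.
  by move=> j /negPf ji; rewrite zE ji crossed_norm10.
have nfz : marked_norm1 mN (f z) = \sum_(d <- [seq (j, h) | j <- index_enum J, h <- s])
    linf_norm1 (linf_indic T * linf_shift 1%g (ccoef (matrix_coef i d.1) d.2)).
  rewrite -(row_norm_single i (linf_indic T) 1%g ss) /marked_norm1.
  by apply: eq_bigr => j _; rewrite /z !linearZ ffunE.
set t := linf_norm1 (linf_indic T : L) in nz.
have t0 : t <= 0.
  have := Sc z Sz; rewrite nz nfz => le1.
  have le2 : (c + e) * t <= c * t.
    apply: le_trans le1.
    have := @linf_norm1_sum_le _ _ _ _ _ _ [:: 0%N] [seq (j, h) | j <- index_enum J, h <- s]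
      (fun=> linf_indic T : L)
      (fun d => linf_indic T * linf_shift 1%g (ccoef (matrix_coef i d.1) d.2)) (c + e) 1
      (addr_ge0 c0 (ltW e0)) ler01.
    rewrite mul1r big_seq1; apply.
    have sh : {ae mu, forall x, \sum_(d <- [seq (j, h) | j <- index_enum J, h <- s])
        linf_abs (linf_indic T * linf_shift 1%g (ccoef (matrix_coef i d.1) d.2)) x =
        linf_abs (linf_indic T : L) x * row_abs s i x}.
      rewrite /row_abs; elim: [seq _ | _ <- _, _ <- _] => [|d u IH].
        by apply: aeW => x; rewrite !big_nil mulr0.
      apply: filterS2 IH (linf_absM (linf_indic T) (linf_shift 1%g (ccoef (matrix_coef i d.1) d.2))).
      by move=> x IH xM; rewrite !big_cons IH xM mulrDr linf_shift1.
    apply: filterS2 sh (linf_repr_indic (Z := Z) mT) => x -> xT.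
    rewrite big_seq1 mul1r mulrC /linf_abs xT.
    have [/set_mem[_ /= Tx]|_] := boolP (x \in T); last by rewrite coef_norm0 !mul0r.
    by rewrite ler_wpM2l// coef_norm_ge0.
  by move: le2; rewrite mulrDl gerDl pmulr_rle0.
have muT : mu T = 0%E.
  have := linf_norm1_indic (Z := Z) mT; rewrite -/t => <-.
  by congr _%:E; apply/eqP; rewrite eq_le t0 linf_norm1_ge0.
exists T; split=> // x /= nTx; apply: contrapT => nT; apply: nTx => -[Sx xc].
exact: nT.
Qed.

End OperatorNorm.

Section OperatorNormTheory.
Context {R : realType} {G : groupType} {alpha : standard_action R G}
  {Z : coefficients}.
Local Notation mu := (sa_mu alpha).
Local Notation L := (Linfty alpha Z).
Local Notation LG := (crossed_ring alpha Z).
Variables (M N : lmodType LG) (mM : marking M) (mN : marking N).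
Variable f : {linear M -> N}.
Local Notation I := (mk_index mM).
Local Notation J := (mk_index mN).
Local Notation coef := (@matrix_coef _ _ _ _ M N mM mN f).

Lemma matrix_coef_mull i j : crossed_indic (mk_set i) * coef i j = coef i j.
Proof.
rewrite [RHS](@marked_linear_coord _ _ _ _ M mM N mN f).
rewrite (bigD1 i)//= mk_iso_basis eqxx big1 ?addr0// => k ki.
by rewrite mk_iso_basis (negPf ki) mul0r.
Qed.

Lemma measure_sum_ge0 (K : finType) (S : K -> set alpha) : 0 <= measure_sum S.
Proof. by apply: sumr_ge0 => k _; rewrite fine_ge0. Qed.

Lemma linf_abs_bounded (l : L) : exists c : R, 0 <= c /\
  {ae mu, forall x, linf_abs l x <= c}.
Proof.
have [c lc] := (ebfunP (linf_repr l)).2; exists (Num.max c 0); split.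
  by rewrite le_max lexx orbT.
by apply: filterS lc => x xc; rewrite le_max xc.
Qed.

Lemma bounded_by_exists (S : I -> set alpha) : (forall i, measurable (S i)) ->
  exists c, bounded_by mN f c S.
Proof.
move=> mS; have [s ss] := supports_exists mM mN f.
have bnd (i : I) : exists c : R, 0 <= c /\ {ae mu, forall x, row_abs mN f s i x <= c}.
  rewrite /row_abs; elim: [seq _ | _ <- _, _ <- _] => [|d u [c [c0 IH]]].
    by exists 0; split=> //; apply: aeW => x; rewrite big_nil.
  have [c' [c'0 lc']] := linf_abs_bounded (ccoef (coef i d.1) d.2).
  exists (c' + c); split; first exact: addr_ge0.
  by apply: filterS2 IH lc' => x xc xc'; rewrite big_cons lerD.
have [c cP] := choice bnd.
exists (\sum_i c i); apply: (row_abs_le_bounded _ ss) => //.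
  by apply: sumr_ge0 => i _; exact: (cP i).1.
move=> i; apply: filterS (cP i).2 => x xc _; apply: le_trans xc _.
by rewrite (bigD1 i)//= lerDl sumr_ge0// => k _; exact: (cP k).1.
Qed.

Lemma opnorm_ge0 (S : I -> set alpha) : 0 <= opnorm mN f S.
Proof.
rewrite /opnorm; set A := [set _ | _].
have [A0|/set0P[c Ac]] := eqVneq A set0; first by rewrite A0 inf0.
by apply: lb_le_inf; [exists c|move=> d []].
Qed.

Lemma log_plus_ge0 (t : R) : 0 <= log_plus t.
Proof. by rewrite /log_plus le_max lexx orbT. Qed.

Lemma log_plus_le (s t : R) : 0 <= s -> s <= t -> log_plus s <= log_plus t.
Proof.
rewrite le_eqVlt => /predU1P[<- _|s0 st].
  by rewrite /log_plus ln0// maxxx log_plus_ge0.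
rewrite /log_plus ge_max; apply/andP; split; last by rewrite le_max lexx orbT.
by rewrite le_max ler_ln ?posrE ?st// (lt_le_trans s0).
Qed.

Lemma marked_rank_ge0 (S : I -> set alpha) : 0 <= marked_rank mN f S.
Proof.
rewrite /marked_rank; set A := [set _ | _ in _].
have [A0|/set0P[c Ac]] := eqVneq A set0; first by rewrite A0 inf0.
by apply: lb_le_inf; [exists c|move=> _ [T _ <-]; exact: measure_sum_ge0].
Qed.

Lemma marked_rank_le (S : I -> set alpha) (T : J -> set alpha) :
  is_summand T -> f @` marked_sub S `<=` marked_sub T ->
  marked_rank mN f S <= measure_sum T.
Proof.
move=> sT fST; apply: ge_inf; last by exists T.
by exists 0 => _ [T' _ <-]; exact: measure_sum_ge0.
Qed.

Lemma lognorm'_ge0 (S : I -> set alpha) : 0 <= lognorm' mN f S.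
Proof.
by rewrite /lognorm' le_min !mulr_ge0 ?measure_sum_ge0 ?marked_rank_ge0 ?log_plus_ge0.
Qed.

Lemma marked_sub_full (x : N) : marked_sub (@mk_set _ _ _ _ _ mN) x.
Proof. by rewrite /marked_sub -mk_iso_range; exists x. Qed.

(* [None] stands for the first term of the minimum in [lognorm'], and [Some T]
   for a summand [T] that nearly attains the rank in the second one. *)
Definition lognorm_witness (S : I -> set alpha) (o : option (J -> set alpha)) :=
  if o is Some T then is_summand T /\ f @` marked_sub S `<=` marked_sub T else True.

Definition lognorm_sets (S : I -> set alpha) (o : option (J -> set alpha)) :
    seq (set alpha) :=
  if o is Some T then [seq T j | j <- index_enum J] else [seq S i | i <- index_enum I].

Lemma lognorm'_witness (S : I -> set alpha) (d : R) : 0 < d ->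
  exists o, lognorm_witness S o /\
    (\sum_(A <- lognorm_sets S o) fine (mu A)) * log_plus (opnorm mN f S) <=
    lognorm' mN f S + d.
Proof.
move=> d0; rewrite /lognorm'; set c := log_plus _.
have c0 : 0 <= c by exact: log_plus_ge0.
have [le|lt] := leP (measure_sum S * c) (marked_rank mN f S * c).
  by exists None; split=> //=; rewrite big_map lerDl ltW.
(* The denominator [c + 1] gives [e * c <= d] also when [c = 0]. *)
pose e := d / (c + 1); have c1 : 0 < c + 1 by rewrite ltr_wpDl.
have e0 : 0 < e by rewrite divr_gt0.
pose A := [set measure_sum T | T in [set T : J -> set alpha |
            is_summand T /\ f @` marked_sub S `<=` marked_sub T]].
have [|_ [T [sT fT] <-] Tlt] := @inf_adherent _ A e e0.
  split; last by exists 0 => _ [T _ <-]; exact: measure_sum_ge0.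
  exists (measure_sum (@mk_set _ _ _ _ _ mN)), (@mk_set _ _ _ _ _ mN) => //; split.
    by move=> j; split=> //; exact: mk_measurable.
  by move=> y _; exact: marked_sub_full.
exists (Some T); split=> //=; rewrite big_map.
apply: (@le_trans _ _ ((marked_rank mN f S + e) * c)).
  by rewrite ler_wpM2r// ltW.
rewrite mulrDl lerD2l /e mulrAC ler_pdivrMr// ler_wpM2l ?ltW//.
by rewrite ltrDl.
Qed.

Lemma lognorm_le (K : finType) (S : K -> I -> set alpha) :
  is_marked_decomposition S -> lognorm mM mN f <= \sum_k lognorm' mN f (S k).
Proof.
move=> dS; apply: ge_inf; last by exists K, S.
by exists 0 => _ [K' [S' [_ ->]]]; apply: sumr_ge0 => k _; exact: lognorm'_ge0.
Qed.

Lemma lognorm_ge0 : 0 <= lognorm mM mN f.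
Proof.
rewrite /lognorm; set A := [set _ | _].
have [A0|/set0P[c Ac]] := eqVneq A set0; first by rewrite A0 inf0.
apply: lb_le_inf; first by exists c.
by move=> _ [K' [S' [_ ->]]]; apply: sumr_ge0 => k _; exact: lognorm'_ge0.
Qed.

Lemma lognorm_adherent (e : R) : 0 < e -> exists (K : finType)
    (S : K -> I -> set alpha), is_marked_decomposition S /\
    \sum_k lognorm' mN f (S k) < lognorm mM mN f + e.
Proof.
move=> e0; pose A := [set x | exists (K : finType) (S : K -> I -> set alpha),
                 is_marked_decomposition S /\ x = \sum_k lognorm' mN f (S k)].
have [|_ [K [S [dS ->]]] lt] := @inf_adherent _ A e e0; last by exists K, S.
split; last first.
  by exists 0 => _ [K' [S' [_ ->]]]; apply: sumr_ge0 => k _; exact: lognorm'_ge0.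
exists (\sum_(k : unit) lognorm' mN f (@mk_set _ _ _ _ _ mM)).
exists unit, (fun=> @mk_set _ _ _ _ _ mM); split=> // i; split.
- by move=> _; exact: mk_measurable.
- by move=> [] [].
- by apply: bigcup_const; exists tt.
Qed.

End OperatorNormTheory.

Section FactorTransfer.
Context {R : realType} {G : groupType} {alpha beta : standard_action R G}.
Variable p : factor_algebra alpha beta.
Local Notation mu := (sa_mu alpha).
Local Notation nu := (sa_mu beta).

Lemma fa_setD A B : fa_sets p A -> fa_sets p B -> fa_sets p (A `\` B).
Proof. by move=> UA UB; rewrite setDE; apply: fa_setI => //; exact: fa_setC. Qed.

Lemma fa_bigcup (K : finType) (D : set K) (F : K -> set beta) :
  (forall k, fa_sets p (F k)) -> fa_sets p (\bigcup_(k in D) F k).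
Proof.
move=> UF.
have -> : \bigcup_(k in D) F k =
    \big[setU/set0]_(k <- enum K) (if `[< D k >] then F k else set0).
  rewrite -bigcup_seq; apply/seteqP; split=> y.
    by move=> [k Dk Fy]; exists k; [rewrite /= mem_enum|case: asboolP].
  by move=> [k _]; case: asboolP => // Dk Fy; exists k.
by apply: fa_bigsetU => k _; case: asboolP => // _; exact: fa_set0.
Qed.

Lemma fa_null_preimage A : fa_sets p A -> p @^-1` A = set0 -> nu A = 0%E.
Proof. by move=> UA pA; apply: (fa_null UA); rewrite pA measure0. Qed.

(** The difference of the two sets has empty preimage, hence is null. This makes different choices
    of sets over the same preimage interchangeable in measure. *)
Lemma fa_measure_eq A B : fa_sets p A -> fa_sets p B ->
  p @^-1` A = p @^-1` B -> nu A = nu B.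
Proof.
move=> UA UB AB.
have D0 C D : fa_sets p C -> fa_sets p D -> p @^-1` C = p @^-1` D ->
    (nu C <= nu D)%E.
  move=> UC UD CD.
  have n0 : nu (C `\` D) = 0%E.
    apply: fa_null_preimage; first exact: fa_setD.
    by rewrite setDE preimage_setI -preimage_setC CD setICr.
  have mC := fa_measurable UC; have mD := fa_measurable UD.
  rewrite -{1}(setUIDK C D) measureU.
  - set a := (X in (_ + X)%E); have -> : a = 0%E by exact: n0.
    by rewrite adde0; apply: le_measure; rewrite ?inE//; exact: measurableI.
  - exact: measurableI.
  - exact: measurableD.
  - by apply/seteqP; split=> // x [[_ Dx] [_ ]].
by apply/eqP; rewrite eq_le !D0.
Qed.

Lemma linf_abs_rel (Z : coefficients) (l : Linfty alpha Z) (l' : Linfty beta Z) :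
  linf_rel p l l' -> exists v : beta -> R,
    [/\ fa_simple p v, {ae mu, forall x, linf_abs l x = v (p x)} &
        {ae nu, forall y, linf_abs l' y = v y}].
Proof.
move=> [u [su lu l'u]]; exists (fun y => coef_norm R (u y)); split.
- exact: fa_simple_comp.
- by apply: filterS lu => x xu; rewrite /linf_abs xu.
- by apply: filterS l'u => x xu; rewrite /linf_abs xu.
Qed.

End FactorTransfer.

(** * Operator norms and images under base change *)

Section BaseChangeNorms.
Context {R : realType} {G : groupType} {alpha beta : standard_action R G}
  {Z : coefficients}.
Variables (p : factor_algebra alpha beta) (D : marked_complex alpha Z) (w : D 0%N).
Hypotheses (wD : complex_sets w `<=` transferable p) (w1 : cx_aug D w = 1).
Local Notation mu := (sa_mu alpha).
Local Notation nu := (sa_mu beta).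
Local Notation D' := (base_change wD w1).
Variable n : nat.
Local Notation mM := (mc_marking D n.+1).
Local Notation mN := (mc_marking D n).
Local Notation mM' := (mc_marking D' n.+1).
Local Notation mN' := (mc_marking D' n).
Local Notation I := (mk_index mM).
Local Notation J := (mk_index mN).
Local Notation d := (cx_d D n).
Local Notation d' := (cx_d D' n).
Local Notation Ra := (crossed_ring alpha Z).
Local Notation Rb := (crossed_ring beta Z).

Lemma bc_matrix_coef (i : I) (j : J) :
  @matrix_coef _ _ _ _ _ _ mM' mN' d' i j = bc_coef p i j.
Proof.
rewrite /matrix_coef.
transitivity (\sum_k (mk_iso mM' (@marked_basis _ _ _ _ _ mM' i) k : Rb) * bc_coef p k j).
  exact: (bc_dE wD (@marked_basis _ _ _ _ _ mM' i) j).
rewrite (bigD1 i)//= big1 ?addr0.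
  rewrite (mk_iso_basis (mM := mM')) eqxx.
  have rel := crossed_relM (bc_set_rel wD i) (bc_coef_rel wD i j).
  rewrite (matrix_coef_mull d i j) in rel.
  exact: crossed_rel_functional rel (bc_coef_rel wD i j).
by move=> k ki; rewrite (mk_iso_basis (mM := mM')) (negPf ki) mul0r.
Qed.

Definition set_rel (A : set alpha) (A' : set beta) := fa_sets p A' /\ p @^-1` A' = A.

(** By the two row sum criteria the bound is an almost everywhere inequality for a function pulled
    back from a simple one, so [fa_ae] transfers it. *)
Lemma bc_bounded_by c (S : I -> set alpha) (S' : I -> set beta) :
  (forall i, S i `<=` mk_set i) -> (forall i, set_rel (S i) (S' i)) ->
  bounded_by mN d c S -> @bounded_by _ _ _ _ _ _ mM' mN' d' c S'.
Proof.
move=> SM SS' bS.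
have [s1 [us1 s1P]] := supports_exists mM mN d.
have [s2 [us2 s2P]] := supports_exists mM' mN' d'.
(* With a common support list the row sums over [alpha] and [beta] can be matched term by term. *)
pose s := undup (s1 ++ s2).
have ss : supports mM mN d s.
  split; first exact: undup_uniq.
  by move=> i j g /s1P gs; rewrite mem_undup mem_cat gs.
have ss' : supports mM' mN' d' s.
  split; first exact: undup_uniq.
  by move=> i j g /s2P gs; rewrite mem_undup mem_cat gs orbT.
have mS i : measurable (S i) by have [/fa_preimage H <-] := SS' i.
have mS' i : measurable (S' i) by have [/fa_measurable] := SS' i.
apply: (row_abs_le_bounded bS.1 ss' mS') => i.
have rS := bounded_row_abs_le ss (fun i => conj (mS i) (SM i)) bS i.
have [v [sv rv rv']] : exists v : beta -> R,
    [/\ fa_simple p v, {ae mu, forall x, row_abs mN d s i x = v (p x)} &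
        {ae nu, forall y, @row_abs _ _ _ _ _ _ mM' mN' d' s i y = v y}].
  rewrite /row_abs; change (index_enum (mk_index mN')) with (index_enum J).
  elim: [seq _ | _ <- _, _ <- _] => [|c0 u [v [sv rv rv']]].
    exists (fun=> 0); split; first exact: fa_simple_cst.
      by apply: aeW => x; rewrite big_nil.
    by apply: aeW => x; rewrite big_nil.
  have [v0 [sv0 rv0 rv0']] := linf_abs_rel (bc_coef_rel wD i c0.1 c0.2).
  exists (fun y => v0 y + v y); split.
  - exact: fa_simple_op.
  - by apply: filterS2 rv0 rv => x x0 xv; rewrite big_cons x0 xv.
  - by apply: filterS2 rv0' rv' => x x0 xv; rewrite big_cons bc_matrix_coef x0 xv.
have H : {ae nu, forall y, S' i y -> v y <= c}.
  apply: (@fa_ae _ _ _ _ p [set y | S' i y -> v y <= c]).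
    have -> : [set y | S' i y -> v y <= c] = ~` S' i `|` v @^-1` [set r | r <= c].
      apply/seteqP; split=> y /=; last by case.
      by have [Sy H|nS _] := pselect (S' i y); [right; exact: H|left].
    apply: fa_setU; first by apply: fa_setC; exact: (SS' i).1.
    exact: fa_simple_preimage.
  apply: filterS2 rS rv => x xc xv /= Sx; rewrite -xv; apply: xc.
  by rewrite -(SS' i).2.
by apply: filterS2 H rv' => y yc yv Sy; rewrite yv; exact: yc.
Qed.

Lemma bc_opnorm_le (S : I -> set alpha) (S' : I -> set beta) :
  (forall i, S i `<=` mk_set i) -> (forall i, set_rel (S i) (S' i)) ->
  @opnorm _ _ _ _ _ _ mM' mN' d' S' <= opnorm mN d S.
Proof.
move=> SM SS'.
have mS i : measurable (S i) by have [/fa_preimage H <-] := SS' i.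
apply: lb_le_inf; first by have [c bc] := bounded_by_exists mN d mS; exists c.
move=> c bc; apply: ge_inf; first by exists 0 => e [].
exact: bc_bounded_by SM SS' bc.
Qed.

(** The inclusion amounts to the finitely many equations [coefT] between matrix entries cut down by
    indicators, and these transfer. *)
Lemma bc_image_sub (S : I -> set alpha) (S' : I -> set beta)
    (T : J -> set alpha) (T' : J -> set beta) :
  (forall i, S i `<=` mk_set i) ->
  (forall i, set_rel (S i) (S' i)) -> (forall j, set_rel (T j) (T' j)) ->
  d @` (@marked_sub _ _ _ _ _ mM S) `<=` @marked_sub _ _ _ _ _ mN T ->
  d' @` (@marked_sub _ _ _ _ _ mM' S') `<=` @marked_sub _ _ _ _ _ mN' T'.
Proof.
move=> SM SS' TT' dST.
have mS i : measurable (S i) by have [/fa_preimage H <-] := SS' i.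
have mS' i : measurable (S' i) by have [/fa_measurable] := SS' i.
have mT j : measurable (T j) by have [/fa_preimage H <-] := TT' j.
have mT' j : measurable (T' j) by have [/fa_measurable] := TT' j.
have indic_rel A A' : set_rel A A' -> crossed_rel p (crossed_indic A : Ra) (crossed_indic A').
  by move=> [UA <-]; exact: crossed_rel_indic.
have coefT i j : crossed_indic (S i) * matrix_coef d i j * crossed_indic (T j) =
    crossed_indic (S i) * matrix_coef d i j :> Ra.
  pose z : D n.+1 := (crossed_indic (S i) : Ra) *: @marked_basis _ _ _ _ _ mM i.
  have Sz : @marked_sub _ _ _ _ _ mM S z.
    move=> k; apply/principalP => //; rewrite /z linearZ ffunE mk_iso_basis.
    case: eqP => [->|_].
      change (crossed_indic (S i) * crossed_indic (mk_set i) * crossed_indic (S i) =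
        (crossed_indic (S i) * crossed_indic (mk_set i) : Ra)).
      rewrite !crossed_indicM ?(setIidl (SM i)) ?setIid//; exact: mk_measurable.
    change (crossed_indic (S i) * 0 * crossed_indic (S k) = (crossed_indic (S i) * 0 : Ra)).
    by rewrite mulr0 mul0r.
  have /(_ j) := dST _ (ex_intro2 _ _ z Sz erefl).
  by move=> /principalP - /(_ (mT j)); rewrite /z !linearZ ffunE.
have coefT' i j : crossed_indic (S' i) * bc_coef p i j * crossed_indic (T' j) =
    crossed_indic (S' i) * bc_coef p i j :> Rb.
  have rel1 := crossed_relM (indic_rel _ _ (SS' i)) (bc_coef_rel wD i j).
  have rel := crossed_relM rel1 (indic_rel _ _ (TT' j)).
  rewrite (coefT i j) in rel.
  exact: crossed_rel_functional rel rel1.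
move=> _ [z Sz <-] j; apply/principalP => //.
have -> : mk_iso mN' (d' z) j = \sum_i (mk_iso mM' z i : Rb) * bc_coef p i j.
  exact: (bc_dE wD z j).
rewrite mulr_suml; apply: eq_bigr => i _.
have /principalP - /(_ (mS' i)) <- := Sz i.
by rewrite -!mulrA [X in _ * X = _]mulrA coefT'.
Qed.

End BaseChangeNorms.

(** * Ergodic actions with almost optimal embeddings *)

Section EmbeddingData.
Context {R : realType} {G : groupType} {Z : coefficients}.
Variables (n : nat) (C : aug_complex (trivial_module Z G)).
Hypothesis fC : is_free_resolution C.
Variable alpha : standard_action R G.

Lemma finite_bigcup_countable (I : finType) (T : Type) (F : I -> set T) :
  (forall i, countable (F i)) -> countable (\bigcup_i F i).
Proof. by move=> cF; apply: bigcup_countable => //; exact: countableP. Qed.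

Lemma complex_sets_countable (D : marked_complex alpha Z) (w : D 0%N) :
  countable (complex_sets w).
Proof.
apply: countable_setU; last apply: countable_setU.
- apply: bigcup_countable => [|k _]; first exact: countableP.
  apply: countable_setU; first exact/countable_image/countableP.
  apply: finite_bigcup_countable => i; apply: finite_bigcup_countable => j.
  exact: crossed_level_sets_countable.
- by apply: finite_bigcup_countable => i; exact: level_sets_countable.
- by apply: finite_bigcup_countable => i; exact: crossed_level_sets_countable.
Qed.

Lemma complex_sets_measurable (D : marked_complex alpha Z) (w : D 0%N) A :
  complex_sets w A -> measurable A.
Proof.
case=> [[k _ [[i _ <-]|[i _ [j _]]]]|[[i _]|[i _]]].
- exact: mk_measurable.
- exact: crossed_level_sets_measurable.
- exact: level_sets_measurable.
- exact: crossed_level_sets_measurable.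
Qed.

(** The order of quantifiers matters: [E] is determined before [beta], which is then built from
    it. *)
Lemma embedding_data (D : marked_complex alpha Z) : embedding_class n C D ->
  exists (w : D 0%N) (w1 : cx_aug D w = 1) (E : set (set alpha)),
  [/\ countable E, forall A, E A -> measurable A &
      forall (beta : standard_action R G) (p : factor_algebra alpha beta),
      E `<=` transferable p -> exists wD : complex_sets w `<=` transferable p,
      embedding_class n C (base_change wD w1)].
Proof.
move=> [f [f_lin f_d f_aug]].
have cG := sa_countable alpha.
have cZG : countable [set: group_ring Z G].
  by apply: crossed_countable => //; exact: coef_countable.
have cZ : countable [set: trivial_module Z G] by exact: (@coef_countable Z).
have [g [g_d g_aug cg]] := countable_self_map cZG cZ fC.
have [w w1] := cx_aug_surj D 1.
exists w, w1, (complex_sets w `|` embedding_sets f g); split.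
- apply: countable_setU; first exact: complex_sets_countable.
  apply: bigcup_countable => [|k _]; first exact: countableP.
  apply: bigcup_countable => [|y _]; first exact: cg.
  by apply: finite_bigcup_countable => i; exact: crossed_level_sets_countable.
- move=> A [|[k _ [y _ [i _]]]]; first exact: complex_sets_measurable.
  exact: crossed_level_sets_measurable.
- move=> beta p tE.
  have wD : complex_sets w `<=` transferable p by move=> A wA; apply: tE; left.
  exists wD; apply: (base_change_embedding wD w1 f_lin f_d f_aug g_d g_aug).
  by move=> A fA; apply: tE; right.
Qed.

End EmbeddingData.

Lemma ergodic_action_exists (R : realType) (G : groupType)
    (alpha : standard_action R G) :
  exists beta : standard_action R G, ergodic beta.
Proof.
have [|||beta [p [F [eb _ _]]]] := @ergodic_factor R G alpha set0 [::].
- exact/finite_set_countable/finite_set0.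
- by [].
- by [].
by exists beta.
Qed.

(** If [S] is empty, its infimum is infinite and any good [t] serves. Otherwise the infimum is
    finite, and [eps] is shared equally between near-optimality of [x] and the loss [d]. *)
Lemma ereal_inf_transfer (R : realType) (T : Type) (S : set \bar R)
    (S' : T -> set \bar R) (good : T -> Prop) (eps : R) :
  0 < eps -> (forall x, S x -> (0 <= x < +oo)%E) -> (exists t, good t) ->
  (forall x (d : R), 0 < d -> S x ->
     exists t, good t /\ exists2 y, S' t y & (y <= x + d%:E)%E) ->
  exists t, good t /\ (ereal_inf (S' t) <= ereal_inf S + eps%:E)%E.
Proof.
move=> e0 S0 [t0 gt0] H.
have [->|/set0P[x0 Sx0]] := eqVneq S set0.
  by exists t0; split=> //; rewrite ereal_inf0 addye// leey.
have Sge : (0 <= ereal_inf S)%E by apply: le_ereal_inf_tmp => x /S0/andP[].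
have Slt : (ereal_inf S < +oo)%E.
  by apply: le_lt_trans (ereal_inf_lbound Sx0) _; have /andP[] := S0 _ Sx0.
have Sfin : ereal_inf S \is a fin_num by rewrite ge0_fin_numE.
have e2 : 0 < eps / 2 by rewrite divr_gt0.
have [x Sx xlt] : exists2 x, S x & (x < ereal_inf S + (eps / 2)%:E)%E.
  by apply: ereal_inf_lt; rewrite lteDl// lte_fin.
have [t [gt [y Sy yx]]] := H x _ e2 Sx.
exists t; split=> //; apply: (le_trans (ereal_inf_lbound Sy)).
apply: (le_trans yx).
rewrite [eps in leRHS]splitr EFinD addeA.
by apply: leeD => //; exact: ltW.
Qed.

Lemma medim_ergodic (R : realType) (n : nat) (G : groupType)
    (alpha : standard_action R G) (eps : R) (Z : coefficients)
    (C : aug_complex (trivial_module Z G)) :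
  0 < eps -> is_free_resolution C ->
  exists beta : standard_action R G,
    ergodic beta /\ (medim n C beta <= medim n C alpha + eps%:E)%E.
Proof.
move=> e0 fC; apply: ereal_inf_transfer => //.
- by move=> x [D [_ ->]]; rewrite lee_fin measure_sum_ge0 ltry.
- exact: ergodic_action_exists alpha.
move=> x d d0 [D [eD ->]].
have [w [w1 [E [cE mE EP]]]] := embedding_data fC eD.
pose mk := mc_marking D n.
pose wt := [seq (1 : R, mk_set i) | i <- index_enum (mk_index mk)].
(* [embedding_data] does not reveal that [E] contains these sets; they are added because some of
   them carry the weights. *)
pose E' := E `|` complex_sets w.
have [||c|beta [p [F [eb FP wF]]]] := @ergodic_factor R G alpha E' wt.
- by apply: countable_setU => //; exact: complex_sets_countable.
- by move=> A [/mE//|]; exact: complex_sets_measurable.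
- move=> /mapP[i _ ->] /=.
  by right; left; exists n => //; left; exists i.
have [wD eD'] : exists wD : complex_sets w `<=` transferable p,
    embedding_class n C (base_change wD w1).
  by apply: EP => A EA; have [UA pA] := FP A (or_introl EA); exists (F A).
exists beta; split=> //.
exists (marked_dim (mc_marking (base_change wD w1) n))%:E.
  by exists (base_change wD w1).
rewrite -EFinD lee_fin.
have d1 : \sum_(c <- wt) c.1 * fine (sa_mu alpha c.2) = marked_dim mk.
  by rewrite big_map; apply: eq_bigr => i _; rewrite mul1r.
have d2 : \sum_(c <- wt) c.1 * fine (sa_mu beta (F c.2)) =
    marked_dim (mc_marking (base_change wD w1) n).
  rewrite big_map; apply: eq_bigr => i _; rewrite mul1r; congr fine.
  have [Ui pi] := bc_setP wD i.
  have [|UF pF] := FP (mk_set i).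
    by right; left; exists n => //; left; exists i.
  by apply: (fa_measure_eq (p := p)) => //; rewrite pi pF.
by rewrite -d2 (le_trans wF)// d1 lerDl ltW.
Qed.

(** A nearly optimal decomposition [S], the term of the minimum used on each piece and the numbers
    [c k] are fixed over [alpha]. What remains is a nonnegative combination of measures of sets,
    which [ergodic_factor] keeps from growing, and which still bounds the logarithmic norm over
    [beta]. *)
Lemma mevol_ergodic (R : realType) (n : nat) (G : groupType)
    (alpha : standard_action R G) (eps : R)
    (C : aug_complex (trivial_module IntCoef G)) :
  0 < eps -> is_free_resolution C ->
  exists beta : standard_action R G,
    ergodic beta /\ (mevol n C beta <= mevol n C alpha + eps%:E)%E.
Proof.
move=> e0 fC; apply: ereal_inf_transfer => //.
- by move=> x [D [_ ->]]; rewrite lee_fin lognorm_ge0 ltry.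
- exact: ergodic_action_exists alpha.
move=> _ d d0 [D [eD ->]].
have [w [w1 [E [cE mE EP]]]] := embedding_data fC eD.
set mM := mc_marking D n.+1; set mN := mc_marking D n.
set f := cx_d D n.
pose I := mk_index mM; pose J := mk_index mN.
have d2 : 0 < d / 2 by rewrite divr_gt0.
have [K [S [dS Sd]]] := lognorm_adherent mM mN f d2.
have SM k i : S k i `<=` mk_set i.
  by have [_ _ <-] := dS i; exact: bigcup_sup.
have mS k i : measurable (S k i) by have [] := dS i.
(* The errors of all pieces add up to at most [d / 2]; the successor avoids a division by zero for
   empty [K]. *)
pose e := d / 2 / (#|K|.+1)%:R.
have e1 : 0 < e by rewrite divr_gt0.
have witness k : exists o : option (J -> set alpha), lognorm_witness f (S k) o /\
    (\sum_(A <- lognorm_sets (S k) o) fine (sa_mu alpha A)) *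
      log_plus (opnorm mN f (S k)) <= lognorm' mN f (S k) + e.
  exact: (lognorm'_witness mN f).
have [sel selP] := choice witness.
pose c k := log_plus (opnorm mN f (S k)).
have c0 k : 0 <= c k by exact: log_plus_ge0.
pose ls k := lognorm_sets (S k) (sel k).
have mls k A : A \in ls k -> measurable A.
  rewrite /ls; have := (selP k).1; case: (sel k) => [T|] /=.
    by move=> [sT _] /mapP[j _ ->]; exact: (sT j).1.
  by move=> _ /mapP[i _ ->].
pose wt := [seq (c k, A) | k <- index_enum K, A <- ls k].
have wtE d' (T : measurableType d') (P : set T -> \bar R) (F : set alpha -> set T) :
    \sum_(b <- wt) b.1 * fine (P (F b.2)) =
    \sum_k (\sum_(A <- ls k) fine (P (F A))) * c k.
  rewrite big_allpairs_dep; apply: eq_bigr => k _; rewrite mulr_suml.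
  by apply: eq_bigr => A _; rewrite mulrC.
pose E' := E `|` complex_sets w `|` (\bigcup_k range (S k)) `|`
  \bigcup_k [set` ls k].
have [|||beta [p [F [eb FP wF]]]] := @ergodic_factor R G alpha E' wt.
- apply: countable_setU; first apply: countable_setU; first apply: countable_setU => //.
  + exact: complex_sets_countable.
  + by apply: finite_bigcup_countable => k; exact/countable_image/countableP.
  + by apply: finite_bigcup_countable => k; exact/finite_set_countable/finite_seq.
- move=> A [[[/mE//|]|[k _ [i _ <-]]]|[k _ /mls]]//.
  exact: complex_sets_measurable.
- move=> b /allpairsPdep[k [A [_ Ak ->]]] /=.
  by right; exists k.
have [wD eD'] : exists wD : complex_sets w `<=` transferable p,
    embedding_class n C (base_change wD w1).
  apply: EP => A EA; have [|UA pA] := FP A; last by exists (F A).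
  by left; left; left.
have FS k i : set_rel p (S k i) (F (S k i)).
  by apply: FP; left; right; exists k => //; exists i.
have Fls k A : A \in ls k -> set_rel p A (F A).
  by move=> Ak; apply: FP; right; exists k.
pose hat (i : I) := bc_set p i.
have hatP (i : I) : set_rel p (mk_set i) (hat i) by exact: (bc_setP wD i).
have preD (A B : set beta) : p @^-1` (A `\` B) = p @^-1` A `\` p @^-1` B by [].
(* Over [beta] the sets [F (S k i)] need be neither disjoint nor contained in [hat i]. The
   correction enforces both without changing the preimages. *)
pose P k i := F (S k i) `&` hat i `\` \bigcup_(k' in [set k' | k' != k]) F (S k' i).
have PP k i : set_rel p (S k i) (P k i).
  split.
    apply: fa_setD; first by apply: fa_setI; [exact: (FS k i).1|exact: (hatP i).1].
    by apply: fa_bigcup => k'; exact: (FS k' i).1.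
  rewrite /P preD preimage_setI (FS k i).2 (hatP i).2 preimage_bigcup.
  rewrite (setIidl (SM k i)); apply/seteqP; split=> x; first by case.
  move=> Sx; split=> // -[k' /= k'k Fx].
  have Sx' : S k' i x by rewrite -(FS k' i).2.
  have [_ tS _] := dS i.
  have k'E : k' = k by apply: (tS k' k) => //; exists x.
  by rewrite k'E eqxx in k'k.
(* [p] need not be surjective, so the [P k i] exhaust [hat i] only up to a null
   set, which is collected in the additional piece [inl tt]. *)
pose S' (q : unit + K) i := if q is inr k then P k i else hat i `\` \bigcup_k P k i.
have rest0 i : sa_mu beta (S' (inl tt) i) = 0%E.
  apply: (@fa_null_preimage _ _ _ _ p).
    apply: fa_setD; first exact: (hatP i).1.
    by apply: fa_bigcup => k; exact: (PP k i).1.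
  rewrite /= preD (hatP i).2 preimage_bigcup.
  have [_ _ <-] := dS i.
  rewrite (_ : \bigcup_k (p @^-1` P k i) = \bigcup_k S k i) ?setDv//.
  by apply: eq_bigcupr => k _; exact: (PP k i).2.
pose D' := base_change wD w1.
have dS' : @is_marked_decomposition _ _ _ _ _ (mc_marking D' n.+1) _ S'.
  move=> i; split.
  - have mP k : measurable (P k i) by exact: (fa_measurable (PP k i).1).
    have mU : measurable (\bigcup_k P k i).
      by apply: (fa_measurable (f := p)); apply: fa_bigcup => k; exact: (PP k i).1.
    case=> [[]|k] /=; last exact: mP.
    by apply: measurableD => //; exact: (fa_measurable (hatP i).1).
  - move=> [[]|k] [[]|k'] _ _ //= [x].
    + by move=> [[_ nP] Px]; case: nP; exists k'.
    + by move=> [Px [_ nP]]; case: nP; exists k.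
    + move=> [[[Fx _] _] [_ nF]]; congr inr.
      apply/eqP; apply: contrapT => /negP kk'; apply: nF.
      by exists k.
  - apply/seteqP; split=> x.
      by move=> [[[]|k] _ /=]; [case|move=> [[_ hx] _]].
    move=> hx; have [[k _ Px]|nP] := pselect ((\bigcup_k P k i) x).
      by exists (inr k).
    by exists (inl tt).
exists beta; split=> //.
exists (lognorm (mc_marking D' n.+1) (mc_marking D' n) (cx_d D' n))%:E.
  by exists D'.
rewrite -EFinD lee_fin.
apply: (le_trans (@lognorm_le _ _ _ _ _ _ (mc_marking D' n.+1) (mc_marking D' n)
  (cx_d D' n) _ S' dS')).
rewrite big_sumType /=.
pose ln := @lognorm' _ _ _ _ _ _ (mc_marking D' n.+1) (mc_marking D' n) (cx_d D' n).
pose on := @opnorm _ _ _ _ _ _ (mc_marking D' n.+1) (mc_marking D' n) (cx_d D' n).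
(* The null piece has dimension [0], so the first term of its minimum vanishes whatever its operator
   norm is. *)
have -> : \sum_(q : unit) ln (S' (inl q)) = 0.
  apply: big1 => -[] _; apply/eqP; rewrite eq_le lognorm'_ge0 andbT.
  rewrite /ln /lognorm' ge_min; apply/orP; left.
  rewrite (_ : measure_sum _ = 0) ?mul0r//.
  by apply: big1 => i _; exact: (congr1 fine (rest0 i)).
rewrite add0r.
apply: (@le_trans _ _ (\sum_k (\sum_(A <- ls k) fine (sa_mu beta (F A))) * c k)).
  apply: ler_sum => k _.
  pose lb := log_plus (on (P k)).
  have lbc : lb <= c k.
    apply: log_plus_le; first exact: opnorm_ge0.
    exact: (bc_opnorm_le wD w1 (SM k) (PP k)).
  rewrite /ls; have := (selP k).1; have := @Fls k; rewrite /ls.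
  case: (sel k) => [T|] /= FT; last first.
    move=> _; rewrite big_map /lognorm' ge_min; apply/orP; left.
    rewrite (_ : \sum_i _ = measure_sum (P k)).
      by rewrite ler_wpM2l// measure_sum_ge0.
    apply: eq_bigr => i _; congr fine.
    apply: (fa_measure_eq (p := p)); [exact: (FS k i).1|exact: (PP k i).1|].
    by rewrite (FS k i).2 (PP k i).2.
  move=> [sT fT].
  have FT' j : set_rel p (T j) (F (T j)) by apply: FT; exact: map_f.
  (* [F (T j)] may leave [bc_set p j], which a summand must not; the intersection has the same
     preimage. *)
  pose T' (j : J) := F (T j) `&` bc_set p j.
  have T'P j : set_rel p (T j) (T' j).
    have [Uj pj] := bc_setP wD j.
    split; first by apply: fa_setI => //; exact: (FT' j).1.
    by rewrite preimage_setI (FT' j).2 pj (setIidl (sT j).2).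
  rewrite big_map /lognorm' ge_min; apply/orP; right.
  apply: (@le_trans _ _ (measure_sum T' * lb)).
    rewrite ler_wpM2r ?log_plus_ge0//; apply: marked_rank_le.
      by move=> j; split; [exact: (fa_measurable (T'P j).1)|move=> x []].
    exact: (bc_image_sub (wD := wD) (w1 := w1) (SM k) (PP k) T'P fT).
  rewrite (_ : \sum_j _ = measure_sum T').
    by rewrite ler_wpM2l// measure_sum_ge0.
  apply: eq_bigr => j _; congr fine.
  apply: (fa_measure_eq (p := p)); [exact: (FT' j).1|exact: (T'P j).1|].
  by rewrite (FT' j).2 (T'P j).2.
rewrite -(wtE _ _ (sa_mu beta) F).
apply: (le_trans wF); rewrite (wtE _ _ (sa_mu alpha) id).
apply: (@le_trans _ _ (\sum_k (lognorm' mN f (S k) + e))).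
  by apply: ler_sum => k _; exact: (selP k).2.
rewrite big_split /= sumr_const.
apply: (@le_trans _ _ ((lognorm mM mN f + d / 2) + d / 2)); last first.
  by rewrite -addrA -splitr.
apply: lerD; first exact: ltW.
rewrite -[_ *+ _]mulr_natr /e mulrAC ler_pdivrMr// ler_wpM2l ?(ltW d2)//.
by rewrite ler_nat leqnSn.
Qed.

Theorem corollary16p4 (R : realType) (n : nat) (G : groupType)
    (hG : type_FP n.+1 G) (alpha : standard_action R G)
    (eps : R) (heps : 0 < eps) :
  (forall (Z : coefficients) (C : aug_complex (trivial_module Z G)),
     is_free_resolution C ->
     exists beta : standard_action R G,
       ergodic beta /\ (medim n C beta <= medim n C alpha + eps%:E)%E) /\
  (forall C : aug_complex (trivial_module IntCoef G),
     is_free_resolution C ->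
     exists beta : standard_action R G,
       ergodic beta /\ (mevol n C beta <= mevol n C alpha + eps%:E)%E).
Proof.
split=> [Z C fC|C fC]; first exact: medim_ergodic.
exact: mevol_ergodic.
Qed.
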